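(* Let $x=a\otimes\eta\otimes\widetilde f\in \Omega_{n\delta}^{0}\otimes\wedge^p\mathfrak{s}^\ast\otimes\mathcal{F}^{\otimes q}$ and $y=\omega\otimes\zeta\otimes\widetilde g\in\Omega_{n\delta}^{1}\otimes\wedge^{p'}\mathfrak{s}^\ast\otimes\mathcal{F}^{\otimes q'}$, and put $$x\ast y:=(-1)^{qp'}\,x\cup y .$$ Then the coboundary $D$ of the total complex, given on $C^{p,q}$ by $$D=d_{\rm CE}+(-1)^p b_N^\ast:\ C^{p,q}(\Omega_{n\delta}^{\leq1},\mathfrak{s}^\ast,\mathcal{F})\to C^{p+1,q}(\Omega_{n\delta}^{\leq1},\mathfrak{s}^\ast,\mathcal{F})\oplus C^{p,q+1}(\Omega_{n\delta}^{\leq1},\mathfrak{s}^\ast,\mathcal{F}),$$ is a graded derivation with respect to $\ast$, i.e. $$D(x\ast y)=D(x)\ast y+(-1)^{p+q}\,x\ast D(y).$$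
   Context: Ground field $\mathbb{C}$; $n\ge 1$ fixed; sums over repeated indices are understood. Coproducts are written $f_{(1)}\otimes f_{(2)}$, right coactions $m_{\langle0\rangle}\otimes m_{\langle1\rangle}$, left coactions $m_{\langle-1\rangle}\otimes m_{\langle0\rangle}$. Lie algebras. $W_n$ is the Lie algebra of formal vector fields $\sum_i f^i\partial_i$ on $\mathbb{R}^n$ ($f^i$ formal power series in $x^1,\dots,x^n$). $\mathfrak{s}\cong g\ell_n^{\rm aff}$ is the subalgebra spanned by all $\partial_i$ and $x^j\partial_i$, and $\mathfrak{n}$ is the subalgebra of fields whose coefficients vanish to order $\ge2$ at $0$, so $W_n=\mathfrak{s}\oplus\mathfrak{n}$ as vector spaces. For $\xi\in\mathfrak{n}$, $X\in\mathfrak{s}$ write $[\xi,X]=\xi\triangleright X+\xi\triangleleft X$ with $\xi\triangleright X\in\mathfrak{s}$, $\xi\triangleleft X\in\mathfrak{n}$. These extend to a left action $v\triangleright X$ of $U(\mathfrak{n})$ on $\mathfrak{s}$ and a right action $v\triangleleft X$ of $\mathfrak{s}$ on $U(\mathfrak{n})$, determined by $vX=(v_{(1)}\triangleright X)v_{(2)}+v\triangleleft X$ in $U(W_n)$. The Hopf algebra $\mathcal{F}=\mathcal{F}(N)$. $N=\{\psi\in{\rm Diff}(\mathbb{R}^n):\psi(0)=0,\ \psi'(0)={\rm Id}\}$ and $\mathcal{F}$ is the commutative Hopf algebra of regular functions on $N$, generated by $\alpha^i_{jk_1\dots k_r}(\psi)=\partial_{k_r}\cdots\partial_{k_1}\partial_j\psi^i(x)|_{x=0}$.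 There is a non-degenerate Hopf pairing $\langle\ ,\ \rangle$ between $U(\mathfrak{n})$ and $\mathcal{F}$. $\mathfrak{s}$ acts on $\mathcal{F}$ by derivations, $\langle v,X\triangleright f\rangle=\langle v\triangleleft X,f\rangle$. $\mathcal{F}$ coacts on $\mathfrak{s}$ from the right by $X_{\langle0\rangle}\langle v,X_{\langle1\rangle}\rangle=v\triangleright X$; the transposed left coaction on $\mathfrak{s}^\ast$, $\eta_{\langle-1\rangle}\langle\eta_{\langle0\rangle},X\rangle=\langle\eta,X_{\langle0\rangle}\rangle X_{\langle1\rangle}$, is extended multiplicatively to $\wedge^\ast\mathfrak{s}^\ast$. Coefficients. $\Omega_n^0$ is the space of formal power series in $x^1,\dots,x^n$, $\Omega_n^1$ that of formal differential 1-forms, $\Omega_n^{\le1}=\Omega_n^0\oplus\Omega_n^1$, with $W_n$ acting by Lie derivative. The right $\mathcal{F}$-coaction on $\Omega_n^{\le1}$ is given by $\omega_{\langle0\rangle}\langle v,\omega_{\langle1\rangle}\rangle=v\cdot\omega$, $v\in U(\mathfrak{n})$; tensor products with spaces of formal forms are completed (coefficientwise in powers of $x$) as needed. As a space $\Omega_{n\delta}^{\bullet}=\Omega_n^{\bullet}$ (the index $\delta$ records a twist that does not enter the formulas below). Actions on tensors. For $h\in\mathcal{F}$: $h\cdot(g^1\otimes\cdots\otimes g^r)=h_{(1)}g^1\otimes\cdots\otimes h_{(r)}g^r$ (and $h\cdot 1=\varepsilon(h)$ if $r=0$). For $X\in\mathfrak{s}$: $X\bullet(f^1\otimes\cdots\otimes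 f^q)=\sum_{i=1}^q f^1\otimes\cdots\otimes f^{i-1}\otimes X_{\langle0\rangle}\triangleright f^i\otimes X_{\langle1\rangle}\cdot(f^{i+1}\otimes\cdots\otimes f^q)$. Bicomplex. $C^{p,q}(\Omega_{n\delta}^{\le1},\mathfrak{s}^\ast,\mathcal{F})=\Omega_{n\delta}^{\le1}\otimes\wedge^p\mathfrak{s}^\ast\otimes\mathcal{F}^{\otimes q}$, with $$b_N^\ast(\omega\otimes\eta\otimes f^1\otimes\cdots\otimes f^q)=\omega\otimes\eta\otimes1\otimes f^1\otimes\cdots\otimes f^q+\sum_{i=1}^q(-1)^i\omega\otimes\eta\otimes f^1\otimes\cdots\otimes\Delta(f^i)\otimes\cdots\otimes f^q+(-1)^{q+1}\omega_{\langle0\rangle}\otimes\eta_{\langle0\rangle}\otimes f^1\otimes\cdots\otimes f^q\otimes S(\omega_{\langle1\rangle})\eta_{\langle-1\rangle},$$ $$d_{\rm CE}(\omega\otimes\eta\otimes\widetilde f)=\omega\otimes d_{\rm DR}(\eta)\otimes\widetilde f-X_i\cdot\omega\otimes\upsilon^i\wedge\eta\otimes\widetilde f-\omega\otimes\upsilon^i\wedge\eta\otimes X_i\bullet\widetilde f,$$ where $\{X_i\}$ is a basis of $\mathfrak{s}$ with dual basis $\{\upsilon^i\}$, and $d_{\rm DR}:\wedge^p\mathfrak{s}^\ast\to\wedge^{p+1}\mathfrak{s}^\ast$ is the graded derivation with $d_{\rm DR}(\upsilon^k)=\frac12C^k_{ij}\upsilon^i\wedge\upsilon^j$, $[X_i,X_j]=C^k_{ij}X_k$.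 Product. For $a\in\Omega^0_{n\delta}$, $\omega\in\Omega^1_{n\delta}$: $$(a\otimes\eta\otimes\widetilde f)\cup(\omega\otimes\zeta\otimes\widetilde g)=a_{\langle0\rangle}\omega\otimes\eta_{\langle0\rangle}\wedge\zeta\otimes\widetilde f\otimes S(a_{\langle1\rangle})\eta_{\langle-1\rangle}\cdot\widetilde g .$$ The product $\ast$ is extended bilinearly, with sign $(-1)^{qp'}$ determined by the bidegrees $(p,q)$ and $(p',q')$ of the factors. *)

(* Defs.v *)
From HB Require Import structures.
From mathcomp Require Import all_boot all_order all_algebra.
From mathcomp Require Import all_classical all_reals all_analysis.
From mathcomp.real_closed Require Import complex.
Set Implicit Arguments.
Unset Strict Implicit.
Unset Printing Implicit Defensive.
Import Order.TTheory GRing.Theory Num.Theory.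
Import numFieldNormedType.Exports.
Local Open Scope ring_scope.
Local Open Scope quotient_scope.
Local Open Scope complex_scope.

(* U(g) is the associative unital K-algebra presented by generators uea_gen x
   (x in g), linear in x, and relations xy - yx = [x, y]: formal algebra
   expressions modulo the least congruence containing the algebra axioms and
   these relations. *)
Section EnvelopingAlgebra.
Variables (K : fieldType) (g : lmodType K) (br : g -> g -> g).

Inductive uexpr : Type :=
| UGen of g | UZero | UOne
| UAdd of uexpr & uexpr | UMul of uexpr & uexpr | UScale of K & uexpr.

Inductive ueq : uexpr -> uexpr -> Prop :=
| ueq_refl a : ueq a a
| ueq_sym a b : ueq a b -> ueq b a
| ueq_trans a b c : ueq a b -> ueq b c -> ueq a c
| ueq_add a a' b b' : ueq a a' -> ueq b b' -> ueq (UAdd a b) (UAdd a' b')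
| ueq_mul a a' b b' : ueq a a' -> ueq b b' -> ueq (UMul a b) (UMul a' b')
| ueq_scale k a a' : ueq a a' -> ueq (UScale k a) (UScale k a')
| ueq_addA a b c : ueq (UAdd a (UAdd b c)) (UAdd (UAdd a b) c)
| ueq_addC a b : ueq (UAdd a b) (UAdd b a)
| ueq_add0 a : ueq (UAdd UZero a) a
| ueq_addN a : ueq (UAdd (UScale (-1) a) a) UZero
| ueq_mulA a b c : ueq (UMul a (UMul b c)) (UMul (UMul a b) c)
| ueq_1mul a : ueq (UMul UOne a) a
| ueq_mul1 a : ueq (UMul a UOne) a
| ueq_mulDl a b c : ueq (UMul (UAdd a b) c) (UAdd (UMul a c) (UMul b c))
| ueq_mulDr a b c : ueq (UMul a (UAdd b c)) (UAdd (UMul a b) (UMul a c))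
| ueq_scaleA k l a : ueq (UScale k (UScale l a)) (UScale (k * l) a)
| ueq_scale1 a : ueq (UScale 1 a) a
| ueq_scaleDr k a b : ueq (UScale k (UAdd a b)) (UAdd (UScale k a) (UScale k b))
| ueq_scaleDl k l a : ueq (UScale (k + l) a) (UAdd (UScale k a) (UScale l a))
| ueq_scaleMl k a b : ueq (UScale k (UMul a b)) (UMul (UScale k a) b)
| ueq_scaleMr k a b : ueq (UScale k (UMul a b)) (UMul a (UScale k b))
| ueq_genD x y : ueq (UGen (x + y)) (UAdd (UGen x) (UGen y))
| ueq_genZ k x : ueq (UGen (k *: x)) (UScale k (UGen x))
| ueq_genB x y : ueq (UAdd (UMul (UGen x) (UGen y))
                           (UScale (-1) (UMul (UGen y) (UGen x))))
                     (UGen (br x y)).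

HB.instance Definition _ := gen_eqMixin uexpr.
HB.instance Definition _ := gen_choiceMixin uexpr.

Definition ueqb (a b : uexpr) : bool := `[< ueq a b >].

Lemma ueqb_refl : reflexive ueqb.
Proof. by move=> a; apply/asboolP; exact: ueq_refl. Qed.
Lemma ueqb_sym : symmetric ueqb.
Proof. by move=> a b; apply/asboolP/asboolP; exact: ueq_sym. Qed.
Lemma ueqb_trans : transitive ueqb.
Proof.
by move=> b a c /asboolP ab /asboolP bc; apply/asboolP; exact: ueq_trans ab bc.
Qed.
Canonical ueqb_equiv := EquivRel ueqb ueqb_refl ueqb_sym ueqb_trans.

Definition uea : Type := {eq_quot ueqb}.
HB.instance Definition _ := Choice.on uea.
HB.instance Definition _ := EqQuotient.on uea.

Definition ucls (a : uexpr) : uea := \pi_uea a.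

Lemma ucls_ind (P : uea -> Prop) : (forall a, P (ucls a)) -> forall u, P u.
Proof. by move=> Pcls; elim/quotW=> a; exact: Pcls. Qed.
Lemma ueaP (a b : uexpr) : ueq a b -> ucls a = ucls b.
Proof. by move=> ab; apply/eqmodP/asboolP. Qed.
Lemma ueq_repr (a : uexpr) : ueq (repr (ucls a)) a.
Proof.
apply/asboolP; rewrite -[`[< _ >]]/(ueqb_equiv _ _) -eqmodE.
by apply/eqP; exact: reprK.
Qed.

Definition uea_add (u v : uea) : uea := ucls (UAdd (repr u) (repr v)).
Definition uea_mul (u v : uea) : uea := ucls (UMul (repr u) (repr v)).
Definition uea_scale (k : K) (u : uea) : uea := ucls (UScale k (repr u)).

Lemma uea_addE a b : uea_add (ucls a) (ucls b) = ucls (UAdd a b).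
Proof. by apply: ueaP; apply: ueq_add; exact: ueq_repr. Qed.
Lemma uea_mulE a b : uea_mul (ucls a) (ucls b) = ucls (UMul a b).
Proof. by apply: ueaP; apply: ueq_mul; exact: ueq_repr. Qed.
Lemma uea_scaleE k a : uea_scale k (ucls a) = ucls (UScale k a).
Proof. by apply: ueaP; apply: ueq_scale; exact: ueq_repr. Qed.
Let ueaE := (uea_addE, uea_mulE, uea_scaleE).

Fixpoint uaug (a : uexpr) : K :=
  match a with
  | UGen _ => 0 | UZero => 0 | UOne => 1
  | UAdd b c => uaug b + uaug c
  | UMul b c => uaug b * uaug c
  | UScale k b => k * uaug b
  end.

Lemma ueq_uaug a b : ueq a b -> uaug a = uaug b.
Proof.
elim=> //=; intros; rewrite ?mul0r ?mulr0 ?add0r ?addr0 ?mul1r ?mulr1 //;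
  rewrite ?mulrA ?addrA ?mulrDl ?mulrDr //; try congruence.
- by rewrite addrC.
- by rewrite mulN1r addNr.
- by rewrite (mulrC k) .
Qed.

Fact uea_addA : associative uea_add.
Proof.
elim/ucls_ind=> a; elim/ucls_ind=> b; elim/ucls_ind=> c.
by rewrite !ueaE; apply: ueaP; exact: ueq_addA.
Qed.
Fact uea_addC : commutative uea_add.
Proof.
by elim/ucls_ind=> a; elim/ucls_ind=> b; rewrite !ueaE; apply: ueaP; exact: ueq_addC.
Qed.
Fact uea_add0 : left_id (ucls UZero) uea_add.
Proof. by elim/ucls_ind=> a; rewrite !ueaE; apply: ueaP; exact: ueq_add0. Qed.
Fact uea_addN : left_inverse (ucls UZero) (uea_scale (-1)) uea_add.
Proof. by elim/ucls_ind=> a; rewrite !ueaE; apply: ueaP; exact: ueq_addN. Qed.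
HB.instance Definition _ :=
  GRing.isZmodule.Build uea uea_addA uea_addC uea_add0 uea_addN.

Fact uea_mulA : associative uea_mul.
Proof.
elim/ucls_ind=> a; elim/ucls_ind=> b; elim/ucls_ind=> c.
by rewrite !ueaE; apply: ueaP; exact: ueq_mulA.
Qed.
Fact uea_1mul : left_id (ucls UOne) uea_mul.
Proof. by elim/ucls_ind=> a; rewrite !ueaE; apply: ueaP; exact: ueq_1mul. Qed.
Fact uea_mul1 : right_id (ucls UOne) uea_mul.
Proof. by elim/ucls_ind=> a; rewrite !ueaE; apply: ueaP; exact: ueq_mul1. Qed.
Fact uea_mulDl : left_distributive uea_mul uea_add.
Proof.
elim/ucls_ind=> a; elim/ucls_ind=> b; elim/ucls_ind=> c.
by rewrite !ueaE; apply: ueaP; exact: ueq_mulDl.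
Qed.
Fact uea_mulDr : right_distributive uea_mul uea_add.
Proof.
elim/ucls_ind=> a; elim/ucls_ind=> b; elim/ucls_ind=> c.
by rewrite !ueaE; apply: ueaP; exact: ueq_mulDr.
Qed.
Fact uea_1neq0 : (ucls UOne) != 0.
Proof.
apply/eqP => /eqmodP /asboolP /ueq_uaug /eqP.
by rewrite /= oner_eq0.
Qed.
HB.instance Definition _ := GRing.Zmodule_isNzRing.Build uea
  uea_mulA uea_1mul uea_mul1 uea_mulDl uea_mulDr uea_1neq0.

Fact uea_scaleA k l u : uea_scale k (uea_scale l u) = uea_scale (k * l) u.
Proof. by elim/ucls_ind: u => a; rewrite !ueaE; apply: ueaP; exact: ueq_scaleA. Qed.
Fact uea_scale1 : left_id 1 uea_scale.
Proof. by elim/ucls_ind=> a; rewrite !ueaE; apply: ueaP; exact: ueq_scale1. Qed.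
Fact uea_scaleDr : right_distributive uea_scale +%R.
Proof.
move=> k; elim/ucls_ind=> a; elim/ucls_ind=> b.
by rewrite /GRing.add /= !ueaE; apply: ueaP; exact: ueq_scaleDr.
Qed.
Fact uea_scaleDl u : {morph uea_scale^~ u : k l / k + l}.
Proof.
elim/ucls_ind: u => a k l /=.
by rewrite {2}/GRing.add /= !ueaE; apply: ueaP; exact: ueq_scaleDl.
Qed.
HB.instance Definition _ := GRing.Zmodule_isLmodule.Build K uea
  uea_scaleA uea_scale1 uea_scaleDr uea_scaleDl.

Fact uea_scaleMl (k : K) (u v : uea) : k *: (u * v) = (k *: u) * v.
Proof.
elim/ucls_ind: u => a; elim/ucls_ind: v => b.
by rewrite /GRing.scale /GRing.mul /= !ueaE; apply: ueaP; exact: ueq_scaleMl.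
Qed.
HB.instance Definition _ := GRing.Lmodule_isLalgebra.Build K uea uea_scaleMl.
Fact uea_scaleMr (k : K) (u v : uea) : k *: (u * v) = u * (k *: v).
Proof.
elim/ucls_ind: u => a; elim/ucls_ind: v => b.
by rewrite /GRing.scale /GRing.mul /= !ueaE; apply: ueaP; exact: ueq_scaleMr.
Qed.
HB.instance Definition _ := GRing.Lalgebra_isAlgebra.Build K uea uea_scaleMr.

Definition uea_gen (x : g) : uea := ucls (UGen x).

Definition uea_word (w : seq g) : uea := \prod_(x <- w) uea_gen x.

End EnvelopingAlgebra.

Section EnvelopingMap.
Variables (K : fieldType) (g h : lmodType K).
Variables (brg : g -> g -> g) (brh : h -> h -> h) (f : g -> h).

Fixpoint umap (a : uexpr g) : uexpr h :=
  match a with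
  | UGen x => UGen (f x) | UZero => UZero _ | UOne => UOne _
  | UAdd a b => UAdd (umap a) (umap b)
  | UMul a b => UMul (umap a) (umap b)
  | UScale k a => UScale k (umap a)
  end.

(* The algebra morphism U(g) -> U(h) induced by a morphism f of Lie algebras. *)
Definition uea_map (u : uea brg) : uea brh := ucls brh (umap (repr u)).

Hypotheses (fD : {morph f : x y / x + y}) (fZ : forall k, {morph f : x / k *: x})
  (fB : {morph f : x y / brg x y >-> brh x y}).

Lemma ueq_umap a b : ueq brg a b -> ueq brh (umap a) (umap b).
Proof.
elim=> /=; intros; first
  [ by rewrite fD; exact: ueq_genD | by rewrite fZ; exact: ueq_genZ
  | by rewrite fB; exact: ueq_genB | by constructor
  | by apply: ueq_sym | by apply: ueq_trans; eassumption ].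
Qed.

Lemma uea_map_cls a : uea_map (ucls brg a) = ucls brh (umap a).
Proof. by apply: ueaP; apply: ueq_umap; exact: ueq_repr. Qed.

End EnvelopingMap.

(* For v = x1 ... xr in U(g), the xi being primitive,
   v_(1) (x) v_(2) = \sum_((w1, w2) <- unshuffles [:: x1; ...; xr]) w1 (x) w2,
   the sum over the two-part splittings of x1 ... xr into subwords. *)
Fixpoint unshuffles (T : Type) (w : seq T) : seq (seq T * seq T) :=
  if w is x :: w' then
    [seq (x :: s.1, s.2) | s <- unshuffles w'] ++
    [seq (s.1, x :: s.2) | s <- unshuffles w']
  else [:: ([::], [::])].

Section Diffeomorphisms.
Variables (R : realType) (n : nat).
Implicit Types (g h : 'rV[R]_n -> R^o) (psi phi : 'rV[R]_n -> 'rV[R]_n).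

Definition dpart (i : 'I_n) g : 'rV[R]_n -> R^o := fun x => 'D_('e_i) g x.

(* dparts [:: k1; ...; kr] g = d_kr ... d_k1 g *)
Definition dparts (ks : seq 'I_n) g : 'rV[R]_n -> R^o :=
  foldl (fun h k => dpart k h) g ks.

Definition smooth g : Prop := forall ks x, differentiable (dparts ks g) x.

Definition rcomp psi (i : 'I_n) : 'rV[R]_n -> R^o := fun x => psi x 0 i.

Definition smooth_map psi : Prop := forall i, smooth (rcomp psi i).

Let Cd m g := forall ks x, (size ks <= m)%N -> differentiable (dparts ks g) x.

Let CdS m g : (forall x, differentiable g x) /\ (forall i, Cd m (dpart i g)) <->
  Cd m.+1 g.
Proof.
split=> [[dg dpg] [|k ks] x //= sz|dg]; first exact: (dpg k ks x sz).
by split=> [x|i ks x sz]; [exact: (dg [::])|exact: (dg (i :: ks))].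
Qed.

Let CdW m g : Cd m.+1 g -> Cd m g.
Proof. by move=> dg ks x sz; apply: dg; exact: leqW. Qed.

Let Cd_sum m k (F : 'I_k -> 'rV[R]_n -> R^o) :
  (forall j, Cd m (F j)) -> Cd m (\sum_(j < k) F j).
Proof.
elim: m F => [|m IH] F dF.
  by case=> [|//] x _ /=; apply: differentiable_sum => j; exact: (dF j [::]).
apply/CdS; split=> [x|i].
  by apply: differentiable_sum => j; exact: (dF j [::]).
have -> : dpart i (\sum_(j < k) F j) = \sum_(j < k) dpart i (F j).
  rewrite /dpart; apply/funext => x; rewrite derive_sum ?fct_sumE// => j.
  by apply: diff_derivable; exact: (dF j [::]).
by apply: IH => j; have /CdS[] := dF j.
Qed.

Let CdM m g h : Cd m g -> Cd m h -> Cd m (g * h).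
Proof.
elim: m g h => [|m IH] g h dg dh.
  by case=> [|//] x _ /=; apply: differentiableM; [exact: (dg [::])|exact: (dh [::])].
apply/CdS; split=> [x|i].
  by apply: differentiableM; [exact: (dg [::])|exact: (dh [::])].
have -> : dpart i (g * h) =
    \sum_(j < 2) (if j == 0 then g * dpart i h else dpart i g * h).
  rewrite big_ord_recl big_ord1 /=; apply/funext => x; rewrite /dpart deriveM.
  - by rewrite /GRing.add /GRing.mul /= /GRing.scale /= (mulrC (h x)).
  - by apply: diff_derivable; exact: (dg [::]).
  - by apply: diff_derivable; exact: (dh [::]).
apply: Cd_sum => j; case: ifP => _; apply: IH.
- exact: CdW.
- by have /CdS[] := dh.
- by have /CdS[] := dg.
- exact: CdW.
Qed.

Let rcompE psi : psi = \sum_(j < n) (fun x => rcomp psi j x *: 'e_j).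
Proof. by apply/funext => x; rewrite fct_sumE [LHS]row_sum_delta. Qed.

Let diff_map psi x :
  (forall i, differentiable (rcomp psi i) x) -> differentiable psi x.
Proof.
move=> dpsi; rewrite (rcompE psi).
by apply: differentiable_sum => j; exact: differentiableZl.
Qed.

Let dpart_comp g psi i :
  (forall x, differentiable g x) ->
  (forall j x, differentiable (rcomp psi j) x) ->
  dpart i (g \o psi) =
  \sum_(j < n) (dpart j g \o psi) * dpart i (rcomp psi j).
Proof.
move=> dg dpsi; apply/funext => x.
have dpx : differentiable psi x by exact: diff_map.
have dgp : differentiable (g \o psi) x by exact: differentiable_comp.
rewrite /dpart deriveE// diff_comp//= fct_sumE.
have -> : 'd psi x 'e_i = \sum_(j < n) 'D_('e_i) (rcomp psi j) x *: 'e_j.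
  rewrite -deriveE// [LHS]row_sum_delta; apply: eq_bigr => j _; congr (_ *: _).
  by rewrite derive_mx ?mxE//; exact: diff_derivable.
rewrite linear_sum; apply: eq_bigr => j _.
by rewrite linearZ /= -deriveE// mulrC.
Qed.

Lemma smooth_comp g psi : smooth g -> smooth_map psi -> smooth (g \o psi).
Proof.
move=> sg spsi.
suff H m g' : smooth g' -> Cd m (g' \o psi).
  by move=> ks x; exact: (H (size ks) g sg ks x (leqnn _)).
elim: m g' => [|m IH] g' sg'.
  case=> [|//] x _ /=; apply: differentiable_comp; last exact: (sg' [::]).
  by apply: diff_map => i; exact: (spsi i [::]).
apply/CdS; split=> [x|i].
  apply: differentiable_comp; last exact: (sg' [::]).
  by apply: diff_map => j; exact: (spsi j [::]).
rewrite dpart_comp; [|exact: (sg' [::])|by move=> j; exact: (spsi j [::])].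
apply: Cd_sum => j; apply: CdM.
- by apply: IH => ks x; exact: (sg' (j :: ks)).
- by move=> ks x _; exact: (spsi j (i :: ks)).
Qed.

Lemma smooth_map_comp psi phi :
  smooth_map psi -> smooth_map phi -> smooth_map (psi \o phi).
Proof.
by move=> spsi sphi i; exact: (smooth_comp (spsi i) sphi).
Qed.

(* bwd is the inverse of the diffeomorphism fwd. *)
Record diffeo0 : Type := Diffeo0 {
  fwd :> 'rV[R]_n -> 'rV[R]_n;
  bwd : 'rV[R]_n -> 'rV[R]_n;
  fwdK : cancel fwd bwd;
  bwdK : cancel bwd fwd;
  smooth_fwd : smooth_map fwd;
  smooth_bwd : smooth_map bwd;
  fwd0 : fwd 0 = 0;
  dfwd0 : forall i j, dpart j (rcomp fwd i) 0 = (i == j)%:R }.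

Lemma diffeo0_eq (psi phi : diffeo0) : fwd psi =1 fwd phi -> psi = phi.
Proof.
case: psi phi => f b fK bK sf sb f0 df0 [f' b' fK' bK' sf' sb' f0' df0'] /= ff'.
have {ff'} ? : f = f' by exact/funext.
subst f'.
have ? : b = b' by apply/funext => x; rewrite -{1}(bK' x) fK.
by subst b'; congr Diffeo0; exact: Prop_irrelevance.
Qed.

Let rcomp_id i : rcomp id i = (fun x => x 0 i). Proof. by []. Qed.

Let smooth_lin g : (forall x, differentiable g x) ->
  (forall i, exists c : R^o, dpart i g = cst c) -> smooth g.
Proof.
move=> dg cg [|k ks] x //=.
have [c ->] := cg k.
elim: ks c => [|k' ks IH] c /=; first exact: differentiable_cst.
suff -> : dpart k' (cst c) = cst 0 by exact: IH.
by apply/funext => y; rewrite /dpart derive_cst.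
Qed.

Let dpart_id i j : dpart j (rcomp id i) = cst (i == j)%:R.
Proof.
apply/funext => x; rewrite /dpart /rcomp.
have -> : 'D_('e_j) (fun x : 'rV[R]_n => x 0 i : R^o) x =
    ('D_('e_j) id x : 'rV[R]_n) 0 i.
  by rewrite [in RHS]derive_mx ?mxE//; exact: derivable_id.
by rewrite derive_id mxE eqxx.
Qed.

Let smooth_id : smooth_map id.
Proof.
move=> i; apply: smooth_lin => [x|j]; first exact: differentiable_coord.
by exists (i == j)%:R; exact: dpart_id.
Qed.

Let dpart_id0 i j : dpart j (rcomp id i) 0 = (i == j)%:R.
Proof. by rewrite dpart_id. Qed.

Definition oneN : diffeo0 :=
  Diffeo0 (fun _ => erefl) (fun _ => erefl) smooth_id smooth_id erefl dpart_id0.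

Let mulN_fwd0 (psi phi : diffeo0) : (psi \o phi) 0 = 0 :> 'rV[R]_n.
Proof. by rewrite /= !fwd0. Qed.

Let mulN_dfwd0 (psi phi : diffeo0) i j :
  dpart j (rcomp (psi \o phi) i) 0 = (i == j)%:R.
Proof.
have -> : rcomp (psi \o phi) i = rcomp psi i \o phi by [].
rewrite dpart_comp => [||k x]; last 2 first.
- exact: (smooth_fwd psi i [::]).
- exact: (smooth_fwd phi k [::]).
rewrite fct_sumE (bigD1 i)//= big1 => [|k /negPf ki].
  by rewrite addr0 /GRing.mul /= fwd0 !dfwd0 eqxx mul1r.
by rewrite /GRing.mul /= fwd0 !dfwd0 eq_sym ki mul0r.
Qed.

Definition mulN (psi phi : diffeo0) : diffeo0 :=
  Diffeo0 (can_comp (fwdK psi) (fwdK phi)) (can_comp (bwdK phi) (bwdK psi))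
    (smooth_map_comp (smooth_fwd psi) (smooth_fwd phi))
    (smooth_map_comp (smooth_bwd phi) (smooth_bwd psi))
    (mulN_fwd0 psi phi) (mulN_dfwd0 psi phi).

Let bwd0 (psi : diffeo0) : bwd psi 0 = 0.
Proof. by rewrite -[in LHS](fwd0 psi) fwdK. Qed.

Let dbwd0 (psi : diffeo0) i j : dpart j (rcomp (bwd psi) i) 0 = (i == j)%:R.
Proof.
have <- : dpart j (rcomp (bwd psi \o psi) i) 0 = (i == j)%:R.
  by rewrite -dpart_id0; congr (dpart _ _ _); apply/funext => x; rewrite /rcomp /= fwdK.
have -> : rcomp (bwd psi \o psi) i = rcomp (bwd psi) i \o psi by [].
rewrite dpart_comp => [||k x]; last 2 first.
- exact: (smooth_bwd psi i [::]).
- exact: (smooth_fwd psi k [::]).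
rewrite fct_sumE (bigD1 j)//= big1 => [|k /negPf kj].
  by rewrite addr0 /GRing.mul /= fwd0 dfwd0 eqxx mulr1.
by rewrite /GRing.mul /= fwd0 dfwd0 kj mulr0.
Qed.

Definition invN (psi : diffeo0) : diffeo0 :=
  Diffeo0 (bwdK psi) (fwdK psi) (smooth_bwd psi) (smooth_fwd psi)
    (bwd0 psi) (dbwd0 psi).

(* psi1 o ... o psir *)
Definition prodN (l : seq diffeo0) : diffeo0 := foldr mulN oneN l.

(* alpha i j [:: k1; ...; kr] psi = d_kr ... d_k1 d_j psi^i (0) *)
Definition alpha (i j : 'I_n) (ks : seq 'I_n) (psi : diffeo0) : R[i] :=
  (dparts (j :: ks) (rcomp psi i) 0)%:C.

End Diffeomorphisms.

Section FormalVectorFields.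
Variables (R : realType) (n : nat).

Definition mindex : Type := {ffun 'I_n -> nat}.

Definition mdeg (K : mindex) : nat := (\sum_i K i)%N.

Definition mzero : mindex := [ffun=> 0%N].

Definition munit (j : 'I_n) : mindex := [ffun k => (k == j) : nat].

(* Omega^0 = C[[x^1, ..., x^n]]: f K is the coefficient of x^K. *)
Definition fps : Type := mindex -> R[i]^o.
HB.instance Definition _ := GRing.Lmodule.on fps.

Definition fpsX (K : mindex) : fps := fun J => (J == K)%:R.

(* The box of indices 0 <= J i <= |K| contains every J <= K. *)
Definition fps_mul (f g : fps) : fps := fun K =>
  \sum_(J : {ffun 'I_n -> 'I_(mdeg K).+1} | [forall i, (J i <= K i)%N])
    f [ffun i => nat_of_ord (J i)] * g [ffun i => (K i - J i)%N].

Definition fps_d (i : 'I_n) (f : fps) : fps := fun K =>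
  (K i).+1%:R * f [ffun j => (K j + (j == i))%N].

(* W_n: w i is the coefficient of d_i. *)
Definition vfield : Type := 'I_n -> fps.
HB.instance Definition _ := GRing.Lmodule.on vfield.

Definition vbr (v w : vfield) : vfield := fun i =>
  \sum_j (fps_mul (v j) (fps_d j (w i)) - fps_mul (w j) (fps_d j (v i))).

(* Omega^1: w i is the coefficient of dx^i. *)
Definition form1 : Type := 'I_n -> fps.
HB.instance Definition _ := GRing.Lmodule.on form1.

(* Omega^{<= 1} = Omega^0 (+) Omega^1 *)
Definition forms : Type := (fps * form1)%type.
HB.instance Definition _ := GRing.Lmodule.on forms.

(* The Lie derivatives of functions, of 1-forms, and of both. *)
Definition lie0 (v : vfield) (a : fps) : fps :=
  \sum_j fps_mul (v j) (fps_d j a).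
Definition lie1 (v : vfield) (w : form1) : form1 := fun i =>
  \sum_j (fps_mul (v j) (fps_d j (w i)) + fps_mul (w j) (fps_d i (v j))).
Definition lie (v : vfield) (w : forms) : forms := (lie0 v w.1, lie1 v w.2).

(* The product Omega^0 x Omega^1 -> Omega^1; the other components of its
   arguments are ignored. *)
Definition form_mul (a w : forms) : forms := (0, fun i => fps_mul a.1 (w.2 i)).

(* s is identified with C^sidx through its basis: inl i stands for d_i and
   inr (j, i) for x^j d_i. *)
Definition sidx : finType := ('I_n + 'I_n * 'I_n)%type.

Definition sbasis (b : sidx) : vfield :=
  match b with
  | inl i => fun k => if k == i then fpsX mzero else 0
  | inr (j, i) => fun k => if k == i then fpsX (munit j) else 0
  end.

Definition saff : Type := sidx -> R[i]^o.
HB.instance Definition _ := GRing.Lmodule.on saff.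

Definition sdelta (b : sidx) : saff := fun c => (c == b)%:R.

Definition svec (X : saff) : vfield := \sum_b X b *: sbasis b.

(* The projection W_n -> s along n. *)
Definition sproj (w : vfield) : saff := fun b =>
  match b with
  | inl i => w i mzero
  | inr (j, i) => w i (munit j)
  end.

Definition sbr (X Y : saff) : saff := sproj (vbr (svec X) (svec Y)).

Definition in_n : {pred vfield} :=
  fun w => `[< forall i K, (mdeg K <= 1)%N -> w i K = 0 >].

Fact in_n_submod : submod_closed in_n.
Proof.
split=> [|k v w /asboolP v0 /asboolP w0]; apply/asboolP => i K K1 //.
transitivity (k *: (v i K : R[i]^o) + w i K) => //.
by rewrite v0// w0// scaler0 addr0.
Qed.
HB.instance Definition _ :=
  GRing.isSubmodClosed.Build _ _ in_n in_n_submod.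

Definition nfield : Type := {w : vfield | w \in in_n}.
HB.instance Definition _ := [isSub of nfield for @proj1_sig _ _].
HB.instance Definition _ := [Choice of nfield by <:].
HB.instance Definition _ := [SubChoice_isSubLmodule of nfield by <:].

Fact fps_mul_n (f g : fps) K :
  (forall J, (mdeg J <= 1)%N -> f J = 0) -> (mdeg K <= 1)%N -> fps_mul f g K = 0.
Proof.
move=> f0 K1; rewrite /fps_mul big1// => J /forallP JK.
rewrite f0 ?mul0r//; apply: leq_trans K1.
by apply: leq_sum => i _; rewrite ffunE.
Qed.

Fact vbr_n (v w : nfield) : vbr (val v) (val w) \in in_n.
Proof.
apply/asboolP => i K K1; have /asboolP v0 := valP v; have /asboolP w0 := valP w.
rewrite /vbr fct_sumE big1// => j _.
transitivity (fps_mul (val v j) (fps_d j (val w i)) K -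
              fps_mul (val w j) (fps_d j (val v i)) K) => //.
by rewrite !fps_mul_n ?subr0// => J; [exact: w0|exact: v0].
Qed.

Definition nbr (v w : nfield) : nfield := Sub (vbr (val v) (val w)) (vbr_n v w).

Fact mdeg_le1 (K : mindex) :
  (mdeg K <= 1)%N -> K = mzero \/ exists j, K = munit j.
Proof.
case: (pickP (fun j => K j != 0%N)) => [j Kj K1|K0 _]; last first.
  left; apply/ffunP => i; rewrite ffunE; apply/eqP.
  by have /negbT := K0 i; rewrite negbK.
right; exists j; apply/ffunP => i; rewrite ffunE.
move: K1; rewrite /mdeg (bigD1 j)//=.
case: (eqVneq i j) => [->|ij] /=.
  case: (K j) Kj => [//|[|k]] // _; by rewrite !addSn ltnS ltn0.
rewrite (bigD1 i)//=.
by case: (K j) Kj => [//|k] _; case: (K i) => // l; rewrite addSn addnS.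
Qed.

Let svec_coef X i K :
  svec X i K = \sum_b X b * (sbasis b i K).
Proof. by rewrite /svec !fct_sumE. Qed.

Let svec_inl X i : svec X i mzero = X (inl i).
Proof.
rewrite svec_coef (bigD1 (inl i))//= eqxx /fpsX eqxx mulr1 big1 ?addr0//.
case=> [i'|[j' i']] /= bi; case: eqVneq => [e|_]; rewrite ?mulr0// /fpsX.
- by rewrite e eqxx in bi.
- suff /negPf -> : mzero != munit j' by rewrite mulr0.
  by apply/eqP => /ffunP/(_ j'); rewrite !ffunE eqxx.
Qed.

Let svec_inr X j i : svec X i (munit j) = X (inr (j, i)).
Proof.
rewrite svec_coef (bigD1 (inr (j, i)))//= eqxx /fpsX eqxx mulr1 big1 ?addr0//.
case=> [i'|[j' i']] /= bi; case: eqVneq => [e|_]; rewrite ?mulr0// /fpsX.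
- suff /negPf -> : munit j != mzero by rewrite mulr0.
  by apply/eqP => /ffunP/(_ j); rewrite !ffunE eqxx.
- suff /negPf -> : munit j != munit j' by rewrite mulr0.
  apply: contraNneq bi => /ffunP/(_ j); rewrite !ffunE eqxx -e.
  by case: eqVneq => // ->; rewrite eqxx.
Qed.

Fact nproj_subproof (w : vfield) : w - svec (sproj w) \in in_n.
Proof.
apply/asboolP => i K /mdeg_le1 K1.
transitivity (w i K - svec (sproj w) i K) => //.
by case: K1 => [->|[j ->]]; rewrite ?svec_inl ?svec_inr /= subrr.
Qed.

(* The projection W_n -> n along s. *)
Definition nproj (w : vfield) : nfield :=
  Sub (w - svec (sproj w)) (nproj_subproof w).

(* [xi, X] = act_s xi X + act_n xi X is the decomposition in W_n = s (+) n of
   the bracket of xi in n and X in s. *)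
Definition act_s (xi : nfield) (X : saff) : saff := sproj (vbr (val xi) (svec X)).
Definition act_n (xi : nfield) (X : saff) : nfield := nproj (vbr (val xi) (svec X)).

End FormalVectorFields.

(* F is the algebra of functions on N generated by the alpha^i_{j k1 ... kr};
   F^{(x) q} is realized as the span of the functions
     f1 (x) ... (x) fq : (psi1, ..., psiq) |-> f1(psi1) ... fq(psiq)
   on N^q, whose points are given as lists of length q. The completed tensor
   product of F^{(x) q} with a space M of formal forms is realized by the
   functions on N^q with values in M whose coefficients are in F^{(x) q}.
   The Hopf algebra structure of F is dual to the group structure of N:
     Delta f (psi, phi) = f (psi o phi),  eps f = f Id,  S f psi = f psi^-1. *)
Section RegularFunctions.
Variables (R : realType) (n : nat).
Local Notation N := (diffeo0 R n).

Inductive regular : (N -> R[i]) -> Prop :=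
| regular_alpha i j ks : regular (alpha i j ks)
| regular_cst c : regular (fun=> c)
| regular_add f g : regular f -> regular g -> regular (fun psi => f psi + g psi)
| regular_mul f g : regular f -> regular g -> regular (fun psi => f psi * g psi).

Definition ftens (q : nat) (f : 'I_q -> N -> R[i]) : seq N -> R[i] := fun l =>
  if size l == q then \prod_(i < q) f i (nth (oneN R n) l i) else 0.

Inductive regular_tens (q : nat) : (seq N -> R[i]) -> Prop :=
| regular_tens_pure (f : 'I_q -> N -> R[i]) :
    (forall i, regular (f i)) -> regular_tens q (ftens f)
| regular_tens0 : regular_tens q (fun=> 0)
| regular_tens_lin (c : R[i]) f g : regular_tens q f -> regular_tens q g ->
    regular_tens q (fun l => c * f l + g l).

End RegularFunctions.

(* Words x1 ... xr span U(n); identities linear in v in U(n) are stated for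
   v a word when they involve v_(1) (x) v_(2), eps(v), S(v), or the action of v
   on forms (the composite of the Lie derivatives along x1, ..., xr). *)
Section Pairing.
Variables (R : realType) (n : nat).
Local Notation C := R[i].
Local Notation N := (diffeo0 R n).
Local Notation Un := (uea (@nbr R n)).
Local Notation UW := (uea (@vbr R n)).
Local Notation word := (uea_word (@nbr R n)).

Definition inclU : Un -> UW :=
  uea_map (@vbr R n) (fun xi : nfield R n => val xi).

Variable pr : Un -> (N -> C) -> C.

Record hopf_pairing : Prop := HopfPairing {
  pairing_linl (k : C) u v f : regular f ->
    pr (k *: u + v) f = k * pr u f + pr v f;
  pairing_linr v (k : C) f g : regular f -> regular g ->
    pr v (fun psi => k * f psi + g psi) = k * pr v f + pr v g;
  pairing_1l f : regular f -> pr 1 f = f (oneN R n);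
  (* <u v, f> = <u, f_(1)> <v, f_(2)> *)
  pairing_mull u v f : regular f ->
    pr (u * v) f = pr u (fun psi => pr v (fun phi => f (mulN psi phi)));
  pairing_1r w : pr (word w) (fun=> 1) = (nilp w)%:R;
  (* <v, f g> = <v_(1), f> <v_(2), g> *)
  pairing_mulr w f g : regular f -> regular g ->
    pr (word w) (fun psi => f psi * g psi) =
      \sum_(s <- unshuffles w) pr (word s.1) f * pr (word s.2) g;
  (* S(x1 ... xr) = (-1)^r xr ... x1 *)
  pairing_S w f : regular f ->
    pr ((-1) ^+ size w *: word (rev w)) f = pr (word w) (fun psi => f (invN psi)) }.

Definition nondegenerate_pairing : Prop :=
  (forall v, (forall f, regular f -> pr v f = 0) -> v = 0) /\
  (forall f, regular f -> (forall v, pr v f = 0) -> forall psi, f psi = 0).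

(* tri v X = v |> X and tel v X = v <| X. *)
Variables (tri : Un -> saff R n -> saff R n) (tel : Un -> saff R n -> Un).

Record matched_actions : Prop := MatchedActions {
  tri_linl (k : C) u v X : tri (k *: u + v) X = k *: tri u X + tri v X;
  tri_linr v (k : C) X Y : tri v (k *: X + Y) = k *: tri v X + tri v Y;
  tel_linl (k : C) u v X : tel (k *: u + v) X = k *: tel u X + tel v X;
  tel_linr v (k : C) X Y : tel v (k *: X + Y) = k *: tel v X + tel v Y;
  tri_gen xi X : tri (uea_gen _ xi) X = act_s xi X;
  tel_gen xi X : tel (uea_gen _ xi) X = uea_gen _ (act_n xi X);
  tri_1 X : tri 1 X = X;
  tri_mul u v X : tri (u * v) X = tri u (tri v X);
  tel_br v X Y : tel v (sbr X Y) = tel (tel v X) Y - tel (tel v Y) X;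
  (* v X = (v_(1) |> X) v_(2) + v <| X in U(W_n) *)
  tri_tel w X : inclU (word w) * uea_gen (@vbr R n) (svec X) =
    \sum_(s <- unshuffles w)
      uea_gen (@vbr R n) (svec (tri (word s.1) X)) * inclU (word s.2)
    + inclU (tel (word w) X) }.

(* actF X f = X |> f, for f in F. *)
Variable actF : saff R n -> (N -> C) -> N -> C.

Definition dual_action : Prop := forall X f, regular f ->
  regular (actF X f) /\ forall v, pr v (actF X f) = pr (tel v X) f.

(* coS X psi = X_<0> X_<1>(psi) *)
Variable coS : saff R n -> N -> saff R n.

Definition s_coaction : Prop := forall X b,
  regular (fun psi => coS X psi b) /\
  forall v, pr v (fun psi => coS X psi b) = tri v X b.

(* The coefficients of a form in Omega^{<= 1}: those of its degree 0 part for
   k = None, those of the coefficient of dx^i for k = Some i. *)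
Definition form_coef (k : option 'I_n) (K : mindex n) (w : forms R n) : C :=
  if k is Some i then w.2 i K else w.1 K.

Definition mkform (c : option 'I_n -> mindex n -> C) : forms R n :=
  (fun K => c None K, fun i K => c (Some i) K).

(* coO w psi = w_<0> w_<1>(psi) *)
Variable coO : forms R n -> N -> forms R n.

Definition form_coaction : Prop := forall w k K,
  regular (fun psi => form_coef k K (coO w psi)) /\
  forall v : seq (nfield R n), pr (word v) (fun psi => form_coef k K (coO w psi)) =
    form_coef k K (foldr (fun xi => lie (val xi)) w v).

End Pairing.

(* Elements z of M (x) /\ s^*: z A is the coefficient of the monomial
   upsilon^b1 /\ ... /\ upsilon^bp, where b1, ..., bp are the elements of A in
   the order of enum_rank. *)
Section Exterior.
Variables (R : realType) (n : nat).
Local Notation C := R[i].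
Local Notation I := (sidx n).

Definition ext (M : lmodType C) : Type := {set I} -> M.
HB.instance Definition _ (M : lmodType C) := GRing.Lmodule.on (ext M).

Definition extdeg (M : lmodType C) (p : nat) (z : ext M) : Prop :=
  forall A : {set I}, #|A| != p -> z A = 0.

Definition inversions (A B : {set I}) : nat :=
  #|[set ab in finset.setX A B | (enum_rank ab.2 < enum_rank ab.1)%N]|.

(* (m1 (x) eta) /\ (m2 (x) zeta) = mu m1 m2 (x) (eta /\ zeta) *)
Definition wedge (M1 M2 M3 : lmodType C) (mu : M1 -> M2 -> M3)
    (x : ext M1) (y : ext M2) : ext M3 := fun A =>
  \sum_(B : {set I} | B \subset A)
    (-1) ^+ inversions B (A :\: B) *: mu (x B) (y (A :\: B)).

Definition extC : Type := ext C^o.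
HB.instance Definition _ := GRing.Lmodule.on extC.

Definition wedgeC (M : lmodType C) : extC -> ext M -> ext M :=
  wedge (fun (c : C^o) (m : M) => c *: m).

Definition ext1 : extC := fun A => (A == finset.set0)%:R.

Definition upsilon (b : I) : extC := fun A => (A == [set b]%SET)%:R.

(* phi b1 /\ ... /\ phi bp *)
Definition extmul (phi : I -> extC) (bs : seq I) : extC :=
  foldr (fun b z => wedgeC (phi b) z) ext1 bs.

(* The extension to M (x) /\ s^* of the linear endomorphism of /\ s^* with
   value F [:: b1; ...; bp] at upsilon^b1 /\ ... /\ upsilon^bp. *)
Definition extlin (M : lmodType C) (F : seq I -> extC) (z : ext M) : ext M :=
  fun A => \sum_(B : {set I}) F (enum B) A *: z B.

Definition strC (k i j : I) : C := sbr (sdelta R i) (sdelta R j) k.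

Definition dDR_gen (k : I) : extC :=
  2^-1 *: \sum_i \sum_j strC k i j *: wedgeC (upsilon i) (upsilon j).

Fixpoint dDR_mono (bs : seq I) : extC :=
  if bs is b :: bs' then
    wedgeC (dDR_gen b) (extmul upsilon bs') - wedgeC (upsilon b) (dDR_mono bs')
  else 0.

Definition dDR (M : lmodType C) : ext M -> ext M := extlin dDR_mono.

End Exterior.

Section Bicomplex.
Variables (R : realType) (n : nat).
Local Notation C := R[i].
Local Notation N := (diffeo0 R n).
Local Notation I := (sidx n).

Variable actF : saff R n -> (N -> C) -> N -> C.
Variable coS : saff R n -> N -> saff R n.
Variable coO : forms R n -> N -> forms R n.

(* The ambient space of the total complex: the bidegree (p, q) part is
   supported on the lists of length q, with values of exterior degree p. *)
Definition cochain : Type := seq N -> ext n (forms R n).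
HB.instance Definition _ := GRing.Lmodule.on cochain.

(* C^{p,q}(Omega^{<= 1}, s^*, F) *)
Definition bicomplex (p q : nat) (c : cochain) : Prop :=
  [/\ forall l, size l != q -> c l = 0,
      forall l, extdeg p (c l)
    & forall A k K, regular_tens q (fun l => form_coef k K (c l A))].

(* w (x) eta (x) f *)
Definition pure_tens (w : forms R n) (eta : extC R n) (f : seq N -> C) : cochain :=
  fun l A => (f l * eta A) *: w.

(* The left coaction of F on s^*: upsilon^b_<-1>(psi) upsilon^b_<0>. *)
Definition coSdual (psi : N) (b : I) : extC R n :=
  \sum_c coS (sdelta R c) psi b *: upsilon R c.

(* w (x) eta |-> w_<0> (x) eta_<0> . (S(w_<1>) eta_<-1>)(psi) *)
Definition twist (psi : N) (z : ext n (forms R n)) : ext n (forms R n) :=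
  extlin (extmul (coSdual psi)) (fun A => coO (z A) (invN psi)).

(* Delta applied to the i-th factor, i >= 1:
   (psi1, ..., psi(q+1)) |-> (psi1, ..., psii o psi(i+1), ..., psi(q+1)) *)
Definition contract (i : nat) (l : seq N) : seq N :=
  take i.-1 l ++ mulN (nth (oneN R n) l i.-1) (nth (oneN R n) l i) :: drop i.+1 l.

Definition bN (c : cochain) : cochain := fun l =>
  if l is psi :: l' then
    let q := size l' in
    c l' + \sum_(1 <= i < q.+1) (-1) ^+ i *: c (contract i l)
      + (-1) ^+ q.+1 *: twist (last psi l') (c (belast psi l'))
  else 0.

(* X .bullet f, with X_<0> (x) X_<1> = sum_b X_b (x) (psi |-> coS X psi b): X_b
   acts on f as a function of its i-th variable, and X_<1> on the tail. In
   general h_(1) (x) ... (x) h_(r) is (psi1, ..., psir) |-> h (psi1 o ... o psir),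
   so h . G is the product of G by this function. *)
Definition bullet (X : saff R n) (f : seq N -> C) : seq N -> C := fun l =>
  \sum_(i < size l) \sum_b
    coS X (prodN (drop i.+1 l)) b *
    actF (sdelta R b) (fun phi => f (set_nth (oneN R n) l i phi)) (nth (oneN R n) l i).

Definition bullet_coef (X : saff R n) (c : cochain) : cochain := fun l A =>
  mkform (fun k K => bullet X (fun l' => form_coef k K (c l' A)) l).

Definition dCE (c : cochain) : cochain := fun l =>
  dDR (c l)
  - \sum_b wedgeC (upsilon R b) (fun A => lie (sbasis R b) (c l A))
  - \sum_b wedgeC (upsilon R b) (bullet_coef (sdelta R b) c l).

(* The component of bidegree (p, q). *)
Definition component (p q : nat) (c : cochain) : cochain := fun l A =>
  if (size l == q) && (#|A| == p) then c l A else 0.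

(* totalD is d_CE + (-1)^p b_N on the component of bidegree (p, q); at a list l only
   the components with q <= size l and p <= dim s contribute. *)
Definition totalD (c : cochain) : cochain := fun l =>
  \sum_(p < #|I|.+1) \sum_(q < (size l).+1)
    (dCE (component p q c) l + (-1) ^+ p *: bN (component p q c) l).

(* (a (x) eta (x) f) cup (w (x) zeta (x) g), evaluated at l = l1 ++ l2:
   S(a_<1>) eta_<-1> . g contributes, besides g(l2), the value of
   S(a_<1>) eta_<-1> at the composite of l2. *)
Definition cup (x y : cochain) : cochain := fun l =>
  \sum_(q < (size l).+1)
    wedge (@form_mul R n) (twist (prodN (drop q l)) (x (take q l))) (y (drop q l)).

(* x * y = (-1)^(q p') x cup y for x of bidegree (p, q) and y of bidegree
   (p', q'), extended bilinearly. *)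
Definition star (x y : cochain) : cochain := fun l =>
  \sum_(p < #|I|.+1) \sum_(q < (size l).+1)
  \sum_(p' < #|I|.+1) \sum_(q' < (size l).+1)
    (-1) ^+ (q * p') *: cup (component p q x) (component p' q' y) l.

End Bicomplex.

(* Main.v *)
Require Import Defs.
From HB Require Import structures.
From mathcomp Require Import all_boot all_order all_algebra.
From mathcomp Require Import all_classical all_reals all_analysis.
From mathcomp.real_closed Require Import complex.
From mathcomp Require Import ring.
Set Implicit Arguments.
Unset Strict Implicit.
Unset Printing Implicit Defensive.
Import Order.TTheory GRing.Theory Num.Theory.
Import numFieldNormedType.Exports.
Local Open Scope ring_scope.
Local Open Scope complex_scope.

(**
The coboundary is D = d_CE + (-1)^p b_N, so the derivation property is the sum
of two Leibniz rules for the unsigned product (x of bidegree (p, q)):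
  b_N (x cup y) = b_N x cup y + (-1)^q x cup b_N y,       (bN_cup)
  d_CE (x cup y) = d_CE x cup y + (-1)^p x cup d_CE y.    (dCE_cup)
The factor (-1)^(q p') is what makes the two rules fit together into one rule
with the sign (-1)^(p + q) (leibniz_signs).

A cochain is a function of lists l of elements of N with values in
Omega (x) /\ s^*. Every psi in N acts on these values by the operator twist psi,
through the coaction on Omega composed with the antipode and through the
coaction on /\ s^*. In these terms (cup_cat)
  (x cup y)(l1 ++ l2) = twist psi (x l1) /\ y l2,   psi the composite of l2,
and b_N is the differential of group cochains with coefficients in a module,
twist entering its last face. The twist is multiplicative for the wedge product
(twist_wedge) and for the composition of N (twist_mulN). Hence the last face of
x and the first face of y give the same term with opposite signs, all the other
faces of x cup y are faces of x or of y, and bN_cup follows.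

For d_CE there are two points. The first is how X in s acts on a product: on a
function of l1 it acts through X_<0> (x) X_<1>(psi), with psi the composite
of l2, and on a function of that composite it acts as on a function of one
variable (bullet_cat, bullet_prod, bullet_mul_prod). The second is that the
twist intertwines the differentials: differentiating twist psi z in psi along
s corrects d(twist psi z) into twist psi (d z), where d is the part of d_CE
that ignores F (twist_dLie). Both sides being multiplicative, this reduces to
the generators of /\ s^*, where it is the Maurer-Cartan type identity td_coS_br
for the coaction on s (dtot_coSdual), and to forms, where it is the
compatibility td_coO_inv_actF of the coaction with Lie derivatives.

All this uses only identities between functions on N, collected in the record
twisted_data. The hypotheses give them infinitesimally, on U(n). The pairing
being nondegenerate, a family of regular functions vanishes as soon as its
members vanish at the identity and its span is stable under the left invariant
derivations defined by n (linv_zero). To obtain families with this stability,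
the action of s on F is extended to an action wactF of all of W_n, in which n
acts by left invariant derivations. It is dual to the right action Rop of W_n
on U(n) = U(W_n) / s U(W_n), and a left invariant derivation then changes the
parameter in W_n by a bracket (linv_wactF).

Finally the operators must preserve regularity: products and inverses in N are
polynomial in the coordinates alpha because, in the iterated chain rule, the
difference between a derivative of g o phi and the same derivative of g only
involves lower derivatives of g (chain_rule0).
*)

(** * Regularity of products and inverses in N *)

Lemma unshuffles_rcons (V : nmodType) (T : Type) (w : seq T) (x : T)
    (F : seq T * seq T -> V) :
  \sum_(s <- unshuffles (rcons w x)) F s =
  \sum_(s <- unshuffles w) (F (rcons s.1 x, s.2) + F (s.1, rcons s.2 x)).
Proof.
elim: w F => [|y w IH] F /=.
  by rewrite !big_cons !big_nil !addr0.
by rewrite !big_cat /= !big_map /= !IH.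
Qed.

(** The splitting that keeps the whole word on the left is the leading term of
    the Leibniz rule; all others differentiate the left factor less often. *)
Lemma unshuffles_behead (T : eqType) (w : seq T) :
  exists2 r, unshuffles w = (w, [::]) :: r &
    forall s, s \in r -> (size s.1 < size w)%N.
Proof.
elim: w => [|x w [r wE rlt]] /=; first by exists [::].
rewrite wE /=; eexists; first by [].
move=> s; rewrite mem_cat => /orP[/mapP[t tr ->]|] /=.
  by rewrite ltnS rlt.
rewrite inE => /orP[/eqP -> //=|/mapP[t tr ->]] /=.
by rewrite ltnS ltnW // rlt.
Qed.

Section PartialDerivatives.
Variables (R : realType) (n : nat).
Implicit Types (g h : 'rV[R]_n -> R^o) (ks : seq 'I_n).

Lemma dparts_rcons ks k g : dparts (rcons ks k) g = dpart k (dparts ks g).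
Proof. by rewrite /dparts foldl_rcons. Qed.

Lemma smooth_diff g x : smooth g -> differentiable g x.
Proof. by move=> sg; exact: (sg [::]). Qed.

Lemma smooth_dpart g k : smooth g -> smooth (dpart k g).
Proof. by move=> sg ks; exact: (sg (k :: ks)). Qed.

Lemma dpart_sum (T : Type) (r : seq T) (F : T -> 'rV[R]_n -> R^o) k :
  (forall j x, differentiable (F j) x) ->
  dpart k (\sum_(j <- r) F j) = \sum_(j <- r) dpart k (F j).
Proof.
move=> dF; suff [] : dpart k (\sum_(j <- r) F j) = \sum_(j <- r) dpart k (F j)
   /\ forall x, differentiable (\sum_(j <- r) F j) x by [].
elim: r => [|j r [IH1 IH2]].
  rewrite !big_nil; split; last by move=> x; exact: differentiable_cst.
  apply/funext => x; exact: derive_cst.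
rewrite !big_cons; split; last by move=> x; exact: differentiableD.
rewrite -IH1; apply/funext => x; rewrite /dpart deriveD //.
  exact: diff_derivable.
exact: diff_derivable.
Qed.

Lemma diff_sum (T : Type) (r : seq T) (F : T -> 'rV[R]_n -> R^o) x :
  (forall j, differentiable (F j) x) -> differentiable (\sum_(j <- r) F j) x.
Proof.
move=> dF; elim: r => [|j r IH].
  by rewrite big_nil; exact: differentiable_cst.
by rewrite big_cons; exact: differentiableD.
Qed.

Lemma dpartM g h k : (forall x, differentiable g x) ->
  (forall x, differentiable h x) ->
  dpart k (g * h) = dpart k g * h + g * dpart k h.
Proof.
move=> dg dh; apply/funext => x; rewrite /dpart deriveM; last 2 first.
- exact: diff_derivable.
- exact: diff_derivable.
by rewrite addrC /GRing.scale /= mulrC.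
Qed.

Lemma dparts_sum (T : Type) (r : seq T) (F : T -> 'rV[R]_n -> R^o) ks :
  (forall j, smooth (F j)) ->
  dparts ks (\sum_(j <- r) F j) = \sum_(j <- r) dparts ks (F j).
Proof.
move=> sF; elim/last_ind: ks => [|ks k IH] //.
rewrite dparts_rcons IH dpart_sum //.
  by apply: eq_bigr => j _; rewrite dparts_rcons.
by move=> j; exact: (sF j ks).
Qed.

Lemma dpartsM g h ks : smooth g -> smooth h ->
  dparts ks (g * h) =
  \sum_(s <- unshuffles ks) dparts s.1 g * dparts s.2 h.
Proof.
move=> sg sh; elim/last_ind: ks => [|ks k IH].
  by rewrite big_cons big_nil addr0.
rewrite dparts_rcons IH dpart_sum; last first.
  by move=> s x; apply: differentiableM; [exact: sg|exact: sh].
rewrite unshuffles_rcons; apply: eq_bigr => s _.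
by rewrite dpartM ?dparts_rcons.
Qed.

Lemma smoothM g h : smooth g -> smooth h -> smooth (g * h).
Proof.
move=> sg sh ks x; rewrite dpartsM //; apply: diff_sum => s.
by apply: differentiableM; [exact: sg|exact: sh].
Qed.

Lemma dpart_comp g (psi : 'rV[R]_n -> 'rV[R]_n) k : smooth g -> smooth_map psi ->
  dpart k (g \o psi) = \sum_(j < n) (dpart j g \o psi) * dpart k (rcomp psi j).
Proof.
move=> sg spsi; apply/funext => x.
have dpsi j : differentiable (rcomp psi j) x := spsi j [::] x.
have psiE : psi = \sum_(j < n) (fun x => rcomp psi j x *: 'e_j).
  by apply/funext => y; rewrite fct_sumE [LHS]row_sum_delta.
have dpx : differentiable psi x.
  by rewrite psiE; apply: differentiable_sum => j; exact: differentiableZl.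
have dg y : differentiable g y by exact: smooth_diff.
rewrite /dpart deriveE; last exact: differentiable_comp.
rewrite diff_comp//= fct_sumE.
have -> : 'd psi x 'e_k = \sum_(j < n) 'D_('e_k) (rcomp psi j) x *: 'e_j.
  rewrite -deriveE// [LHS]row_sum_delta; apply: eq_bigr => j _.
  by rewrite derive_mx ?mxE//; exact: diff_derivable.
rewrite linear_sum; apply: eq_bigr => j _.
by rewrite linearZ /= -deriveE// mulrC.
Qed.

End PartialDerivatives.

Section Regularity.
Variables (R : realType) (n : nat).
Local Notation N := (diffeo0 R n).
Local Notation C := R[i].

Lemma regular_scale c (f : N -> C) : regular f -> regular (fun psi => c * f psi).
Proof. by move=> rf; apply: regular_mul => //; exact: regular_cst. Qed.

Lemma regular_opp (f : N -> C) : regular f -> regular (fun psi => - f psi).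
Proof.
move=> rf; rewrite (_ : (fun _ => _) = (fun psi => -1 * f psi)).
  exact: regular_scale.
by apply/funext => psi; rewrite mulN1r.
Qed.

Lemma regular_sub (f g : N -> C) :
  regular f -> regular g -> regular (fun psi => f psi - g psi).
Proof. by move=> rf rg; apply: regular_add => //; exact: regular_opp. Qed.

Lemma regular_sum (T : Type) (r : seq T) (P : pred T) (F : T -> N -> C) :
  (forall j, P j -> regular (F j)) -> regular (fun psi => \sum_(j <- r | P j) F j psi).
Proof.
move=> rF; elim: r => [|j r IH].
  rewrite (_ : (fun _ => _) = fun=> 0); first exact: regular_cst.
  by apply/funext => psi; rewrite big_nil.
under eq_fun do rewrite big_cons.
by case: (boolP (P j)) => // Pj; apply: regular_add => //; exact: rF.
Qed.

Definition regularR (G : N -> R) := regular (fun psi => (G psi)%:C).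

Lemma regularR_dparts i ks : regularR (fun psi => dparts ks (rcomp psi i) 0).
Proof.
rewrite /regularR; case: ks => [|j ks]; last exact: regular_alpha.
rewrite (_ : (fun _ => _) = fun=> 0); first exact: regular_cst.
by apply/funext => psi /=; rewrite /rcomp fwd0 mxE.
Qed.

Lemma regularR_mul G H : regularR G -> regularR H ->
  regularR (fun psi => G psi * H psi).
Proof.
move=> rG rH; rewrite /regularR; under eq_fun do rewrite rmorphM.
exact: regular_mul.
Qed.

(** Functions of (g, phi) that are combinations of derivatives of g at 0 of
    order below m, with coefficients regular in phi. They are closed under
    equality on smooth g, since the derivatives are only controlled there. *)
Inductive lowpoly (m : nat) : (('rV[R]_n -> R^o) -> N -> R) -> Prop :=
| lowpoly_term js G : (size js < m)%N -> regularR G ->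
    lowpoly m (fun g phi => dparts js g 0 * G phi)
| lowpoly0 : lowpoly m (fun _ _ => 0)
| lowpoly_add Q Q' : lowpoly m Q -> lowpoly m Q' ->
    lowpoly m (fun g phi => Q g phi + Q' g phi)
| lowpoly_ext Q Q' : (forall g phi, smooth g -> Q g phi = Q' g phi) ->
    lowpoly m Q -> lowpoly m Q'.

Lemma lowpoly_leq m m' Q : (m <= m')%N -> lowpoly m Q -> lowpoly m' Q.
Proof.
move=> mm'; elim.
- by move=> js G sz rG; apply: lowpoly_term => //; exact: leq_trans mm'.
- exact: lowpoly0.
- by move=> Q1 Q2 _ IH1 _ IH2; exact: lowpoly_add.
- by move=> Q1 Q2 QE _ IH; exact: lowpoly_ext QE IH.
Qed.

Lemma lowpoly_mulr m Q G : lowpoly m Q -> regularR G ->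
  lowpoly m (fun g phi => Q g phi * G phi).
Proof.
move=> lQ rG; elim: lQ.
- move=> js H sz rH; apply: (@lowpoly_ext _
    (fun g phi => dparts js g 0 * (H phi * G phi))) => [g phi _|].
    by rewrite mulrA.
  by apply: lowpoly_term => //; exact: regularR_mul.
- by apply: lowpoly_ext (lowpoly0 _) => g phi _; rewrite mul0r.
- move=> Q1 Q2 _ IH1 _ IH2; apply: lowpoly_ext (lowpoly_add IH1 IH2) => g phi _.
  by rewrite mulrDl.
- by move=> Q1 Q2 QE _ IH; apply: lowpoly_ext IH => g phi sg; rewrite QE.
Qed.

Lemma lowpoly_dpart m Q k : lowpoly m Q ->
  lowpoly m.+1 (fun g phi => Q (dpart k g) phi).
Proof.
elim.
- by move=> js G sz rG; apply: (@lowpoly_term _ (k :: js)).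
- exact: lowpoly0.
- by move=> Q1 Q2 _ IH1 _ IH2; exact: lowpoly_add.
- move=> Q1 Q2 QE _ IH; apply: lowpoly_ext IH => g phi sg; apply: QE.
  exact: smooth_dpart.
Qed.

Lemma lowpoly_sum m (T : eqType) (r : seq T) Q : (forall j, j \in r -> lowpoly m (Q j)) ->
  lowpoly m (fun g phi => \sum_(j <- r) Q j g phi).
Proof.
elim: r => [|j r IH] lQ.
  by apply: lowpoly_ext (lowpoly0 _) => g phi _; rewrite big_nil.
apply: (@lowpoly_ext _ (fun g phi => Q j g phi + \sum_(j <- r) Q j g phi)).
  by move=> g phi _; rewrite big_cons.
apply: lowpoly_add; first by apply: lQ; exact: mem_head.
by apply: IH => i ir; apply: lQ; rewrite inE ir orbT.
Qed.

(** As phi is tangent to the identity, the derivative of g o phi along ks has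
    the leading term dparts ks g 0, in which every derivative falls on g; the
    other terms of the Faa di Bruno formula have lower order in g. *)
Lemma chain_rule0 ks :
  lowpoly (size ks) (fun g phi => dparts ks (g \o phi) 0 - dparts ks g 0).
Proof.
have [m] := ubnP (size ks); elim: m ks => // m IH [|k ks] szm.
  by apply: lowpoly_ext (lowpoly0 _) => g phi sg /=; rewrite fwd0 subrr.
have [r rE rlt] := unshuffles_behead ks.
have smc (g : 'rV_n -> R^o) j (phi : N) : smooth g -> smooth (dpart j g \o phi).
  by move=> sg; apply: smooth_comp; [exact: smooth_dpart|exact: smooth_fwd].
apply: (@lowpoly_ext _ (fun g phi =>
   (dparts ks (dpart k g \o phi) 0 - dparts ks (dpart k g) 0) +
   \sum_(j < n) \sum_(s <- r)
      dparts s.1 (dpart j g \o phi) 0 * dparts s.2 (dpart k (rcomp phi j)) 0)).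
  move=> g phi sg /=; rewrite dpart_comp //; last exact: smooth_fwd.
  rewrite dparts_sum; last first.
    move=> j; apply: smoothM; first exact: smc.
    by apply: smooth_dpart; exact: smooth_fwd.
  rewrite fct_sumE.
  have -> : \sum_(j < n) dparts ks ((dpart j g \o phi) * dpart k (rcomp phi j)) 0
    = \sum_(j < n) (dparts ks (dpart j g \o phi) 0 * (j == k)%:R +
       \sum_(s <- r) dparts s.1 (dpart j g \o phi) 0
                    * dparts s.2 (dpart k (rcomp phi j)) 0).
    apply: eq_bigr => j _; rewrite dpartsM; last 2 first.
    - exact: smc.
    - by apply: smooth_dpart; exact: smooth_fwd.
    by rewrite rE big_cons fct_sumE /= -(dfwd0 phi).
  rewrite big_split /=.
  have -> : \sum_(j < n) dparts ks (dpart j g \o phi) 0 * (j == k)%:R =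
            dparts ks (dpart k g \o phi) 0.
    rewrite (bigD1 k) //= eqxx mulr1 big1 ?addr0 //.
    by move=> j /negPf ->; rewrite mulr0.
  by rewrite addrAC.
apply: lowpoly_add.
  apply: (@lowpoly_dpart _ (fun g phi => dparts ks (g \o phi) 0 - dparts ks g 0)).
  exact: IH.
apply: lowpoly_sum => j _; apply: lowpoly_sum => s sr.
apply: lowpoly_mulr; last exact: (regularR_dparts j (k :: s.2)).
apply: (@lowpoly_ext _ (fun g phi =>
   (dparts s.1 (dpart j g \o phi) 0 - dparts s.1 (dpart j g) 0)
   + dparts (j :: s.1) g 0 * 1)).
  by move=> g phi _ /=; rewrite mulr1 subrK.
have slt := rlt s sr.
apply: lowpoly_add; last first.
  apply: lowpoly_term => //; rewrite /regularR /=; exact: regular_cst.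
apply: (@lowpoly_leq (size s.1).+1); first by rewrite ltnS ltnW.
apply: (@lowpoly_dpart _
  (fun g phi => dparts s.1 (g \o phi) 0 - dparts s.1 g 0)); apply: IH.
exact: ltn_trans slt szm.
Qed.

(** The elements of F (x) F, as functions on N x N. *)
Inductive regular2 : (N -> N -> C) -> Prop :=
| regular2_pure f g : regular f -> regular g ->
    regular2 (fun psi phi => f psi * g phi)
| regular2_add F G : regular2 F -> regular2 G ->
    regular2 (fun psi phi => F psi phi + G psi phi).

Lemma regular2_mul F G : regular2 F -> regular2 G ->
  regular2 (fun psi phi => F psi phi * G psi phi).
Proof.
move=> rF; elim: rF G => [f f' rf rf'|F1 F2 _ IH1 _ IH2] G rG; last first.
  rewrite (_ : (fun _ _ => _) = fun psi phi => F1 psi phi * G psi phi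
                              + F2 psi phi * G psi phi).
    by apply: regular2_add; [exact: IH1|exact: IH2].
  by apply/funext => psi; apply/funext => phi; rewrite mulrDl.
elim: rG => [g g' rg rg'|G1 G2 _ IH1 _ IH2].
  rewrite (_ : (fun _ _ => _) = fun psi phi => (f psi * g psi) * (f' phi * g' phi)).
    by apply: regular2_pure; exact: regular_mul.
  by apply/funext => psi; apply/funext => phi; rewrite mulrACA.
rewrite (_ : (fun _ _ => _) = fun psi phi => f psi * f' phi * G1 psi phi
                              + f psi * f' phi * G2 psi phi).
  exact: regular2_add.
by apply/funext => psi; apply/funext => phi; rewrite mulrDr.
Qed.

Lemma regular2_l f : regular f -> regular2 (fun psi _ => f psi).
Proof.
move=> rf; rewrite (_ : (fun _ _ => _) = fun psi phi => f psi * 1).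
  by apply: regular2_pure => //; exact: regular_cst.
by apply/funext => psi; apply/funext => phi; rewrite mulr1.
Qed.

Lemma lowpoly_regular2 m Q i : lowpoly m Q ->
  regular2 (fun psi phi => (Q (rcomp psi i) phi)%:C).
Proof.
elim.
- move=> js G _ rG; rewrite (_ : (fun _ _ => _) = (fun psi phi : N =>
     (dparts js (rcomp psi i) 0)%:C * (G phi)%:C)).
    by apply: regular2_pure => //; exact: regularR_dparts.
  by apply/funext => psi; apply/funext => phi; rewrite rmorphM.
- by apply: (@regular2_l (fun=> 0)); exact: regular_cst.
- move=> Q1 Q2 _ IH1 _ IH2; rewrite (_ : (fun _ _ => _) = (fun psi phi : N =>
     (Q1 (rcomp psi i) phi)%:C + (Q2 (rcomp psi i) phi)%:C)).
    exact: regular2_add.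
  by apply/funext => psi; apply/funext => phi; rewrite rmorphD.
- move=> Q1 Q2 QE _; congr regular2; apply/funext => psi; apply/funext => phi.
  by rewrite QE //; exact: smooth_fwd.
Qed.

(** The coproduct of F takes values in F (x) F, by the chain rule. *)
Lemma regular_mulN (f : N -> C) : regular f -> regular2 (fun psi phi => f (mulN psi phi)).
Proof.
elim.
- move=> i j ks; have := lowpoly_regular2 i (chain_rule0 (j :: ks)).
  move=> /(regular2_add (regular2_l (regular_alpha R i j ks))); congr regular2.
  apply/funext => psi; apply/funext => phi.
  by rewrite /alpha -rmorphD /= addrC subrK.
- by move=> c; apply: (@regular2_l (fun=> c)); exact: regular_cst.
- by move=> f' g _ IH1 _ IH2; exact: regular2_add.
- by move=> f' g _ IH1 _ IH2; exact: regular2_mul.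
Qed.

Lemma lowpoly_invN m Q i : lowpoly m Q ->
  (forall ks, (size ks < m)%N ->
     regularR (fun psi => dparts ks (rcomp (invN psi) i) 0)) ->
  regularR (fun psi => Q (rcomp (invN psi) i) psi).
Proof.
move=> + IHm; elim.
- by move=> js G sz rG; apply: regularR_mul => //; exact: IHm.
- exact: regular_cst.
- move=> Q1 Q2 _ IH1 _ IH2; rewrite /regularR; under eq_fun do rewrite rmorphD.
  exact: regular_add.
- move=> Q1 Q2 QE _; congr regular; apply/funext => psi.
  by rewrite QE //; exact: smooth_bwd.
Qed.

(** Induction on the order: psi^-1 o psi = id and the chain rule express a
    derivative of psi^-1 through lower ones and through derivatives of psi. *)
Lemma regularR_invN i ks : regularR (fun psi => dparts ks (rcomp (invN psi) i) 0).
Proof.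
have [m] := ubnP (size ks); elim: m ks => // m IH ks szm.
have IH' ks' : (size ks' < size ks)%N ->
    regularR (fun psi => dparts ks' (rcomp (invN psi) i) 0).
  by move=> sz; apply: IH; exact: leq_trans sz _.
have := lowpoly_invN (chain_rule0 ks) IH'; rewrite /regularR => r1.
have := regular_sub (regular_cst n (dparts ks (rcomp id i) 0 : R)%:C) r1.
congr regular; apply/funext => psi.
have -> : rcomp (invN psi) i \o psi = rcomp id i.
  by apply/funext => x; rewrite /rcomp /= fwdK.
by rewrite -rmorphB /= opprB addrC subrK.
Qed.

Lemma regular_invN (f : N -> C) : regular f -> regular (fun psi => f (invN psi)).
Proof.
elim.
- by move=> i j ks; exact: (regularR_invN i (j :: ks)).
- exact: regular_cst.
- by move=> f' g _ IH1 _ IH2; exact: regular_add.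
- by move=> f' g _ IH1 _ IH2; exact: regular_mul.
Qed.

End Regularity.

(** * Formal power series *)

Lemma eq_big_supp (V : nmodType) (T : eqType) (r1 r2 : seq T) (F : T -> V) :
  uniq r1 -> uniq r2 -> (forall x, F x != 0 -> (x \in r1) = (x \in r2)) ->
  \sum_(x <- r1) F x = \sum_(x <- r2) F x.
Proof.
move=> u1 u2 r12.
have red (r : seq T) :
    \sum_(x <- r) F x = \sum_(x <- [seq x <- r | F x != 0]) F x.
  rewrite big_filter [LHS](bigID (fun x => F x != 0)) /=.
  by rewrite [X in _ + X]big1 ?addr0 // => x; rewrite negbK => /eqP.
rewrite [LHS]red [RHS]red; apply: perm_big; apply: uniq_perm; rewrite ?filter_uniq //.
by move=> x; rewrite !mem_filter; case: eqVneq => //= /r12.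
Qed.

Lemma big_seq_delta (V : nmodType) (T : eqType) (r : seq T) (x : T) (F : T -> V) :
  uniq r -> (x \notin r -> F x = 0) ->
  \sum_(y <- r) (if x == y then F y else 0) = F x.
Proof.
move=> ur xr; rewrite -(big_seq1 +%R x F) [RHS]big_seq1.
rewrite (@eq_big_supp _ _ r [:: x]) //.
  by rewrite big_seq1 eqxx.
move=> y; case: (eqVneq x y) => [<-|]; last by rewrite eqxx.
rewrite inE eqxx; case: (boolP (x \in r)) => // /xr ->.
by rewrite eqxx.
Qed.

Section PowerSeries.
Variables (R : realType) (n : nat).
Local Notation C := R[i].
Local Notation mindex := (mindex n).
Local Notation fps := (fps R n).
Local Notation mzero0 := (Defs.mzero n).

Definition madd (J L : mindex) : mindex := [ffun i => (J i + L i)%N].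

(** A box that contains every multi-index of degree at most d. Sums over pairs
    of such indices, restricted by a condition on their sum, are easier to
    reorganize than the Cauchy products over the indices below a given one. *)
Definition mbox (d : nat) : seq mindex :=
  [seq [ffun i => nat_of_ord (J i)] | J : {ffun 'I_n -> 'I_d.+1}].

Lemma mbox_uniq d : uniq (mbox d).
Proof.
rewrite map_inj_uniq ?enum_uniq // => J L /ffunP JL.
by apply/ffunP => i; apply: val_inj; have := JL i; rewrite !ffunE.
Qed.

Lemma mem_mbox d (K : mindex) : (K \in mbox d) = [forall i, (K i <= d)%N].
Proof.
apply/mapP/forallP => [[J _ ->] i|Kd]; first by rewrite ffunE -ltnS.
exists [ffun i => inord (K i)]; first by rewrite mem_enum.
by apply/ffunP => i; rewrite !ffunE inordK // ltnS.
Qed.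

Lemma mdeg_ge (K : mindex) i : (K i <= mdeg K)%N.
Proof. by rewrite /mdeg (bigD1 i) //= leq_addr. Qed.

Lemma mdeg_mbox d (K : mindex) : (mdeg K <= d)%N -> K \in mbox d.
Proof.
by move=> Kd; rewrite mem_mbox; apply/forallP => i; exact: leq_trans (mdeg_ge _ _) Kd.
Qed.

Lemma mdegD (J L : mindex) : mdeg (madd J L) = (mdeg J + mdeg L)%N.
Proof.
by rewrite /mdeg -big_split; apply: eq_bigr => i _; rewrite ffunE.
Qed.

Lemma mdeg_unit (i : 'I_n) : mdeg (munit i) = 1%N.
Proof.
rewrite /mdeg (bigD1 i) //= ffunE eqxx big1 // => j /negPf ji.
by rewrite ffunE ji.
Qed.

Lemma maddC (J L : mindex) : madd J L = madd L J.
Proof. by apply/ffunP => i; rewrite !ffunE addnC. Qed.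

Lemma maddA (J L M : mindex) : madd J (madd L M) = madd (madd J L) M.
Proof. by apply/ffunP => i; rewrite !ffunE addnA. Qed.

Lemma madd0 (J : mindex) : madd mzero0 J = J.
Proof. by apply/ffunP => i; rewrite !ffunE. Qed.

Lemma maddIr L J J' : madd J L = madd J' L -> J = J'.
Proof.
move=> /ffunP e; apply/ffunP => i; apply: (@addIn (L i)).
by have := e i; rewrite !ffunE.
Qed.

Lemma madd_eqr L J J' : (madd J L == madd J' L) = (J == J').
Proof. by apply/eqP/eqP => [/maddIr|->]. Qed.

(** Every box that contains the multi-indices below K gives the same sum, so products
    of several factors can be compared on a common box. *)
Lemma fps_mulE d (f g : fps) K : (mdeg K <= d)%N ->
  fps_mul f g K = \sum_(J <- mbox d) \sum_(L <- mbox d)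
     (if madd J L == K then f J * g L else 0).
Proof.
move=> Kd.
transitivity (\sum_(J <- mbox (mdeg K) | [forall i, (J i <= K i)%N])
   f J * g [ffun i => (K i - J i)%N]).
  rewrite /fps_mul big_map big_enum_cond /=; apply: eq_big => J.
    by apply: eq_forallb => i; rewrite ffunE.
  by move=> _; congr (_ * g _); apply/ffunP => i; rewrite !ffunE.
rewrite big_mkcond /= (@eq_big_supp _ _ _ (mbox d)); rewrite ?mbox_uniq //.
  apply: eq_big_seq => J Jd; case: ifPn => [/forallP JK|JK].
    set L0 := (X in g X).
    rewrite (eq_bigr (fun L => if L0 == L then f J * g L else 0)).
      rewrite (@big_seq_delta _ _ _ L0 (fun L => f J * g L)) // ?mbox_uniq //.
      case/negP; rewrite mem_mbox; apply/forallP => i; rewrite ffunE.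
      by apply: leq_trans (leq_subr _ _) _; apply: leq_trans (mdeg_ge _ _) Kd.
    move=> L _; congr (if _ then _ else _); apply/eqP/eqP; rewrite /L0 => <-.
      by apply/ffunP => i; rewrite !ffunE addKn.
    by apply/ffunP => i; rewrite !ffunE subnKC.
  rewrite big1 // => L _; case: eqP => // JLK; case/negP: JK.
  by apply/forallP => i; rewrite -JLK ffunE leq_addr.
move=> J; case: ifPn; last by rewrite eqxx.
move=> /forallP JK _; rewrite !mem_mbox.
transitivity true; last symmetry; apply/forallP => i;
  apply: leq_trans (JK i) _; first exact: mdeg_ge.
exact: leq_trans (mdeg_ge _ _) Kd.
Qed.

Fact fps_mulC : commutative (@fps_mul R n).
Proof.
move=> f g; apply/funext => K; rewrite !(fps_mulE _ _ (leqnn _)) exchange_big.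
by apply: eq_bigr => J _; apply: eq_bigr => L _; rewrite maddC mulrC.
Qed.

Let mul3 (f g h : fps) K := \sum_(J <- mbox (mdeg K)) \sum_(L <- mbox (mdeg K))
  \sum_(M <- mbox (mdeg K))
  (if madd (madd J L) M == K then f J * g L * h M else 0).

Let fps_mul3 f g h K : fps_mul (fps_mul f g) h K = mul3 f g h K.
Proof.
rewrite (fps_mulE _ _ (leqnn _)) exchange_big /=.
rewrite (eq_bigr (fun M => \sum_(P <- mbox (mdeg K)) \sum_(J <- mbox (mdeg K))
  \sum_(L <- mbox (mdeg K)) (if madd J L == P then
      (if madd P M == K then f J * g L * h M else 0) else 0))); last first.
  move=> M _; apply: eq_bigr => P _; case: eqP => [PMK|_]; last first.
    by rewrite big1 // => J _; rewrite big1 // => L _; rewrite if_same.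
  rewrite (@fps_mulE (mdeg K)); last by rewrite -PMK mdegD leq_addr.
  rewrite mulr_suml; apply: eq_bigr => J _; rewrite mulr_suml.
  by apply: eq_bigr => L _; case: ifP => _; rewrite ?mul0r.
under eq_bigr do rewrite exchange_big /=.
rewrite exchange_big /=; apply: eq_bigr => J _.
under eq_bigr do rewrite exchange_big /=.
rewrite exchange_big /=; apply: eq_bigr => L _; apply: eq_bigr => M _.
rewrite (@big_seq_delta _ _ _ _ (fun P => if madd P M == K then _ else _)) ?mbox_uniq //.
move=> /negP JL; case: eqP => // JLM; case: JL; apply: mdeg_mbox.
by rewrite -JLM [leqRHS]mdegD leq_addr.
Qed.

Fact fps_mulA : associative (@fps_mul R n).
Proof.
move=> f g h; apply/funext => K; rewrite fps_mulC !fps_mul3 /mul3.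
under eq_bigr do rewrite exchange_big /=.
rewrite exchange_big /=.
apply: eq_bigr => J _; apply: eq_bigr => L _; apply: eq_bigr => M _.
by rewrite maddC maddA [_ * f _]mulrC mulrA.
Qed.

Fact fps_mul1 : left_id (fpsX R mzero0 : fps) (@fps_mul R n).
Proof.
move=> f; apply/funext => K; rewrite (fps_mulE _ _ (leqnn _)).
rewrite (eq_bigr (fun J => if mzero0 == J then f K else 0)).
  rewrite (@big_seq_delta _ _ _ _ (fun=> f K)) ?mbox_uniq //.
  case/negP; apply: mdeg_mbox.
  by rewrite /mdeg big1 // => i _; rewrite ffunE.
move=> J _; rewrite /fpsX eq_sym; case: (eqVneq J mzero0) => [->|_]; last first.
  by rewrite big1 // => L _; rewrite mul0r if_same.
rewrite (eq_bigr (fun L => if K == L then f L else 0)).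
  by rewrite big_seq_delta ?mbox_uniq // mdeg_mbox.
by move=> L _; rewrite madd0 mul1r eq_sym.
Qed.

Fact fps_mulDl : left_distributive (@fps_mul R n) +%R.
Proof.
move=> f g h; apply/funext => K.
transitivity (fps_mul f h K + fps_mul g h K) => //.
rewrite /fps_mul -big_split /=.
by apply: eq_bigr => J _; rewrite -mulrDl.
Qed.

Fact fps_1neq0 : (fpsX R mzero0 : fps) != 0.
Proof.
apply/eqP => /(congr1 (fun f => f mzero0)); rewrite /fpsX eqxx => /eqP.
by rewrite oner_eq0.
Qed.

HB.instance Definition _ := GRing.Zmodule_isComNzRing.Build fps
  fps_mulA fps_mulC fps_mul1 fps_mulDl fps_1neq0.

Lemma fps_mulM (f g : fps) : fps_mul f g = f * g. Proof. by []. Qed.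

Lemma fps_addE (f g : fps) K : (f + g) K = f K + g K. Proof. by []. Qed.

Lemma fps_scaleE c (f : fps) K : (c *: f) K = c * f K. Proof. by []. Qed.

Lemma fps_sumE (T : Type) (r : seq T) (P : pred T) (F : T -> fps) K :
  (\sum_(i <- r | P i) F i) K = \sum_(i <- r | P i) F i K.
Proof.
elim: r => [|i r IH]; first by rewrite !big_nil.
by rewrite !big_cons; case: (P i); rewrite // fps_addE IH.
Qed.

Fact fps_scaleAl (c : C) (f g : fps) : c *: (f * g) = c *: f * g.
Proof.
apply/funext => K; rewrite fps_scaleE -!fps_mulM /fps_mul mulr_sumr.
by apply: eq_bigr => J _; rewrite fps_scaleE mulrA.
Qed.

Lemma fps_scaleAr (c : C) (f g : fps) : c *: (f * g) = f * (c *: g).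
Proof. by rewrite mulrC fps_scaleAl mulrC. Qed.

Fact fps_d_is_linear i : linear (@fps_d R n i).
Proof.
move=> c f g; apply/funext => K.
by rewrite /fps_d !fps_addE !fps_scaleE mulrDr; congr (_ + _); rewrite mulrCA.
Qed.
HB.instance Definition _ i := GRing.isLinear.Build C fps fps _ (@fps_d R n i)
  (fps_d_is_linear i).

Lemma fps_dE i (f : fps) K : fps_d i f K = (K i).+1%:R * f (madd K (munit i)).
Proof. by congr (_ * f _); apply/ffunP => j; rewrite !ffunE. Qed.

Lemma fps_dC i j (f : fps) : fps_d i (fps_d j f) = fps_d j (fps_d i f).
Proof.
apply/funext => K; rewrite !fps_dE -!maddA (maddC (munit i)) !ffunE.
rewrite !mulrA; congr (_ * _).
by rewrite eq_sym; case: eqVneq => [->|] //=; rewrite !addn0 mulrC.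
Qed.

(** Both sums run over the nonzero values of F at the indices J with J i > 0. *)
Lemma mbox_shift (V : nmodType) d (i : 'I_n) (F : mindex -> V) :
  (forall J, J \notin mbox d -> F J = 0) -> (forall J : mindex, J i = 0%N -> F J = 0) ->
  \sum_(J <- mbox d) F (madd J (munit i)) = \sum_(J <- mbox d) F J.
Proof.
move=> Fd F0; rewrite -(big_map (fun J => madd J (munit i)) xpredT F) /=.
apply: eq_big_supp; rewrite ?mbox_uniq //.
  rewrite map_inj_uniq ?mbox_uniq // => J L; exact: maddIr.
move=> J FJ; have Jd : J \in mbox d by apply: contraNT FJ => /Fd ->.
rewrite Jd; apply/mapP; exists [ffun j => (J j - (j == i))%N].
  move: Jd; rewrite !mem_mbox => /forallP Jd; apply/forallP => j.
  by rewrite ffunE; apply: leq_trans (leq_subr _ _) _.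
apply/ffunP => j; rewrite !ffunE; case: eqVneq => [->|_]; last by rewrite subn0 addn0.
rewrite subnK // lt0n; apply: contraNneq FJ => /F0 ->; exact: eqxx.
Qed.

(** Multiplication by the exponents turns the Cauchy product into a
    Leibniz rule: if J + L = K + e_i then K i + 1 = J i + L i. *)
Lemma fps_dM i (f g : fps) : fps_d i (f * g) = fps_d i f * g + f * fps_d i g.
Proof.
have half (f1 g1 : fps) K : (fps_d i f1 * g1) K =
    \sum_(J <- mbox (mdeg K).+1) \sum_(L <- mbox (mdeg K).+1)
     (if madd J L == madd K (munit i) then (J i)%:R * (f1 J * g1 L) else 0).
  rewrite -fps_mulM (@fps_mulE (mdeg K).+1) // exchange_big [RHS]exchange_big /=.
  apply: eq_bigr => L _.
  rewrite -(@mbox_shift _ _ i (fun J => if madd J L == madd K (munit i) then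
      (J i)%:R * (f1 J * g1 L) else 0)).
  - apply: eq_bigr => J _; rewrite fps_dE mulrA !ffunE eqxx addn1.
    by rewrite -[madd (madd J (munit i)) L]maddA (maddC (munit i) L) maddA madd_eqr.
  - move=> J; apply: contraNeq; case: ifP; rewrite ?eqxx // => /eqP JL _.
    apply: mdeg_mbox.
    have : (mdeg J <= mdeg (madd J L))%N by rewrite mdegD leq_addr.
    by rewrite JL mdegD mdeg_unit addn1.
  - by move=> J ->; rewrite mul0r if_same.
apply/funext => K; rewrite fps_addE [f * fps_d _ _]mulrC !half fps_dE.
rewrite -[(f * g) _]/(fps_mul f g _) (@fps_mulE (mdeg K).+1); last first.
  by rewrite mdegD mdeg_unit addn1.
rewrite mulr_sumr [X in _ = _ + X]exchange_big -big_split /=.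
apply: eq_bigr => J _; rewrite mulr_sumr -big_split /=; apply: eq_bigr => L _.
rewrite (maddC L); case: eqP => [JLK|_]; last by rewrite mulr0 addr0.
have -> : (K i).+1 = (J i + L i)%N.
  by move/ffunP/(_ i): JLK; rewrite !ffunE eqxx addn1.
by rewrite natrD mulrDl (mulrC (g L)).
Qed.

End PowerSeries.

(** * Lie derivatives of formal functions and 1-forms *)

Section LieDerivatives.
Variables (R : realType) (n : nat).
Local Notation C := R[i].
Local Notation fps := (fps R n).
Local Notation vfield := (vfield R n).
Local Notation form1 := (form1 R n).
Local Notation forms := (forms R n).
Implicit Types (v w : vfield) (a : fps) (om : form1) (u : forms).

Lemma vf_addE v w i : (v + w) i = v i + w i. Proof. by []. Qed.
Lemma vf_scaleE (c : C) v i : (c *: v) i = c *: v i. Proof. by []. Qed.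
Lemma vf_oppE v i : (- v) i = - v i. Proof. by []. Qed.
Lemma form1_addE (v w : form1) i : (v + w) i = v i + w i. Proof. by []. Qed.
Lemma form1_scaleE (c : C) (v : form1) i : (c *: v) i = c *: v i. Proof. by []. Qed.
Lemma form1_oppE (v : form1) i : (- v) i = - v i. Proof. by []. Qed.

Lemma lie0E v a : lie0 v a = \sum_j v j * fps_d j a.
Proof. by []. Qed.

Lemma lie1E v om i : lie1 v om i = lie0 v (om i) + \sum_j om j * fps_d i (v j).
Proof. by rewrite /lie1 big_split. Qed.

(** The bracket is the difference of the Lie derivatives on the coefficients,
    so its properties reduce to those of lie0 as a derivation. *)
Lemma vbrE v w i : vbr v w i = lie0 v (w i) - lie0 w (v i).
Proof. by rewrite /vbr sumrB. Qed.

Lemma lie0_is_linear v : linear (lie0 v).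
Proof.
move=> c a b; rewrite !lie0E scaler_sumr -big_split; apply: eq_bigr => j _ /=.
by rewrite linearP mulrDr fps_scaleAr.
Qed.
HB.instance Definition _ v := GRing.isLinear.Build C fps fps _ (lie0 v) (lie0_is_linear v).

Lemma lie0_linl c v w a : lie0 (c *: v + w) a = c *: lie0 v a + lie0 w a.
Proof.
rewrite !lie0E scaler_sumr -big_split; apply: eq_bigr => j _ /=.
by rewrite vf_addE vf_scaleE mulrDl fps_scaleAl.
Qed.

Lemma lie0M v a b : lie0 v (a * b) = lie0 v a * b + a * lie0 v b.
Proof.
rewrite !lie0E mulr_suml mulr_sumr -big_split; apply: eq_bigr => j _ /=.
rewrite fps_dM; ring.
Qed.

Lemma lie0_br v w a : lie0 (vbr v w) a = lie0 v (lie0 w a) - lie0 w (lie0 v a).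
Proof.
have comp x y : lie0 x (lie0 y a) = \sum_j lie0 x (y j) * fps_d j a
    + \sum_j \sum_k y j * x k * fps_d k (fps_d j a).
  rewrite [X in lie0 x X]lie0E raddf_sum -big_split; apply: eq_bigr => j _ /=.
  rewrite lie0M; congr (_ + _); rewrite lie0E mulr_sumr; apply: eq_bigr => k _.
  by rewrite mulrA.
rewrite !comp [X in _ = _ - (_ + X)]exchange_big /=.
have -> : \sum_j \sum_i v i * w j * fps_d j (fps_d i a) =
          \sum_j \sum_k w j * v k * fps_d k (fps_d j a).
  by apply: eq_bigr => j _; apply: eq_bigr => k _; rewrite fps_dC (mulrC (v k)).
rewrite opprD addrACA subrr addr0 [LHS]lie0E -sumrB; apply: eq_bigr => j _.
by rewrite vbrE mulrBl.
Qed.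

Lemma vbr_jacobi x v w : vbr x (vbr v w) = vbr (vbr x v) w + vbr v (vbr x w).
Proof.
apply/funext => i; rewrite vf_addE !vbrE !lie0_br !raddfB /=; ring.
Qed.

Lemma vbr_skew v w : vbr v w = - vbr w v.
Proof. by apply/funext => i; rewrite vf_oppE !vbrE opprB. Qed.

Lemma vbr_linr c x v w : vbr x (c *: v + w) = c *: vbr x v + vbr x w.
Proof.
apply/funext => i; rewrite vf_addE vf_scaleE !vbrE vf_addE vf_scaleE.
rewrite linearP lie0_linl scalerBr /=; ring.
Qed.

Lemma vbr_linl c x v w : vbr (c *: v + w) x = c *: vbr v x + vbr w x.
Proof.
by rewrite vbr_skew vbr_linr opprD -scalerN (vbr_skew v x) (vbr_skew w x).
Qed.

Lemma lie1_linr v c (om om' : form1) :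
  lie1 v (c *: om + om') = c *: lie1 v om + lie1 v om'.
Proof.
apply/funext => i; rewrite form1_addE form1_scaleE !lie1E form1_addE form1_scaleE.
rewrite linearP /= scalerDr addrACA; congr (_ + _).
rewrite scaler_sumr -big_split; apply: eq_bigr => j _ /=.
by rewrite form1_addE form1_scaleE mulrDl fps_scaleAl.
Qed.

Lemma lie1_linl c v w (om : form1) :
  lie1 (c *: v + w) om = c *: lie1 v om + lie1 w om.
Proof.
apply/funext => i; rewrite form1_addE form1_scaleE !lie1E lie0_linl.
rewrite scalerDr addrACA; congr (_ + _).
rewrite scaler_sumr -big_split; apply: eq_bigr => j _ /=.
by rewrite vf_addE vf_scaleE linearP mulrDr fps_scaleAr.
Qed.

Lemma lie1_br v w (om : form1) :
  lie1 (vbr v w) om = lie1 v (lie1 w om) - lie1 w (lie1 v om).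
Proof.
apply/funext => i; rewrite form1_addE form1_oppE.
have comp x y : lie1 x (lie1 y om) i =
   (lie0 x (lie0 y (om i)) + \sum_j (lie0 x (om j) * fps_d i (y j)
       + lie0 y (om j) * fps_d i (x j)))
   + \sum_j om j * (lie0 x (fps_d i (y j)) + \sum_k fps_d k (y j) * fps_d i (x k)).
  rewrite lie1E lie1E linearD /=.
  have -> : lie0 x (\sum_j om j * fps_d i (y j)) =
      \sum_j (lie0 x (om j) * fps_d i (y j) + om j * lie0 x (fps_d i (y j))).
    by rewrite raddf_sum; apply: eq_bigr => j _; exact: lie0M.
  have -> : \sum_j lie1 y om j * fps_d i (x j) =
      \sum_j (lie0 y (om j) * fps_d i (x j)
              + om j * \sum_k fps_d k (y j) * fps_d i (x k)).
    rewrite (eq_bigr _ (fun j _ => congr1 ( *%R^~ _) (lie1E y om j))).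
    under eq_bigr do rewrite mulrDl.
    rewrite !big_split /=; congr (_ + _).
    under eq_bigr do rewrite mulr_suml.
    rewrite exchange_big; apply: eq_bigr => j _ /=.
    by rewrite mulr_sumr; apply: eq_bigr => k _; rewrite mulrA.
  rewrite -!addrA; congr (_ + _); rewrite -!big_split /=.
  by apply: eq_bigr => j _; rewrite mulrDr !addrA; ring.
have dl (x y : vfield) j : fps_d i (lie0 x (y j)) =
    lie0 x (fps_d i (y j)) + \sum_k fps_d k (y j) * fps_d i (x k).
  rewrite (lie0E x (y j)) raddf_sum (lie0E x (fps_d i _)) -big_split; apply: eq_bigr => k _ /=.
  by rewrite fps_dM fps_dC addrC (mulrC (fps_d i _)).
rewrite !comp lie1E lie0_br.
under eq_bigr do rewrite vbrE raddfB /= !dl mulrBr.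
rewrite sumrB.
set A := \sum_j _; set B := \sum_j _; set D := \sum_j _; set E := \sum_j _.
have -> : E = D.
  by apply: eq_bigr => j _; rewrite addrC.
ring.
Qed.

Lemma lie1M v a (om : form1) i :
  lie1 v (fun j => a * om j) i = lie0 v a * om i + a * lie1 v om i.
Proof.
rewrite !lie1E lie0M mulrDr -!addrA; congr (_ + (_ + _)).
by rewrite mulr_sumr; apply: eq_bigr => j _; rewrite mulrA.
Qed.

Lemma lie_is_linear v : linear (lie v).
Proof.
move=> c u u'.
have E0 : lie0 v (c *: u + u').1 = c *: lie0 v u.1 + lie0 v u'.1 by rewrite -linearP.
have E1 : lie1 v (c *: u + u').2 = c *: lie1 v u.2 + lie1 v u'.2 by rewrite -lie1_linr.
by rewrite /lie E0 E1.
Qed.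
HB.instance Definition _ v := GRing.isLinear.Build C forms forms _ (lie v) (lie_is_linear v).

Lemma lie_linl c v w u : lie (c *: v + w) u = c *: lie v u + lie w u.
Proof. by rewrite /lie lie0_linl lie1_linl. Qed.

Lemma lie_br v w u : lie (vbr v w) u = lie v (lie w u) - lie w (lie v u).
Proof. by rewrite /lie lie0_br lie1_br. Qed.

Lemma lieM v u u' :
  lie v (form_mul u u') = form_mul (lie v u) u' + form_mul u (lie v u').
Proof.
have E0 : lie0 v (form_mul u u').1 = 0 by exact: raddf0.
have E1 : lie1 v (form_mul u u').2 =
    (fun i => fps_mul (lie0 v u.1) (u'.2 i) + fps_mul u.1 (lie1 v u'.2 i)).
  by apply/funext => i; rewrite -lie1M.
rewrite /lie E0 E1 /form_mul; transitivity ((0 + 0, fun i =>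
    fps_mul (lie0 v u.1) (u'.2 i) + fps_mul u.1 (lie1 v u'.2 i)) : forms).
  by rewrite addr0.
by [].
Qed.

Lemma form_mul_linl c u u' u2 :
  form_mul (c *: u + u') u2 = c *: form_mul u u2 + form_mul u' u2.
Proof.
have E i : fps_mul (c *: u + u').1 (u2.2 i) = c *: fps_mul u.1 (u2.2 i) + fps_mul u'.1 (u2.2 i).
  by rewrite !fps_mulM fps_scaleAl -mulrDl.
transitivity ((c *: 0 + 0, fun i => c *: fps_mul u.1 (u2.2 i) + fps_mul u'.1 (u2.2 i)) : forms).
  by rewrite scaler0 addr0; congr (_, _); apply/funext.
by [].
Qed.

Lemma form_mul_linr c u u' u2 :
  form_mul u2 (c *: u + u') = c *: form_mul u2 u + form_mul u2 u'.
Proof.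
have E i : fps_mul u2.1 ((c *: u + u').2 i) = c *: fps_mul u2.1 (u.2 i) + fps_mul u2.1 (u'.2 i).
  by rewrite !fps_mulM fps_scaleAr -mulrDr.
transitivity ((c *: 0 + 0, fun i => c *: fps_mul u2.1 (u.2 i) + fps_mul u2.1 (u'.2 i)) : forms).
  by rewrite scaler0 addr0; congr (_, _); apply/funext.
by [].
Qed.

End LieDerivatives.

(** * The decomposition of formal vector fields into s and n *)

Section Decomposition.
Variables (R : realType) (n : nat).
Local Notation C := R[i].
Local Notation fps := (fps R n).
Local Notation vfield := (vfield R n).
Local Notation forms := (forms R n).
Local Notation saff := (saff R n).
Implicit Types (v w : vfield) (X Y : saff) (xi : nfield R n).

Lemma saff_addE X Y b : (X + Y) b = X b + Y b. Proof. by []. Qed.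
Lemma saff_scaleE (c : C) X b : (c *: X) b = c * X b. Proof. by []. Qed.
Lemma saff_sumE (T : Type) (r : seq T) (P : pred T) (F : T -> saff) b :
  (\sum_(i <- r | P i) F i) b = \sum_(i <- r | P i) F i b.
Proof.
elim: r => [|i r IH]; first by rewrite !big_nil.
by rewrite !big_cons; case: (P i); rewrite // saff_addE IH.
Qed.

Lemma saff_delta X : X = \sum_b X b *: sdelta R b.
Proof.
apply/funext => c; rewrite saff_sumE (bigD1 c) //= saff_scaleE /sdelta eqxx mulr1.
rewrite big1 ?addr0 // => b /negPf bc.
by rewrite saff_scaleE eq_sym bc mulr0.
Qed.

Fact sproj_is_linear : linear (@sproj R n).
Proof. by move=> c v w; apply/funext => -[i|[j i]]. Qed.
HB.instance Definition _ := GRing.isLinear.Build C vfield saff _ (@sproj R n) sproj_is_linear.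

Fact svec_is_linear : linear (@svec R n).
Proof.
move=> c X Y; rewrite /svec scaler_sumr -big_split; apply: eq_bigr => b _ /=.
by rewrite saff_addE saff_scaleE scalerDl scalerA.
Qed.
HB.instance Definition _ := GRing.isLinear.Build C saff vfield _ (@svec R n) svec_is_linear.

Lemma svec_delta (b : sidx n) : svec (sdelta R b) = sbasis R b.
Proof.
rewrite /svec (bigD1 b) //= /sdelta eqxx scale1r big1 ?addr0 // => c /negPf cb.
by rewrite cb scale0r.
Qed.

Lemma svecK : cancel (@svec R n) (@sproj R n).
Proof.
have sbasisK (b : sidx n) : sproj (sbasis R b) = sdelta R b.
  have mu (j k : 'I_n) : (munit j == munit k) = (j == k).
    apply/eqP/eqP => [/ffunP/(_ j)|-> //].
    by rewrite !ffunE eqxx; case: eqVneq.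
  have m0 (j : 'I_n) : (Defs.mzero n == munit j) = false.
    by apply/eqP => /ffunP/(_ j); rewrite !ffunE eqxx.
  have val (P : bool) (J K : mindex n) :
      (if P then fpsX R J else 0) K = (P && (K == J))%:R by case: P.
  case: b => [i|[j i]]; apply/funext => -[k|[l k]].
  - by apply: etrans (val _ _ _) _; rewrite eqxx andbT.
  - by apply: etrans (val _ _ _) _; rewrite [munit _ == _]eq_sym m0 andbF.
  - by apply: etrans (val _ _ _) _; rewrite m0 andbF.
  - by apply: etrans (val _ _ _) _; rewrite mu andbC.
move=> X; rewrite [in RHS](saff_delta X) /svec linear_sum.
by apply: eq_bigr => b _; rewrite linearZ /= sbasisK.
Qed.

Lemma sproj_n xi : sproj (val xi) = 0.
Proof.
have /asboolP xi0 := valP xi.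
apply/funext => -[i|[j i]] /=; apply: xi0; last by rewrite mdeg_unit.
by rewrite /mdeg big1 // => k _; rewrite ffunE.
Qed.

Lemma val_nproj w : val (nproj w) = w - svec (sproj w).
Proof. by []. Qed.

Lemma sn_decomp w : w = svec (sproj w) + val (nproj w).
Proof. by rewrite val_nproj addrC subrK. Qed.

Fact nproj_is_linear : linear (@nproj R n).
Proof.
move=> c v w; apply: val_inj.
transitivity (c *: val (nproj v) + val (nproj w)) => //.
by rewrite !val_nproj (linearP (@sproj R n)) (linearP (@svec R n)) scalerBr opprD addrACA.
Qed.
HB.instance Definition _ :=
  GRing.isLinear.Build C vfield (nfield R n) _ (@nproj R n) nproj_is_linear.

Lemma nprojD v w : nproj (v + w) = nproj v + nproj w. Proof. exact: raddfD. Qed.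
Lemma nprojN v : nproj (- v) = - nproj v. Proof. exact: raddfN. Qed.
Lemma sprojD v w : sproj (v + w) = sproj v + sproj w. Proof. exact: raddfD. Qed.
Lemma sprojN v : sproj (- v) = - sproj v. Proof. exact: raddfN. Qed.

Lemma nproj_val xi : nproj (val xi) = xi.
Proof. by apply: val_inj; rewrite val_nproj sproj_n linear0 subr0. Qed.

Lemma nproj_svec X : nproj (svec X) = 0.
Proof. by apply: val_inj; rewrite val_nproj svecK subrr. Qed.

Lemma vbrDr v w w' : vbr v (w + w') = vbr v w + vbr v w'.
Proof. by rewrite -(scale1r w) vbr_linr !scale1r. Qed.
Lemma vbrDl v w w' : vbr (w + w') v = vbr w v + vbr w' v.
Proof. by rewrite -(scale1r w) vbr_linl !scale1r. Qed.

Definition fps_order (d : nat) (f : fps) := forall K, (mdeg K < d)%N -> f K = 0.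
Definition fps_degree (d : nat) (f : fps) := forall K, (d < mdeg K)%N -> f K = 0.

Lemma fps_orderM d e f g : fps_order d f -> fps_order e g -> fps_order (d + e) (f * g).
Proof.
move=> fd ge K Kde; rewrite -fps_mulM (fps_mulE _ _ (leqnn _)).
rewrite big1 // => J _; rewrite big1 // => L _; case: eqP => // JL.
have [Jd|Jd] := ltnP (mdeg J) d; first by rewrite fd // mul0r.
rewrite ge ?mulr0 //; move: Kde; rewrite -JL mdegD.
by apply: contraTltn => Le; rewrite -leqNgt leq_add.
Qed.

Lemma fps_order_d d i f : fps_order d.+1 f -> fps_order d (fps_d i f).
Proof.
by move=> fd K Kd; rewrite fps_dE fd ?mulr0 // mdegD mdeg_unit addn1.
Qed.

Lemma fps_order_sum d (T : Type) (r : seq T) (F : T -> fps) :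
  (forall j, fps_order d (F j)) -> fps_order d (\sum_(j <- r) F j).
Proof. by move=> Fd K Kd; rewrite fps_sumE big1 // => j _; rewrite Fd. Qed.

Lemma fps_orderD d f g : fps_order d f -> fps_order d g -> fps_order d (f + g).
Proof. by move=> fd gd K Kd; rewrite fps_addE fd // gd // addr0. Qed.

Lemma fps_order_leq d e f : (d <= e)%N -> fps_order e f -> fps_order d f.
Proof. by move=> de fe K Kd; apply: fe; exact: leq_trans de. Qed.

Lemma fps_order_dpred d i f : fps_order d f -> fps_order d.-1 (fps_d i f).
Proof. by case: d => [|d] // fd; exact: fps_order_d. Qed.

Lemma fps_degreeM d e f g : fps_degree d f -> fps_degree e g -> fps_degree (d + e) (f * g).
Proof.
move=> fd ge K Kde; rewrite -fps_mulM (fps_mulE _ _ (leqnn _)).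
rewrite big1 // => J _; rewrite big1 // => L _; case: eqP => // JL.
have [Jd|Jd] := ltnP d (mdeg J); first by rewrite fd // mul0r.
rewrite ge ?mulr0 //; move: Kde; rewrite -JL mdegD.
by apply: contraTltn => Le; rewrite -leqNgt leq_add.
Qed.

Lemma fps_degree_d d i f : fps_degree d f -> fps_degree d.-1 (fps_d i f).
Proof.
move=> fd K Kd; rewrite fps_dE fd ?mulr0 // mdegD mdeg_unit addn1.
by case: d {fd} Kd => [|d] // Kd; rewrite ltnS.
Qed.

Lemma svec_degree X i : fps_degree 1 (svec X i).
Proof.
move=> K K1; rewrite /svec fct_sumE fps_sumE big1 // => b _.
rewrite vf_scaleE fps_scaleE; case: b => [k|[j k]]; rewrite /sbasis;
  case: (i == k); rewrite ?mulr0 // /fpsX; case: eqVneq => [KE|]; rewrite ?mulr0 //;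
  move: K1; rewrite KE ?mdeg_unit //.
by rewrite /mdeg big1 // => l _; rewrite ffunE.
Qed.

(** The coefficients of fields in s have degree at most 1, and this bound is kept
    by the bracket, while a field in n has no coefficients of degree at most 1. *)
Lemma svec_br X Y : vbr (svec X) (svec Y) = svec (sbr X Y).
Proof.
rewrite /sbr [LHS]sn_decomp -[RHS]addr0; congr (_ + _).
apply/funext => i; apply/funext => K.
have [K1|K1] := leqP (mdeg K) 1.
  by have /asboolP := valP (nproj (vbr (svec X) (svec Y))); exact.
have nK : val (nproj (vbr (svec X) (svec Y))) i K = vbr (svec X) (svec Y) i K.
  rewrite val_nproj vf_addE fps_addE vf_oppE.
  by rewrite [(- _) K]/(- (_ K)) svec_degree // subr0.
rewrite nK vbrE fps_addE [(- _) K]/(- (_ K)) !lie0E !fps_sumE.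
rewrite !big1 ?subr0 // => j _; apply: (@fps_degreeM 1 0) => //;
  try exact: svec_degree; apply: (@fps_degree_d 1); exact: svec_degree.
Qed.

Definition forms_order d (u : forms) :=
  fps_order d u.1 /\ forall i, fps_order d (u.2 i).

Lemma n_order xi j : fps_order 2 (val xi j).
Proof. by move=> K K2; have /asboolP := valP xi; exact. Qed.

(** Fields in n have order 2, which makes up for the degree lost by the derivative,
    whichever factor is differentiated. *)
Lemma lie_order d xi u : forms_order d u -> forms_order d (lie (val xi) u).
Proof.
have lie0_order f : fps_order d f -> fps_order d (lie0 (val xi) f).
  move=> fd; rewrite lie0E; apply: fps_order_sum => j.
  apply: (@fps_order_leq _ (2 + d.-1)); first by case: d {fd}.
  by apply: fps_orderM; [exact: n_order|exact: fps_order_dpred].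
case: u => a om [/= ad omd]; split=> [|i]; rewrite /lie /=; first exact: lie0_order.
rewrite lie1E; apply: fps_orderD; first exact: lie0_order.
apply: fps_order_sum => j; apply: (@fps_order_leq _ (d + 1)); first exact: leq_addr.
by apply: fps_orderM; [exact: omd|apply: fps_order_d; exact: n_order].
Qed.

End Decomposition.

(** * The right action of W_n on U(n) *)

Section Words.
Variables (K : fieldType) (g : lmodType K) (br : g -> g -> g).
Local Notation U := (uea br).
Local Notation word := (uea_word br).

Lemma ucls_add a b : ucls br (UAdd a b) = ucls br a + ucls br b.
Proof. by rewrite -uea_addE. Qed.
Lemma ucls_mul a b : ucls br (UMul a b) = ucls br a * ucls br b.
Proof. by rewrite -uea_mulE. Qed.
Lemma ucls_scale k a : ucls br (UScale k a) = k *: ucls br a.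
Proof. by rewrite -uea_scaleE. Qed.

Lemma uea_word1 x : word [:: x] = uea_gen br x.
Proof. by rewrite /uea_word big_seq1. Qed.
Lemma uea_word0 : word [::] = 1.
Proof. by rewrite /uea_word big_nil. Qed.
Lemma uea_word_cat v w : word (v ++ w) = word v * word w.
Proof. by rewrite /uea_word big_cat. Qed.
Lemma uea_word_rcons v x : word (rcons v x) = word v * uea_gen br x.
Proof. by rewrite -cats1 uea_word_cat uea_word1. Qed.

Lemma uea_genD x y : uea_gen br (x + y) = uea_gen br x + uea_gen br y.
Proof. by rewrite /uea_gen -ucls_add; apply: ueaP; exact: ueq_genD. Qed.
Lemma uea_genZ k x : uea_gen br (k *: x) = k *: uea_gen br x.
Proof. by rewrite /uea_gen -ucls_scale; apply: ueaP; exact: ueq_genZ. Qed.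
Lemma uea_gen_br x y :
  uea_gen br (br x y) = uea_gen br x * uea_gen br y - uea_gen br y * uea_gen br x.
Proof.
rewrite /uea_gen -!ucls_mul -scaleN1r -ucls_scale -ucls_add.
by apply: ueaP; apply: ueq_sym; exact: ueq_genB.
Qed.
Lemma uea_gen0 : uea_gen br 0 = 0.
Proof. by rewrite -(scale0r 0) uea_genZ scale0r. Qed.

Lemma uea_word_ind (P : U -> Prop) :
  (forall k u v, P u -> P v -> P (k *: u + v)) -> (forall w, P (word w)) ->
  forall u, P u.
Proof.
move=> Plin Pword.
pose S (u : U) := exists s : seq (K * seq g), u = \sum_(x <- s) x.1 *: word x.2.
have S0 : S 0 by exists [::]; rewrite big_nil.
have SD u v : S u -> S v -> S (u + v).
  by move=> [s ->] [t ->]; exists (s ++ t); rewrite big_cat.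
have SZ k u : S u -> S (k *: u).
  move=> [s ->]; exists [seq (k * x.1, x.2) | x <- s].
  by rewrite big_map scaler_sumr; apply: eq_bigr => x _; rewrite scalerA.
have Ssum (T : Type) (r : seq T) (F : T -> U) :
    (forall i, S (F i)) -> S (\sum_(i <- r) F i).
  by move=> SF; elim: r => [|i r IH]; rewrite ?big_nil ?big_cons //; exact: SD.
have Sword w : S (word w).
  by exists [:: (1, w)]; rewrite big_seq1 scale1r.
have SM u v : S u -> S v -> S (u * v).
  move=> [s ->] [t ->]; rewrite mulr_suml; apply: (Ssum) => x.
  rewrite mulr_sumr; apply: (Ssum) => y.
  by rewrite -scalerAl -scalerAr -uea_word_cat; apply: (SZ); apply: SZ; exact: Sword.
have Sall u : S u.
  elim/ucls_ind: u; elim=> [x|||a Sa b Sb|a Sa b Sb|k a Sa].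
  - by rewrite -[ucls _ _]uea_word1.
  - exact: S0.
  - by rewrite -[ucls _ _]uea_word0.
  - by rewrite ucls_add; exact: SD.
  - by rewrite ucls_mul; exact: SM.
  - by rewrite ucls_scale; exact: SZ.
have P0 : P 0 by rewrite -(addNr (word [::])) -scaleN1r; apply: Plin.
move=> u; have [s ->] := Sall u; elim: s => [|x s IH]; first by rewrite big_nil.
by rewrite big_cons; exact: Plin.
Qed.

End Words.

Section RightModule.
Variables (K : fieldType) (g : lmodType K) (br : g -> g -> g).
Variables (V : lmodType K) (P : V -> Prop) (rho : g -> V -> V).
Hypotheses (P0 : P 0) (Plin : forall k u v, P u -> P v -> P (k *: u + v))
  (Prho : forall x v, P v -> P (rho x v)).
Hypothesis rho_linl : forall k x y v, P v ->
  rho (k *: x + y) v = k *: rho x v + rho y v.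
Hypothesis rho_linr : forall k x u v, P u -> P v ->
  rho x (k *: u + v) = k *: rho x u + rho x v.
Hypothesis rho_br : forall x y v, P v ->
  rho (br x y) v = rho y (rho x v) - rho x (rho y v).

(** A right representation rho of g on a subset P of V, closed under linear
    combinations, makes P a right U(g)-module. The subset is needed when rho
    satisfies the axioms only on some elements of V, here on the linear maps
    among all the functions. *)
Fixpoint uact (a : uexpr g) (v : V) : V :=
  match a with
  | UGen x => rho x v
  | UZero => 0
  | UOne => v
  | UAdd a b => uact a v + uact b v
  | UMul a b => uact b (uact a v)
  | UScale k a => k *: uact a v
  end.

Let PD u v : P u -> P v -> P (u + v).
Proof. by move=> Pu Pv; rewrite -(scale1r u); exact: Plin. Qed.

Let PZ k u : P u -> P (k *: u).
Proof. by move=> Pu; rewrite -(addr0 (k *: u)); exact: Plin. Qed.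

Let P_uact a v : P v -> P (uact a v).
Proof. by elim: a v => //= *; auto. Qed.

Let uact_lin a k u v : P u -> P v -> uact a (k *: u + v) = k *: uact a u + uact a v.
Proof.
elim: a u v => [x|||a IHa b IHb|a IHa b IHb|l a IHa] u v Pu Pv //=.
- exact: rho_linr.
- by rewrite scaler0 addr0.
- by rewrite IHa // IHb // scalerDr addrACA.
- by rewrite IHa // IHb; auto.
- by rewrite IHa // scalerDr !scalerA mulrC.
Qed.

Let uactZ a k v : P v -> uact a (k *: v) = k *: uact a v.
Proof.
move=> Pv; have a0 : uact a 0 = 0.
  have /eqP := uact_lin a (-1) Pv Pv; rewrite !scaleN1r !addNr => /eqP //.
by rewrite -[k *: v]addr0 uact_lin // a0 addr0.
Qed.

Let uactD a u v : P u -> P v -> uact a (u + v) = uact a u + uact a v.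
Proof. by move=> Pu Pv; rewrite -(scale1r u) uact_lin // !scale1r. Qed.

Let ueq_uact a b : ueq br a b -> forall v, P v -> uact a v = uact b v.
Proof.
elim=> /=.
- by [].
- by move=> a' b' _ IH v Pv; rewrite IH.
- by move=> a' b' c _ IH1 _ IH2 v Pv; rewrite IH1 // IH2.
- by move=> a1 a2 b1 b2 _ IH1 _ IH2 v Pv; rewrite IH1 // IH2.
- by move=> a1 a2 b1 b2 _ IH1 _ IH2 v Pv; rewrite IH1 // IH2 //; exact: P_uact.
- by move=> k a1 a2 _ IH v Pv; rewrite IH.
- by move=> a1 b1 c v Pv; rewrite addrA.
- by move=> a1 b1 v Pv; rewrite addrC.
- by move=> a1 v Pv; rewrite add0r.
- by move=> a1 v Pv; rewrite scaleN1r addNr.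
- by [].
- by [].
- by [].
- by move=> a1 b1 c v Pv; rewrite uactD //; exact: P_uact.
- by [].
- by move=> k l a1 v Pv; rewrite scalerA.
- by move=> a1 v Pv; rewrite scale1r.
- by move=> k a1 b1 v Pv; rewrite scalerDr.
- by move=> k l a1 v Pv; rewrite scalerDl.
- by move=> k a1 b1 v Pv; rewrite uactZ //; exact: P_uact.
- by [].
- by move=> x y v Pv; rewrite -{1}(scale1r x) rho_linl // scale1r.
- move=> k x v Pv; rewrite -[k *: x]addr0 rho_linl //.
  by rewrite -(addNr x) -{1}(scaleN1r x) rho_linl // scaleN1r addNr addr0.
- by move=> x y v Pv; rewrite rho_br // scaleN1r.
Qed.

Definition ract (u : uea br) (v : V) : V := uact (repr u) v.

Let ract_cls a v : P v -> ract (ucls br a) v = uact a v.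
Proof. by move=> Pv; apply: ueq_uact => //; exact: ueq_repr. Qed.

Lemma ract_gen x v : P v -> ract (uea_gen br x) v = rho x v.
Proof. exact: ract_cls. Qed.

Lemma ract_P u v : P v -> P (ract u v). Proof. exact: P_uact. Qed.

Lemma ract1 v : P v -> ract 1 v = v.
Proof. exact: (@ract_cls (UOne _)). Qed.

Lemma ract_mul u u' v : P v -> ract (u * u') v = ract u' (ract u v).
Proof.
move=> Pv; elim/ucls_ind: u => a; elim/ucls_ind: u' => b.
by rewrite -ucls_mul !ract_cls //; exact: P_uact.
Qed.

Lemma ract_linl k u u' v : P v -> ract (k *: u + u') v = k *: ract u v + ract u' v.
Proof.
move=> Pv; elim/ucls_ind: u => a; elim/ucls_ind: u' => b.
by rewrite -ucls_scale -ucls_add !ract_cls.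
Qed.

Lemma ract_linr u k v v' : P v -> P v' ->
  ract u (k *: v + v') = k *: ract u v + ract u v'.
Proof. exact: uact_lin. Qed.

End RightModule.

Section Inclusion.
Variables (R : realType) (n : nat).
Local Notation Un := (uea (@nbr R n)).

Let clsE (a : uexpr (nfield R n)) :
  inclU (ucls (@nbr R n) a) = ucls (@vbr R n) (umap (fun xi : nfield R n => val xi) a).
Proof. exact: uea_map_cls. Qed.

Lemma inclU_mul (u v : Un) : inclU (u * v) = inclU u * inclU v.
Proof.
by elim/ucls_ind: u => a; elim/ucls_ind: v => b; rewrite -ucls_mul !clsE -ucls_mul.
Qed.

Lemma inclU_lin k (u v : Un) : inclU (k *: u + v) = k *: inclU u + inclU v.
Proof.
elim/ucls_ind: u => a; elim/ucls_ind: v => b.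
by rewrite -ucls_scale -ucls_add !clsE -ucls_scale -ucls_add.
Qed.

Lemma inclU_gen xi : inclU (uea_gen (@nbr R n) xi) = uea_gen (@vbr R n) (val xi).
Proof. exact: clsE. Qed.

Lemma inclU1 : inclU (1 : Un) = 1.
Proof. exact: (clsE (UOne _)). Qed.

End Inclusion.

Section RightAction.
Variables (R : realType) (n : nat).
Local Notation C := R[i].
Local Notation vfield := (vfield R n).
Local Notation Un := (uea (@nbr R n)).
Local Notation UW := (uea (@vbr R n)).
Local Notation gen := (uea_gen (@nbr R n)).

Let lin (r : vfield -> Un) := forall k v w, r (k *: v + w) = k *: r v + r w.

(** The recursion that determines Rop: since
      (u xi) w = u w xi + u [xi, w]   in U(W_n),
    the map r = Rop u determines Rop (u xi). *)
Let nact (xi : nfield R n) (r : vfield -> Un) : vfield -> Un :=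
  fun w => r w * gen xi + r (vbr (val xi) w).

Let r0 : vfield -> Un := fun w => gen (nproj w).

(** The right action of w in W_n on U(n), identified with U(W_n) / s U(W_n) by the
    decomposition W_n = s (+) n: Rop u w is the class of u w. *)
Definition Rop (u : Un) (w : vfield) : Un := ract nact u r0 w.

Let r0_lin : lin r0.
Proof. by move=> k v w; rewrite /r0 linearP uea_genD uea_genZ. Qed.

Let lin0 : lin 0. Proof. by move=> k v w; rewrite scaler0 addr0. Qed.

Let funE (k : C) (r r' : vfield -> Un) w : (k *: r + r') w = k *: r w + r' w.
Proof. by []. Qed.

Let lin_lin k r r' : lin r -> lin r' -> lin (k *: r + r').
Proof.
move=> rl rl' l v w; rewrite !funE rl rl' !scalerDr !scalerA (mulrC k).
by rewrite addrACA.
Qed.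

Let lin_nact xi r : lin r -> lin (nact xi r).
Proof.
move=> rl k v w; rewrite /nact vbr_linr !rl mulrDl -scalerAl scalerDr.
by rewrite addrACA.
Qed.

Let nact_linl k xi eta r : lin r ->
  nact (k *: xi + eta) r = k *: nact xi r + nact eta r.
Proof.
move=> rl; apply/funext => w; rewrite funE /nact uea_genD uea_genZ.
have -> : val (k *: xi + eta) = k *: val xi + val eta by [].
by rewrite vbr_linl rl mulrDr -scalerAr scalerDr addrACA.
Qed.

Let nact_linr k xi r r' : lin r -> lin r' ->
  nact xi (k *: r + r') = k *: nact xi r + nact xi r'.
Proof.
move=> rl rl'; apply/funext => w; rewrite funE /nact !funE.
by rewrite mulrDl -scalerAl scalerDr addrACA.
Qed.

Let nact_br xi eta r : lin r ->
  nact (nbr xi eta) r = nact eta (nact xi r) - nact xi (nact eta r).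
Proof.
move=> rl; apply/funext => w; rewrite -[RHS]/(nact eta _ w - nact xi _ w) /nact.
have -> : val (nbr xi eta) = vbr (val xi) (val eta) by [].
have rB v1 v2 : r (v1 - v2) = r v1 - r v2.
  by rewrite addrC -scaleN1r rl scaleN1r addrC.
have -> : vbr (vbr (val xi) (val eta)) w =
   vbr (val xi) (vbr (val eta) w) - vbr (val eta) (vbr (val xi) w).
  by rewrite (vbr_jacobi (val xi)) addrK.
rewrite rB uea_gen_br mulrBr !mulrDl !mulrA.
move: (r w * gen xi * _) (r w * gen eta * _). move: (r (vbr (val xi) w) * _) (r (vbr (val eta) w) * _) (r _) (r _) => A B D E F G.
rewrite !opprD (AC ((2*2)*(2*2)) ((1*5)*(4*8)*((2*7)*(3*6)))) /=.
by rewrite !subrr !addr0.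
Qed.

Let r0_act (u : Un) : lin (ract nact u r0).
Proof. by apply: (ract_P lin0 lin_lin lin_nact); exact: r0_lin. Qed.

Lemma Rop_linr u k v w : Rop u (k *: v + w) = k *: Rop u v + Rop u w.
Proof. exact: r0_act. Qed.

Lemma Rop_linl k u v w : Rop (k *: u + v) w = k *: Rop u w + Rop v w.
Proof.
rewrite /Rop (ract_linl lin0 lin_lin lin_nact nact_linl nact_linr nact_br) //.
Qed.

Lemma Rop1 w : Rop 1 w = gen (nproj w).
Proof.
rewrite /Rop (ract1 lin0 lin_lin lin_nact nact_linl nact_linr nact_br) //.
Qed.

Lemma Rop_mul u xi w : Rop (u * gen xi) w = Rop u w * gen xi + Rop u (vbr (val xi) w).
Proof.
rewrite /Rop (ract_mul lin0 lin_lin lin_nact nact_linl nact_linr nact_br); last first.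
  exact: r0_lin.
rewrite (ract_gen lin0 lin_lin lin_nact nact_linl nact_linr nact_br) //.
Qed.

Lemma RopD u v w : Rop u (v + w) = Rop u v + Rop u w.
Proof. by rewrite -(scale1r v) Rop_linr !scale1r. Qed.

Lemma RopDl u v w : Rop (u + v) w = Rop u w + Rop v w.
Proof. by rewrite -(scale1r u) Rop_linl !scale1r. Qed.

Lemma Rop_n u xi : Rop u (val xi) = u * gen xi.
Proof.
elim/uea_word_ind: u xi => [k u v IHu IHv xi|w].
  by rewrite Rop_linl IHu IHv mulrDl -scalerAl.
elim/last_ind: w => [|w eta IH] xi.
  by rewrite uea_word0 Rop1 nproj_val mul1r.
rewrite uea_word_rcons Rop_mul IH.
have -> : vbr (val eta) (val xi) = val (nbr eta xi) by [].
by rewrite IH uea_gen_br mulrBr !mulrA addrC subrK.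
Qed.

Lemma nproj_br (v w : vfield) : nproj (vbr v w) =
  nbr (nproj v) (nproj w) + nproj (vbr (val (nproj v)) (svec (sproj w)))
  - nproj (vbr (val (nproj w)) (svec (sproj v))).
Proof.
rewrite [in LHS](sn_decomp v) [in LHS](sn_decomp w) vbrDr.
rewrite !(vbrDl _ (svec (sproj v)) (val (nproj v))).
rewrite svec_br !nprojD nproj_svec add0r.
have -> : vbr (val (nproj v)) (val (nproj w)) = val (nbr (nproj v) (nproj w)) by [].
rewrite nproj_val (vbr_skew (svec _)) nprojN.
by rewrite addrA addrC addrA.
Qed.

(** The module axiom of U(W_n) / s U(W_n), by induction on the word u. The step
    is the Jacobi identity. *)
Lemma Rop_br u v w : Rop u (vbr v w) = Rop (Rop u v) w - Rop (Rop u w) v.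
Proof.
elim/uea_word_ind: u v w => [k u u' IHu IHu' v w|ws].
  rewrite !Rop_linl IHu IHu' scalerBr.
  by rewrite opprD addrACA.
elim/last_ind: ws => [|ws xi IH] v w.
  have np (v1 v2 : vfield) : nproj (vbr (val (nproj v1)) v2) =
      nproj (vbr (val (nproj v1)) (svec (sproj v2))) + nbr (nproj v1) (nproj v2).
    rewrite [in LHS](sn_decomp v2) vbrDr nprojD.
    have -> : vbr (val (nproj v1)) (val (nproj v2)) = val (nbr (nproj v1) (nproj v2)).
      by [].
    by rewrite nproj_val.
  have gB x y : gen (x - y) = gen x - gen y.
    by rewrite addrC -scaleN1r uea_genD uea_genZ scaleN1r addrC.
  rewrite uea_word0 !Rop1 -(mul1r (gen (nproj v))) -(mul1r (gen (nproj w))) !Rop_mul.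
  rewrite !Rop1 nproj_br gB (np v w) (np w v) !uea_genD !uea_gen_br.
  move: (gen (nproj v) * gen (nproj w)) (gen (nproj w) * gen (nproj v))
    (gen (nproj (vbr _ (svec (sproj w))))) (gen (nproj (vbr _ (svec (sproj v))))).
  move=> a b P Q; rewrite !opprD opprK.
  rewrite [RHS](AC ((1*(1*2))*(1*(1*2))) (((3*4)*2)*6*((1*7)*(8*5)))) /=.
  by rewrite !subrr !addr0.
rewrite uea_word_rcons !Rop_mul !RopDl !Rop_mul IH (vbr_jacobi (val xi)) RopD.
rewrite (IH (vbr _ v) w) (IH v (vbr _ w)) mulrBl !opprD.
by rewrite [LHS](AC (2*(2*2)) ((1*5*3)*((2*4)*6))).
Qed.

(** The extension of Rop to U(W_n). *)
Definition wact (y : UW) (u : Un) : Un := ract (fun w u => Rop u w) y u.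

Let T (u : Un) := True.

Let wact_hyps :
  [/\ forall k x y (v : Un), T v -> Rop v (k *: x + y) = k *: Rop v x + Rop v y,
    forall k x u (v : Un), T u -> T v -> Rop (k *: u + v) x = k *: Rop u x + Rop v x
   & forall x y (v : Un), T v -> Rop v (vbr x y) = Rop (Rop v x) y - Rop (Rop v y) x].
Proof.
split=> *; [exact: Rop_linr|exact: Rop_linl|exact: Rop_br].
Qed.

Lemma wact_gen w u : wact (uea_gen (@vbr R n) w) u = Rop u w.
Proof.
have [h1 h2 h3] := wact_hyps.
exact: (@ract_gen _ _ (@vbr R n) _ T _ I (fun _ _ _ _ _ => I) (fun _ _ _ => I) h1 h2 h3).
Qed.

Lemma wact1 u : wact 1 u = u.
Proof.
have [h1 h2 h3] := wact_hyps.
exact: (@ract1 _ _ (@vbr R n) _ T _ I (fun _ _ _ _ _ => I) (fun _ _ _ => I) h1 h2 h3).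
Qed.

Lemma wact_mul y y' u : wact (y * y') u = wact y' (wact y u).
Proof.
have [h1 h2 h3] := wact_hyps.
exact: (@ract_mul _ _ (@vbr R n) _ T _ I (fun _ _ _ _ _ => I) (fun _ _ _ => I) h1 h2 h3).
Qed.

Lemma wact_linl k y y' u : wact (k *: y + y') u = k *: wact y u + wact y' u.
Proof.
have [h1 h2 h3] := wact_hyps.
exact: (@ract_linl _ _ (@vbr R n) _ T _ I (fun _ _ _ _ _ => I) (fun _ _ _ => I) h1 h2 h3).
Qed.

Lemma wact_linr k y u u' : wact y (k *: u + u') = k *: wact y u + wact y u'.
Proof.
by apply: (@ract_linr _ _ (@vbr R n) _ T) => // l x u1 u2 _ _; exact: Rop_linl.
Qed.

Lemma wact_inclU u : wact (inclU u) 1 = u.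
Proof.
elim/uea_word_ind: u => [k u v IHu IHv|w].
  by rewrite inclU_lin wact_linl IHu IHv.
elim/last_ind: w => [|w xi IH]; first by rewrite uea_word0 inclU1 wact1.
by rewrite uea_word_rcons inclU_mul wact_mul IH inclU_gen wact_gen Rop_n.
Qed.

Section Matched.
Variables (tri : Un -> saff R n -> saff R n) (tel : Un -> saff R n -> Un).
Hypothesis mat : matched_actions tri tel.

(** Both sides are the action of X on U(W_n) / s U(W_n). Formally, let the defining
    relation of u <| X in U(W_n) act on 1: each term with a left factor in s acts
    by 0. *)
Lemma telE u X : tel u X = Rop u (svec X).
Proof.
have wactD y y' u' : wact (y + y') u' = wact y u' + wact y' u'.
  by rewrite -(scale1r y) wact_linl !scale1r.
have wact0 y : wact y 0 = 0.
  transitivity (wact y (-1 *: 1 + 1)); first by rewrite scaleN1r addNr.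
  by rewrite wact_linr scaleN1r addNr.
have wact0l u' : wact 0 u' = 0.
  transitivity (wact (-1 *: 1 + 1) u'); first by rewrite scaleN1r addNr.
  by rewrite wact_linl scaleN1r addNr.
elim/uea_word_ind: u => [k u v IHu IHv|w].
  by rewrite (tel_linl mat) IHu IHv Rop_linl.
have := congr1 (fun y => wact y 1) (tri_tel mat w X).
rewrite wact_mul wact_inclU wact_gen wactD wact_inclU => ->.
rewrite -[LHS]add0r; congr (_ + _).
elim: (unshuffles w) => [|s r IH]; first by rewrite big_nil wact0l.
rewrite big_cons wactD -IH addr0 wact_mul wact_gen Rop1 nproj_svec.
by rewrite uea_gen0 wact0.
Qed.

Lemma tel1 X : tel 1 X = 0.
Proof. by rewrite telE Rop1 nproj_svec uea_gen0. Qed.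

End Matched.

End RightAction.

(** * The group N and functionals on its regular functions *)

Section GroupLaws.
Variables (R : realType) (n : nat).
Local Notation N := (diffeo0 R n).

Lemma mulNA (a b c : N) : mulN a (mulN b c) = mulN (mulN a b) c.
Proof. exact: diffeo0_eq. Qed.
Lemma mul1N (a : N) : mulN (oneN R n) a = a.
Proof. exact: diffeo0_eq. Qed.
Lemma mulN1 (a : N) : mulN a (oneN R n) = a.
Proof. exact: diffeo0_eq. Qed.

Lemma invMN (a b : N) : invN (mulN a b) = mulN (invN b) (invN a).
Proof. exact: diffeo0_eq. Qed.
Lemma inv1N : invN (oneN R n) = oneN R n.
Proof. exact: diffeo0_eq. Qed.
End GroupLaws.

Section Functionals.
Variables (R : realType) (n : nat).
Local Notation N := (diffeo0 R n).
Local Notation C := R[i].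
Local Notation F := (N -> C).

(** Linearity is only required on regular functions, the domain on which the
    pairing is specified. *)
Definition flin (l : F -> C) := forall k f g, regular f -> regular g ->
  l (fun psi => k * f psi + g psi) = k * l f + l g.

Variable l : F -> C.
Hypothesis ll : flin l.

Lemma flin0 : l (fun=> 0) = 0.
Proof.
have r0 : regular (fun _ : N => 0 : C) by exact: regular_cst.
rewrite -[RHS](addNr (l (fun=> 0))) -mulN1r -ll //; congr l.
by apply/funext => psi; rewrite mulr0 addr0.
Qed.

Lemma flinD f g : regular f -> regular g ->
  l (fun psi => f psi + g psi) = l f + l g.
Proof.
move=> rf rg; rewrite -[l f]mul1r -ll //; congr l.
by apply/funext => psi; rewrite mul1r.
Qed.

Lemma flinZ k f : regular f -> l (fun psi => k * f psi) = k * l f.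
Proof.
move=> rf; have r0 : regular (fun _ : N => 0 : C) by exact: regular_cst.
rewrite -[RHS]addr0 -flin0 -ll //; congr l.
by apply/funext => psi; rewrite addr0.
Qed.

Lemma flinZr k f : regular f -> l (fun psi => f psi * k) = l f * k.
Proof.
move=> rf; rewrite mulrC -flinZ //; congr l.
by apply/funext => psi; rewrite mulrC.
Qed.

Lemma flinN f : regular f -> l (fun psi => - f psi) = - l f.
Proof.
move=> rf; rewrite -mulN1r -flinZ //; congr l.
by apply/funext => psi; rewrite mulN1r.
Qed.

Lemma flinB f g : regular f -> regular g ->
  l (fun psi => f psi - g psi) = l f - l g.
Proof. by move=> rf rg; rewrite flinD ?flinN //; exact: regular_opp. Qed.

Lemma flin_sum (T : Type) (r : seq T) (f : T -> F) : (forall j, regular (f j)) ->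
  l (fun psi => \sum_(j <- r) f j psi) = \sum_(j <- r) l (f j).
Proof.
move=> rf; elim: r => [|j r IH].
  rewrite [RHS]big_nil -[RHS]flin0; congr l; apply/funext => psi; by rewrite big_nil.
rewrite big_cons -IH -flinD //; last exact: regular_sum.
congr l; apply/funext => psi; by rewrite big_cons.
Qed.

Lemma regular2_slicer (G : N -> F) : regular2 G -> forall psi, regular (G psi).
Proof.
elim=> [f g rf rg|G1 G2 _ IH1 _ IH2] psi; first exact: regular_scale.
by apply: regular_add; [exact: IH1|exact: IH2].
Qed.

Lemma regular2_slicel (G : N -> F) : regular2 G -> forall phi, regular (fun psi => G psi phi).
Proof.
elim=> [f g rf rg|G1 G2 _ IH1 _ IH2] phi; last exact: regular_add.
by apply: regular_mul => //; exact: regular_cst.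
Qed.

Lemma regular2_flin (G : N -> F) : regular2 G -> regular (fun psi => l (G psi)).
Proof.
elim=> [f g rf rg|G1 G2 r1 IH1 r2 IH2].
  rewrite (_ : (fun _ => _) = fun psi => f psi * l g).
    by apply: regular_mul => //; exact: regular_cst.
  by apply/funext => psi; exact: flinZ.
rewrite (_ : (fun _ => _) = fun psi => l (G1 psi) + l (G2 psi)).
  exact: regular_add.
by apply/funext => psi; apply: flinD; exact: regular2_slicer.
Qed.

Lemma regular2_flinl (G : N -> F) :
  regular2 G -> regular (fun phi => l (fun psi => G psi phi)).
Proof.
elim=> [f g rf rg|G1 G2 r1 IH1 r2 IH2].
  rewrite (_ : (fun _ => _) = fun phi => l f * g phi).
    exact: regular_scale.
  by apply/funext => phi; exact: flinZr.
rewrite (_ : (fun _ => _) =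
    fun phi => l (fun psi => G1 psi phi) + l (fun psi => G2 psi phi)).
  exact: regular_add.
by apply/funext => phi; apply: flinD; exact: regular2_slicel.
Qed.

End Functionals.

(** For pure tensors both sides are a product of two values. *)
Lemma flin_fubini (R : realType) (n : nat) (l l2 : (diffeo0 R n -> R[i]) -> R[i]) G :
  flin l -> flin l2 -> regular2 G ->
  l (fun psi => l2 (G psi)) = l2 (fun phi => l (fun psi => G psi phi)).
Proof.
move=> ll ll2; elim=> [f g rf rg|G1 G2 r1 IH1 r2 IH2].
  transitivity (l f * l2 g).
    rewrite -flinZr //; congr l; apply/funext => psi; exact: flinZ.
  rewrite -flinZ //; congr l2; apply/funext => phi; symmetry; exact: flinZr.
transitivity (l (fun psi => l2 (G1 psi) + l2 (G2 psi))).
  congr l; apply/funext => psi; apply: flinD => //; exact: regular2_slicer.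
rewrite flinD //; [|exact: regular2_flin..].
rewrite IH1 IH2 -flinD //; [|exact: regular2_flinl..].
by congr l2; apply/funext => phi; rewrite flinD //; exact: regular2_slicel.
Qed.

(** Derivations at the point psi, that is tangent vectors to N at psi. *)
Definition pder (R : realType) (n : nat) (psi : diffeo0 R n)
    (l : (diffeo0 R n -> R[i]) -> R[i]) := flin l /\ forall f g, regular f -> regular g ->
  l (fun phi => f phi * g phi) = l f * g psi + f psi * l g.

Section FiniteLinear.
Variables (R : realType) (n : nat).
Local Notation N := (diffeo0 R n).
Local Notation C := R[i].
Local Notation fps := (fps R n).
Local Notation forms := (forms R n).
Implicit Types (u : forms) (L : forms -> C).

Lemma form_ext u u' : (forall k K, form_coef k K u = form_coef k K u') -> u = u'.
Proof.
case: u u' => a w [a' w'] uu; congr (_, _).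
  by apply/funext => K; exact: (uu None K).
by apply/funext => i; apply/funext => K; exact: (uu (Some i) K).
Qed.

Lemma form_coef_lin k K c u u' :
  form_coef k K (c *: u + u') = c * form_coef k K u + form_coef k K u'.
Proof. by case: k. Qed.

Lemma form_coef_mk k K c : form_coef k K (mkform c : forms) = c k K.
Proof. by case: k. Qed.

(** Continuous linear functionals on forms: those that depend on finitely many
    coefficients. Only these commute with functionals applied coefficientwise,
    because power series are infinite combinations of their coefficients. *)
Definition finlin L := exists s : seq (C * (option 'I_n * mindex n)),
  forall u, L u = \sum_(x <- s) x.1 * form_coef x.2.1 x.2.2 u.

Lemma finlin_coef k K : finlin (form_coef k K).
Proof. by exists [:: (1, (k, K))] => u; rewrite big_seq1 mul1r. Qed.

Lemma finlin0 : finlin (fun=> 0).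
Proof. by exists [::] => u; rewrite big_nil. Qed.

Lemma finlinD L L' : finlin L -> finlin L' -> finlin (fun u => L u + L' u).
Proof. by move=> [s sE] [t tE]; exists (s ++ t) => u; rewrite big_cat sE tE. Qed.

Lemma finlinZ c L : finlin L -> finlin (fun u => c * L u).
Proof.
move=> [s sE]; exists [seq (c * x.1, x.2) | x <- s] => u.
by rewrite big_map sE mulr_sumr; apply: eq_bigr => x _; rewrite mulrA.
Qed.

Lemma finlinZr c L : finlin L -> finlin (fun u => L u * c).
Proof. by move=> Ll; under eq_fun do rewrite mulrC; exact: finlinZ. Qed.

Lemma finlin_sum (T : Type) (r : seq T) (P : pred T) (L : T -> forms -> C) :
  (forall j, finlin (L j)) -> finlin (fun u => \sum_(j <- r | P j) L j u).
Proof.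
move=> Ll; elim: r => [|j r IH].
  by under eq_fun do rewrite big_nil; exact: finlin0.
under eq_fun do rewrite big_cons; case: (P j) => //; exact: finlinD.
Qed.

Lemma finlin_lin L c u u' : finlin L -> L (c *: u + u') = c * L u + L u'.
Proof.
move=> [s sE]; rewrite !sE mulr_sumr -big_split; apply: eq_bigr => x _ /=.
rewrite form_coef_lin; ring.
Qed.

Lemma finlinB L u u' : finlin L -> L (u - u') = L u - L u'.
Proof. by move=> Ll; rewrite addrC -scaleN1r finlin_lin // mulN1r addrC. Qed.

Lemma finlin_addE L u u' : finlin L -> L (u + u') = L u + L u'.
Proof. by move=> Ll; rewrite -(scale1r u) finlin_lin // mul1r scale1r. Qed.

Lemma finlin_0 L : finlin L -> L 0 = 0.
Proof. by move=> Ll; rewrite -(subrr 0) finlinB // subrr. Qed.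

Lemma finlin_scale L c u : finlin L -> L (c *: u) = c * L u.
Proof. by move=> Ll; rewrite -[c *: u]addr0 finlin_lin // finlin_0 // addr0. Qed.

Lemma finlin_sumE L (T : Type) (r : seq T) (c : T -> C) (u : T -> forms) : finlin L ->
  L (\sum_(t <- r) c t *: u t) = \sum_(t <- r) c t * L (u t).
Proof.
move=> Ll; elim: r => [|t r IH]; first by rewrite !big_nil finlin_0.
by rewrite !big_cons finlin_lin // IH.
Qed.

Lemma finlin_comp L (Th : forms -> forms) : finlin L ->
  (forall k K, finlin (fun u => form_coef k K (Th u))) -> finlin (fun u => L (Th u)).
Proof.
move=> [s sE] Thl; under eq_fun do rewrite sE.
by apply: finlin_sum => x; exact: finlinZ.
Qed.

Definition finlin_fps (Th : forms -> fps) := forall K, finlin (fun u => Th u K).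

Lemma finlin_fps_mul (f : fps) Th : finlin_fps Th -> finlin_fps (fun u => f * Th u).
Proof.
move=> Thl K.
rewrite (_ : (fun u => _) = (fun u => fps_mul f (Th u) K)) // /fps_mul.
by apply: finlin_sum => J; exact: finlinZ.
Qed.

Lemma finlin_fps_d i Th : finlin_fps Th -> finlin_fps (fun u => fps_d i (Th u)).
Proof. by move=> Thl K; exact: finlinZ. Qed.

Lemma finlin_fps_sum (T : Type) (r : seq T) (Th : T -> forms -> fps) :
  (forall j, finlin_fps (Th j)) -> finlin_fps (fun u => \sum_(j <- r) Th j u).
Proof.
by move=> Thl K; under eq_fun do rewrite fps_sumE; apply: finlin_sum => j; exact: Thl.
Qed.

Lemma finlin_lie v k K : finlin (fun u => form_coef k K (lie v u)).
Proof.
have f1 : finlin_fps fst by move=> J; exact: (finlin_coef None J).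
have f2 i : finlin_fps (fun u => u.2 i) by move=> J; exact: (finlin_coef (Some i) J).
have l0 Th : finlin_fps Th -> finlin_fps (fun u => lie0 v (Th u)).
  move=> Thl; apply: finlin_fps_sum => j; apply: finlin_fps_mul; exact: finlin_fps_d.
case: k => [i|]; last exact: l0.
rewrite (_ : (fun u => _) =
  fun u => lie0 v (u.2 i) K + (\sum_j fps_d i (v j) * u.2 j) K).
  apply: finlinD; first exact: l0.
  by apply: finlin_fps_sum => j; apply: finlin_fps_mul; exact: f2.
apply/funext => u /=; rewrite lie1E fps_addE; congr (_ + _ K).
by apply: eq_bigr => j _; rewrite mulrC.
Qed.

Definition regform (Fm : N -> forms) := forall k K, regular (fun phi => form_coef k K (Fm phi)).

Definition lform (l : (N -> C) -> C) (Fm : N -> forms) : forms :=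
  mkform (fun k K => l (fun phi => form_coef k K (Fm phi))).

Lemma finlin_regular L Fm : finlin L -> regform Fm -> regular (fun phi => L (Fm phi)).
Proof.
move=> [s sE] rF; under eq_fun do rewrite sE.
by apply: regular_sum => x _; apply: regular_scale; exact: rF.
Qed.

Lemma finlin_flin l L Fm : flin l -> finlin L -> regform Fm ->
  l (fun phi => L (Fm phi)) = L (lform l Fm).
Proof.
move=> ll [s sE] rF; rewrite sE; under eq_fun do rewrite sE.
rewrite (flin_sum ll); last by move=> x; apply: regular_scale; exact: rF.
apply: eq_bigr => x _; rewrite (flinZ ll); last exact: rF.
by rewrite form_coef_mk.
Qed.

Lemma regform_mul Fm G : regform Fm -> regform G ->
  regform (fun phi => form_mul (Fm phi) (G phi)).
Proof.
move=> rF rG [i|] K; last exact: regular_cst.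
apply: regular_sum => J _; apply: regular_mul.
  exact: (rF None).
exact: (rG (Some i)).
Qed.

Lemma form_mul_pder psi l Fm G k K : pder psi l -> regform Fm -> regform G ->
  l (fun phi => form_coef k K (form_mul (Fm phi) (G phi))) =
  form_coef k K (form_mul (lform l Fm) (G psi)) +
  form_coef k K (form_mul (Fm psi) (lform l G)).
Proof.
move=> [ll ld] rF rG; case: k => [i|] /=; last by rewrite (flin0 ll) addr0.
rewrite /fps_mul -big_split /=.
pose c1 J := fun phi => (Fm phi).1 J; pose c2 J := fun phi => (G phi).2 i J.
have rc1 J : regular (c1 J) by exact: (rF None).
have rc2 J : regular (c2 J) by exact: (rG (Some i)).
pose t (J : {ffun 'I_n -> 'I_(mdeg K).+1}) phi :=
  c1 [ffun i => nat_of_ord (J i)] phi * c2 [ffun i => (K i - J i)%N] phi.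
have rt J : regular (t J) by exact: regular_mul.
pose A := [pred J : {ffun 'I_n -> 'I_(mdeg K).+1} | [forall j, (J j <= K j)%N]].
transitivity (l (fun phi => \sum_(J <- enum A) t J phi)).
  by congr l; apply/funext => phi; rewrite big_enum.
rewrite (flin_sum ll _ rt) big_enum; apply: eq_bigr => J _.
by rewrite /t ld.
Qed.

End FiniteLinear.
Arguments finlin_coef {R n} k K.

(** * Functions on N and left invariant derivations *)

Section Duality.
Variables (R : realType) (n : nat).
Local Notation N := (diffeo0 R n).
Local Notation C := R[i].
Local Notation F := (N -> C).
Local Notation vfield := (vfield R n).
Local Notation saff := (saff R n).
Local Notation forms := (forms R n).
Local Notation Un := (uea (@nbr R n)).
Local Notation gen := (uea_gen (@nbr R n)).
Local Notation word := (uea_word (@nbr R n)).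
Local Notation e := (oneN R n).
Implicit Types (f g h : F) (psi phi : N).

Variable pr : Un -> F -> C.
Hypotheses (pr_hopf : hopf_pairing pr) (pr_nondeg : nondegenerate_pairing pr).

Lemma flin_pr v : flin (pr v).
Proof. by move=> k f g rf rg; exact: (pairing_linr pr_hopf). Qed.

Lemma pr_linl k u v f : regular f -> pr (k *: u + v) f = k * pr u f + pr v f.
Proof. exact: (pairing_linl pr_hopf). Qed.

Lemma pr1 f : regular f -> pr 1 f = f e.
Proof. exact: (pairing_1l pr_hopf). Qed.

Lemma prD u v f : regular f -> pr (u + v) f = pr u f + pr v f.
Proof. by move=> rf; rewrite -(scale1r u) pr_linl // mul1r scale1r. Qed.

Lemma pr0 f : regular f -> pr 0 f = 0.
Proof. by move=> rf; rewrite -(addNr 1) -scaleN1r pr_linl // mulN1r addNr. Qed.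

Lemma prN v f : regular f -> pr (- v) f = - pr v f.
Proof.
by move=> rf; rewrite -[- v]addr0 -scaleN1r pr_linl // pr0 // addr0 mulN1r.
Qed.

(** Words span U(n), so nondegeneracy separates regular functions by words. *)
Lemma regular_eq f g : regular f -> regular g ->
  (forall w, pr (word w) f = pr (word w) g) -> f = g.
Proof.
move=> rf rg fg; apply/funext => psi; apply/eqP; rewrite -subr_eq0; apply/eqP.
apply: (pr_nondeg.2 (fun psi => f psi - g psi)); first exact: regular_sub.
move=> v; rewrite (flinB (flin_pr v)) //; apply/eqP; rewrite subr_eq0; apply/eqP.
elim/uea_word_ind: v => [k u v IHu IHv|//].
by rewrite !pr_linl // IHu IHv.
Qed.

(** The left invariant derivation of F defined by xi, in Hopf terms
    f |-> f_(1) <xi, f_(2)>. *)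
Definition linv (xi : nfield R n) (f : F) : F :=
  fun psi => pr (gen xi) (fun phi => f (mulN psi phi)).

Lemma regular_linv xi f : regular f -> regular (linv xi f).
Proof. by move=> rf; apply: (regular2_flin (flin_pr _)); exact: regular_mulN. Qed.

Lemma regular_transl f psi : regular f -> regular (fun phi => f (mulN psi phi)).
Proof. by move=> rf; apply: (regular2_slicer (regular_mulN rf)). Qed.

Lemma pr_mul_gen u xi f : regular f -> pr (u * gen xi) f = pr u (linv xi f).
Proof. exact: (pairing_mull pr_hopf). Qed.

Lemma linv_e xi f : linv xi f e = pr (gen xi) f.
Proof. by congr (pr _ _); apply/funext => phi; rewrite mul1N. Qed.

Lemma flin_linv xi psi : flin (fun f => linv xi f psi).
Proof.
by move=> k f g rf rg; apply: (flin_pr (gen xi)); exact: regular_transl.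
Qed.

Lemma linv_transl xi f psi : linv xi (fun phi => f (mulN psi phi)) =
  fun phi => linv xi f (mulN psi phi).
Proof.
apply/funext => phi; congr (pr _ _); apply/funext => theta.
by rewrite mulNA.
Qed.

(** A generator of U(n) is primitive. *)
Lemma pder_gen xi : pder e (pr (gen xi)).
Proof.
split=> [|f g rf rg]; first exact: flin_pr.
rewrite -uea_word1 (pairing_mulr pr_hopf) // !big_cons big_nil /=.
by rewrite addr0 uea_word0 !pr1.
Qed.

Lemma pder_linv xi psi : pder psi (fun f => linv xi f psi).
Proof.
split=> [|f g rf rg]; first exact: flin_linv.
rewrite /linv (pder_gen xi).2 ?mulN1 //; exact: regular_transl.
Qed.

Lemma linvM xi f g : regular f -> regular g ->
  linv xi (fun psi => f psi * g psi) =
  fun psi => linv xi f psi * g psi + f psi * linv xi g psi.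
Proof. by move=> rf rg; apply/funext => psi; exact: (pder_linv xi psi).2. Qed.

Lemma linvD xi f g : regular f -> regular g ->
  linv xi (fun psi => f psi + g psi) = fun psi => linv xi f psi + linv xi g psi.
Proof. by move=> rf rg; apply/funext => psi; exact: (flinD (flin_linv xi psi)). Qed.

Lemma linvB xi f g : regular f -> regular g ->
  linv xi (fun psi => f psi - g psi) = fun psi => linv xi f psi - linv xi g psi.
Proof. by move=> rf rg; apply/funext => psi; exact: (flinB (flin_linv xi psi)). Qed.

Lemma linvZr xi k f : regular f ->
  linv xi (fun psi => f psi * k) = fun psi => linv xi f psi * k.
Proof. by move=> rf; apply/funext => psi; exact: (flinZr (flin_linv xi psi)). Qed.

Lemma linv_sum xi (T : Type) (r : seq T) (f : T -> F) : (forall j, regular (f j)) ->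
  linv xi (fun psi => \sum_(j <- r) f j psi) = fun psi => \sum_(j <- r) linv xi (f j) psi.
Proof. by move=> rf; apply/funext => psi; exact: (flin_sum (flin_linv xi psi)). Qed.

Inductive lspan (Z : F -> Prop) : F -> Prop :=
| lspan_gen f : Z f -> lspan Z f
| lspan0 : lspan Z (fun=> 0)
| lspan_add f g : lspan Z f -> lspan Z g -> lspan Z (fun psi => f psi + g psi)
| lspan_scale k f : lspan Z f -> lspan Z (fun psi => k * f psi).

(** The derivations linv xi, iterated along a word w and evaluated at the identity,
    compute the pairing with w. So all these pairings vanish, and nondegeneracy
    applies: a flat section that vanishes at one point is zero. *)
Lemma linv_zero (Z : F -> Prop) : (forall h, Z h -> regular h) ->
  (forall h, Z h -> h e = 0) -> (forall h xi, Z h -> lspan Z (linv xi h)) ->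
  forall h, Z h -> h = fun=> 0.
Proof.
move=> Zreg Ze ZD.
have Sreg h : lspan Z h -> regular h.
  elim=> [f /Zreg //||f g _ rf _ rg|k f _ rf].
  - exact: regular_cst.
  - exact: regular_add.
  - exact: regular_scale.
have Se h : lspan Z h -> h e = 0.
  elim=> [f /Ze //|//|f g _ -> _ ->|k f _ ->]; by rewrite ?addr0 ?mulr0.
have SD xi h : lspan Z h -> lspan Z (linv xi h).
  elim=> [f /ZD //||f g sf IHf sg IHg|k f sf IHf].
  - rewrite (_ : linv xi _ = fun=> 0); first exact: lspan0.
    by apply/funext => psi; exact: (flin0 (flin_linv xi psi)).
  - rewrite (_ : linv xi _ = (fun psi => linv xi f psi + linv xi g psi)).
      exact: lspan_add.
    by apply/funext => psi; apply: (flinD (flin_linv xi psi)); exact: Sreg.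
  - rewrite (_ : linv xi _ = (fun psi => k * linv xi f psi)).
      exact: lspan_scale.
    by apply/funext => psi; apply: (flinZ (flin_linv xi psi)); exact: Sreg.
have prS w h : lspan Z h -> pr (word w) h = 0.
  elim/last_ind: w h => [|w xi IH] h sh; have rh := Sreg h sh.
    by rewrite uea_word0 pr1 // Se.
  by rewrite uea_word_rcons pr_mul_gen // IH //; exact: SD.
move=> h Zh; have sh := lspan_gen Zh; apply: regular_eq; first exact: Zreg.
  exact: regular_cst.
by move=> w; rewrite prS // (flin0 (flin_pr _)).
Qed.

Variables (tri : Un -> saff -> saff) (tel : Un -> saff -> Un).
Hypothesis mat : matched_actions tri tel.
Variable actF : saff -> F -> F.
Hypothesis actF_dual : dual_action pr tel actF.

Lemma regular_actF X f : regular f -> regular (actF X f).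
Proof. by move=> rf; have [] := actF_dual X rf. Qed.

Lemma pr_actF v X f : regular f -> pr v (actF X f) = pr (tel v X) f.
Proof. by move=> rf; have [_] := actF_dual X rf. Qed.

(** The action of W_n = s (+) n on F: s acts by the given action and n by left
    invariant derivations. The s-part alone does not yield families stable
    under linv, since [xi, X] has components in s and in n. *)
Definition wactF (w : vfield) (f : F) : F :=
  fun psi => actF (sproj w) f psi + linv (nproj w) f psi.

Lemma regular_wactF w f : regular f -> regular (wactF w f).
Proof. by move=> rf; apply: regular_add; [exact: regular_actF|exact: regular_linv]. Qed.

(** The action on F is the transpose of the right action on U(n). *)
Lemma pr_wactF v w f : regular f -> pr v (wactF w f) = pr (Rop v w) f.
Proof.
move=> rf; rewrite (flinD (flin_pr v)); [|exact: regular_actF|exact: regular_linv].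
rewrite pr_actF // (telE mat) -pr_mul_gen // -prD // -Rop_n -RopD.
by rewrite -sn_decomp.
Qed.

Lemma wactF_e w f : regular f -> wactF w f e = pr (gen (nproj w)) f.
Proof. by move=> rf; rewrite -pr1 ?pr_wactF ?Rop1 //; exact: regular_wactF. Qed.

Lemma wactF_svec X f : regular f -> wactF (svec X) f = actF X f.
Proof.
move=> rf; apply: regular_eq => [||v]; [exact: regular_wactF|exact: regular_actF|].
by rewrite pr_wactF // pr_actF // (telE mat).
Qed.

Lemma wactF_lin w k f g : regular f -> regular g ->
  wactF w (fun psi => k * f psi + g psi) = fun psi => k * wactF w f psi + wactF w g psi.
Proof.
move=> rf rg; have rkfg : regular (fun psi => k * f psi + g psi).
  by apply: regular_add => //; exact: regular_scale.
have rwf := regular_wactF w rf; have rwg := regular_wactF w rg.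
apply: regular_eq => [||v]; first exact: regular_wactF.
  by apply: regular_add => //; exact: regular_scale.
by rewrite pr_wactF // !(flin_pr _) // !pr_wactF.
Qed.

Lemma flin_wactF w psi : flin (fun f => wactF w f psi).
Proof. by move=> k f g rf rg; rewrite wactF_lin. Qed.

Lemma wactFD w f g : regular f -> regular g ->
  wactF w (fun psi => f psi + g psi) = fun psi => wactF w f psi + wactF w g psi.
Proof. by move=> rf rg; apply/funext => psi; exact: (flinD (flin_wactF w psi)). Qed.

(** The commutation rule of W_n, in its dual form (u xi) w = (u w) xi + u [xi, w]. *)
Lemma linv_wactF xi w f : regular f -> linv xi (wactF w f) =
  fun psi => wactF w (linv xi f) psi + wactF (vbr (val xi) w) f psi.
Proof.
move=> rf; have rD := regular_linv xi rf; have rw := regular_wactF w rf.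
apply: regular_eq => [||v].
- exact: regular_linv.
- by apply: regular_add; exact: regular_wactF.
rewrite -pr_mul_gen // pr_wactF // Rop_mul prD // pr_mul_gen //.
rewrite (flinD (flin_pr _)); [|exact: regular_wactF..].
by rewrite !pr_wactF.
Qed.

(** The actions are only known to be dual to each other, so the derivation property
    is deduced from its infinitesimal version at the identity by linv_zero. *)
Lemma wactFM w f g : regular f -> regular g -> wactF w (fun psi => f psi * g psi) =
  fun psi => wactF w f psi * g psi + f psi * wactF w g psi.
Proof.
pose Z h := exists w f g, [/\ regular f, regular g &
  h = (fun psi => wactF w (fun psi => f psi * g psi) psi -
    (wactF w f psi * g psi + f psi * wactF w g psi))].
move=> rf rg; apply/funext => psi; apply/eqP; rewrite -subr_eq0; apply/eqP.
have Zh : Z (fun psi => wactF w (fun psi => f psi * g psi) psi -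
    (wactF w f psi * g psi + f psi * wactF w g psi)) by exists w, f, g.
suff H : forall h, Z h -> h = fun=> 0 by exact: (congr1 (fun h => h psi) (H _ Zh)).
have regZ w' f' g' : regular f' -> regular g' ->
  [/\ regular (wactF w' (fun psi => f' psi * g' psi)),
      regular (fun psi => wactF w' f' psi * g' psi) &
      regular (fun psi => f' psi * wactF w' g' psi)].
  move=> rf' rg'; split; [apply: regular_wactF| |]; apply: regular_mul => //;
    exact: regular_wactF.
apply: linv_zero => {w f g rf rg psi Zh} [_ [w [f [g [rf rg ->]]]]
  |_ [w [f [g [rf rg ->]]]]|_ xi [w [f [g [rf rg ->]]]]].
- have [r1 r2 r3] := regZ w f g rf rg.
  by apply: regular_sub => //; exact: regular_add.
- rewrite !wactF_e //; last exact: regular_mul.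
  by rewrite (pder_gen _).2 // subrr.
- have [r1 r2 r3] := regZ w f g rf rg.
  have rwf := regular_wactF w rf; have rwg := regular_wactF w rg.
  have rDf := regular_linv xi rf; have rDg := regular_linv xi rg.
  rewrite (_ : linv xi _ = fun psi =>
    ((wactF w (fun psi => linv xi f psi * g psi) psi -
    (wactF w (linv xi f) psi * g psi + linv xi f psi * wactF w g psi)) +
    (wactF w (fun psi => f psi * linv xi g psi) psi -
    (wactF w f psi * linv xi g psi + f psi * wactF w (linv xi g) psi))) +
    (wactF (vbr (val xi) w) (fun psi => f psi * g psi) psi -
    (wactF (vbr (val xi) w) f psi * g psi
      + f psi * wactF (vbr (val xi) w) g psi))).
    apply: lspan_add; [apply: lspan_add|]; apply: lspan_gen.
    + by exists w, (linv xi f), g.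
    + by exists w, f, (linv xi g).
    + by exists (vbr (val xi) w), f, g.
  have rfg := regular_mul rf rg.
  have rDfg := regular_mul rDf rg; have rfDg := regular_mul rf rDg.
  rewrite (linvB _ r1 (regular_add r2 r3)) (linvD _ r2 r3).
  rewrite (linvM _ rwf rg) (linvM _ rf rwg) (linv_wactF _ _ rfg).
  rewrite (linv_wactF _ _ rf) (linv_wactF _ _ rg) (linvM _ rf rg).
  rewrite (wactFD _ rDfg rfDg).
  by apply/funext => psi; ring.
Qed.

Lemma pder_wactF w psi : pder psi (fun f => wactF w f psi).
Proof. by split=> [|f g rf rg]; [exact: flin_wactF|rewrite wactFM]. Qed.

Lemma pder_actF X psi : pder psi (fun f => actF X f psi).
Proof.
have [l d] := pder_wactF (svec X) psi.
split=> [k f g rf rg|f g rf rg]; rewrite -!wactF_svec //.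
- exact: l.
- by apply: regular_add => //; exact: regular_scale.
- exact: d.
- exact: regular_mul.
Qed.

(** The same principle for a family with parameters. The identities on N follow
    by applying it to the difference H of their two sides. *)
Lemma linv_family (T : Type) (P : T -> Prop) (H : T -> F) :
  (forall t, P t -> regular (H t)) -> (forall t, P t -> H t e = 0) ->
  (forall t xi, P t -> lspan (fun h => exists2 t, P t & h = H t) (linv xi (H t))) ->
  forall t, P t -> forall psi, H t psi = 0.
Proof.
move=> Hreg He HD t Pt psi.
suff : forall h, (exists2 t, P t & h = H t) -> h = fun=> 0.
  by move=> /(_ _ (ex_intro2 _ _ t Pt erefl)) ->.
apply: linv_zero => [h|h|h xi] [t' Pt' ->]; [exact: Hreg|exact: He|exact: HD].
Qed.

Lemma lspan_family (T : Type) (P : T -> Prop) (H : T -> F) t :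
  P t -> lspan (fun h => exists2 t, P t & h = H t) (H t).
Proof. by move=> Pt; apply: lspan_gen; exists t. Qed.

Lemma actF_linl k X Y f : regular f ->
  actF (k *: X + Y) f = fun psi => k * actF X f psi + actF Y f psi.
Proof.
move=> rf; have rX := regular_actF X rf; have rY := regular_actF Y rf.
apply: regular_eq => [||w].
- exact: regular_actF.
- by apply: regular_add => //; exact: regular_scale.
- by rewrite (flin_pr _) // !pr_actF // (tel_linr mat) pr_linl.
Qed.

Lemma actF_delta X f psi : regular f ->
  actF X f psi = \sum_b X b * actF (sdelta R b) f psi.
Proof.
move=> rf; have a0 : actF 0 f psi = 0.
  have := actF_linl (-1) 0 0 rf; rewrite scaler0 addr0 => /(congr1 (fun h => h psi)).
  by rewrite mulN1r addNr.
rewrite [in LHS](saff_delta X); elim: (index_enum _) => [|b r IH].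
  by rewrite !big_nil.
by rewrite !big_cons actF_linl // IH.
Qed.

(** * The coaction on s *)

Variable coS : saff -> N -> saff.
Hypothesis coS_co : s_coaction pr tri coS.

(** The matrix coefficients X_<1> of the coaction. *)
Definition cs X b : F := fun psi => coS X psi b.

Lemma regular_cs X b : regular (cs X b).
Proof. by have [] := coS_co X b. Qed.

Lemma pr_cs v X b : pr v (cs X b) = tri v X b.
Proof. by have [_] := coS_co X b. Qed.

Lemma coS_lin k X Y psi : coS (k *: X + Y) psi = k *: coS X psi + coS Y psi.
Proof.
apply/funext => b.
have : cs (k *: X + Y) b = fun psi => k * cs X b psi + cs Y b psi.
  have rX := regular_cs X b; have rY := regular_cs Y b.
  apply: regular_eq => [||w]; first exact: regular_cs.
    by apply: regular_add => //; exact: regular_scale.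
  by rewrite (flin_pr _) // !pr_cs (tri_linr mat).
by move/(congr1 (fun h => h psi)).
Qed.

Lemma coS_delta X psi b : coS X psi b = \sum_c X c * coS (sdelta R c) psi b.
Proof.
have c0 : coS 0 psi = 0.
  have := coS_lin (-1) 0 0 psi; rewrite scaler0 addr0 => ->.
  by rewrite scaleN1r addNr.
rewrite [in LHS](saff_delta X); elim: (index_enum _) => [|c r IH].
  by rewrite !big_nil c0.
by rewrite !big_cons coS_lin saff_addE saff_scaleE IH.
Qed.

Lemma coS_e X : coS X e = X.
Proof.
by apply/funext => b; rewrite -[LHS](pr1 (regular_cs X b)) pr_cs (tri_1 mat).
Qed.

Lemma linv_cs xi X b : linv xi (cs X b) = cs (act_s xi X) b.
Proof.
have rX := regular_cs X b.
apply: regular_eq => [||w]; [exact: regular_linv|exact: regular_cs|].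
by rewrite -pr_mul_gen // !pr_cs (tri_mul mat) (tri_gen mat).
Qed.

Lemma act_s_sproj xi (w : vfield) : act_s xi (sproj w) = sproj (vbr (val xi) w).
Proof.
rewrite /act_s [in RHS](sn_decomp w) vbrDr sprojD.
by rewrite -[vbr (val xi) (val _)]/(val (nbr xi (nproj w))) sproj_n addr0.
Qed.

(** Extending X to a field w, of which only the s-component counts, gives the
    parameter in W_n required for a stable family. *)
Lemma linv_csW xi w b : linv xi (cs (sproj w) b) = cs (sproj (vbr (val xi) w)) b.
Proof. by rewrite linv_cs act_s_sproj. Qed.

(** The coaction axiom, as an action of the group N on s. *)
Lemma coS_mulN X psi phi : coS X (mulN psi phi) = coS (coS X phi) psi.
Proof.
apply/funext => b; rewrite [RHS]coS_delta; apply/eqP; rewrite -subr_eq0; apply/eqP.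
pose H X := fun phi => cs X b (mulN psi phi) -
  \sum_c cs X c phi * cs (sdelta R c) b psi.
have r1 Y : regular (fun phi => cs Y b (mulN psi phi)).
  by apply: regular_transl; exact: regular_cs.
have r2 Y c : regular (fun phi => cs Y c phi * cs (sdelta R c) b psi).
  by apply: regular_mul; [exact: regular_cs|exact: regular_cst].
apply: (@linv_family _ (fun=> True) H _ _ _ X I phi) => [Y _|Y _|Y xi _].
- by apply: regular_sub => //; apply: regular_sum => c _.
- rewrite /H mulN1; under eq_bigr do rewrite /cs coS_e.
  by rewrite -coS_delta subrr.
- rewrite (_ : linv xi (H Y) = H (act_s xi Y)); first exact: lspan_family.
  rewrite linvB //; last by apply: regular_sum => c _.
  rewrite linv_transl linv_cs linv_sum //; apply/funext => theta; congr (_ - _).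
  apply: eq_bigr => c _; rewrite linvZr ?linv_cs //; exact: regular_cs.
Qed.

Lemma regular2_translr (G : N -> F) phi : regular2 G ->
  regular2 (fun p q => G p (mulN phi q)).
Proof.
elim=> [f g rf rg|G1 G2 _ IH1 _ IH2]; last exact: regular2_add.
by apply: regular2_pure => //; exact: regular_transl.
Qed.

Lemma regular_actF_transr X f psi : regular f ->
  regular (fun phi => actF X (fun p => f (mulN p phi)) psi).
Proof.
move=> rf; have [l _] := pder_actF X psi.
exact: (regular2_flinl l (regular_mulN rf)).
Qed.

Lemma linv_actF_transr xi X f psi : regular f ->
  linv xi (fun phi => actF X (fun p => f (mulN p phi)) psi) =
  fun phi => actF X (fun p => linv xi f (mulN p phi)) psi.
Proof.
move=> rf; apply/funext => phi; rewrite /linv; have [l _] := pder_actF X psi.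
have r2 := regular2_translr phi (regular_mulN rf).
rewrite -(flin_fubini l (flin_pr (gen xi)) r2); congr (actF _ _ _).
apply/funext => p; congr (pr _ _); apply/funext => q; by rewrite mulNA.
Qed.

(** The compatibility of the action with the coproduct,
      Delta(w |> f) = (w_<0> |> f_(1)) (x) w_<1> f_(2) + f_(1) (x) w |> f_(2),
    proved for fields w in W_n because a left invariant derivation in phi
    replaces (w, f) by (w, linv xi f) and ([xi, w], f). *)
Lemma wactF_mulN w f psi phi : regular f -> wactF w f (mulN psi phi) =
  \sum_b coS (sproj w) phi b * actF (sdelta R b) (fun p => f (mulN p phi)) psi
  + wactF w (fun q => f (mulN psi q)) phi.
Proof.
move=> rf; apply/eqP; rewrite -subr_eq0 opprD addrA; apply/eqP.
pose H (t : vfield * F) := fun phi => wactF t.1 t.2 (mulN psi phi) -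
  \sum_b cs (sproj t.1) b phi * actF (sdelta R b) (fun p => t.2 (mulN p phi)) psi
  - wactF t.1 (fun q => t.2 (mulN psi q)) phi.
have r1 v g : regular g -> regular (fun phi => wactF v g (mulN psi phi)).
  by move=> rg; apply: regular_transl; exact: regular_wactF.
have r2 v g b : regular g -> regular (fun phi => cs (sproj v) b phi *
    actF (sdelta R b) (fun p => g (mulN p phi)) psi).
  move=> rg; apply: regular_mul; [exact: regular_cs|exact: regular_actF_transr].
have r3 v g : regular g -> regular (wactF v (fun q => g (mulN psi q))).
  by move=> rg; apply: regular_wactF; exact: regular_transl.
have r2s v g : regular g -> regular (fun phi => \sum_b cs (sproj v) b phi *
    actF (sdelta R b) (fun p => g (mulN p phi)) psi).
  by move=> rg; apply: regular_sum => b _; exact: r2.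
apply: (@linv_family _ (fun t => regular t.2) H _ _ _ (w, f) rf phi)
    => {w f rf} [[w f] /= rf|[w f] /= rf|[w f] xi /= rf].
- by apply: regular_sub (regular_sub (r1 _ _ rf) _) (r3 _ _ rf); exact: r2s.
- rewrite /H /= mulN1 wactF_e; last exact: regular_transl.
  under eq_bigr do rewrite /cs coS_e.
  rewrite (_ : \sum_b _ = actF (sproj w) f psi).
    by rewrite /wactF /linv [actF _ _ _ + _]addrC addrK subrr.
  rewrite actF_delta //; apply: eq_bigr => b _; congr (_ * actF _ _ _).
  by apply/funext => p; rewrite mulN1.
- have rD := regular_linv xi rf.
  rewrite (_ : linv xi (H (w, f)) = fun phi => H (w, linv xi f) phi +
       H (vbr (val xi) w, f) phi).
    apply: lspan_add.
      exact: (@lspan_family _ (fun t => regular t.2) H (w, linv xi f)).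
    exact: (@lspan_family _ (fun t => regular t.2) H (vbr (val xi) w, f)).
  rewrite (linvB _ (regular_sub (r1 _ _ rf) (r2s _ _ rf)) (r3 _ _ rf)).
  rewrite (linvB _ (r1 _ _ rf) (r2s _ _ rf)).
  rewrite linv_transl linv_wactF // linv_wactF; last exact: regular_transl.
  rewrite linv_transl linv_sum; last by move=> b; exact: r2.
  apply/funext => theta; rewrite /H /=.
  rewrite (_ : \sum_j _ =
    \sum_b cs (sproj (vbr (val xi) w)) b theta *
         actF (sdelta R b) (fun p => f (mulN p theta)) psi +
    \sum_b cs (sproj w) b theta *
         actF (sdelta R b) (fun p => linv xi f (mulN p theta)) psi); first by ring.
  rewrite -big_split; apply: eq_bigr => b _ /=.
  rewrite linvM; [|exact: regular_cs|exact: regular_actF_transr].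
  by rewrite linv_csW linv_actF_transr.
Qed.

Lemma actF_mulN X f psi phi : regular f -> actF X f (mulN psi phi) =
  \sum_b coS X phi b * actF (sdelta R b) (fun p => f (mulN p phi)) psi
  + actF X (fun q => f (mulN psi q)) phi.
Proof.
move=> rf; rewrite -wactF_svec // wactF_mulN // svecK wactF_svec //.
exact: regular_transl.
Qed.

Lemma actF_e X f : regular f -> actF X f e = 0.
Proof. by move=> rf; rewrite -pr1 ?pr_actF ?(tel1 mat) ?pr0 //; exact: regular_actF. Qed.

Lemma sbr_strC (X Y : saff) k : sbr X Y k = \sum_a \sum_b X a * Y b * strC R k a b.
Proof.
have lin0 (T : Type) (r : seq T) (G : saff -> saff) (c : T -> C) (Z : T -> saff) :
   (forall k X Y, G (k *: X + Y) = k *: G X + G Y) ->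
   G (\sum_(t <- r) c t *: Z t) = \sum_(t <- r) c t *: G (Z t).
  move=> Gl; have G0 : G 0 = 0.
    by have := Gl (-1) 0 0; rewrite scaler0 addr0 scaleN1r addNr.
  by elim: r => [|t r IH]; rewrite ?big_nil // !big_cons Gl IH.
have linl (Z : saff) k' X' Y' : sbr (k' *: X' + Y') Z = k' *: sbr X' Z + sbr Y' Z.
  by rewrite /sbr !linearP vbr_linl linearP.
have linr (Z : saff) k' X' Y' : sbr Z (k' *: X' + Y') = k' *: sbr Z X' + sbr Z Y'.
  by rewrite /sbr !linearP vbr_linr linearP.
have -> : sbr X Y = \sum_a X a *: sbr (sdelta R a) Y.
  rewrite [in LHS](saff_delta X).
  exact: (lin0 _ (index_enum _) (fun Z => sbr Z Y) X _ (linl Y)).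
rewrite saff_sumE; apply: eq_bigr => a _.
have -> : sbr (sdelta R a) Y = \sum_b Y b *: sbr (sdelta R a) (sdelta R b).
  rewrite [in LHS](saff_delta Y).
  exact: (lin0 _ (index_enum _) (sbr (sdelta R a)) Y _ (linr (sdelta R a))).
rewrite saff_scaleE saff_sumE mulr_sumr; apply: eq_bigr => b _.
by rewrite saff_scaleE mulrA.
Qed.

(** The bracket of s from that of W_n: the correction terms come from the
    components in n. *)
Lemma sbr_sproj (v w : vfield) : sproj (vbr v w) = sbr (sproj v) (sproj w)
  + sproj (vbr (val (nproj v)) w) - sproj (vbr (val (nproj w)) v).
Proof.
have nn v' w' : sproj (vbr (val (nproj v')) (val (nproj w'))) = 0 :> saff.
  exact: (sproj_n (nbr _ _)).
have ns v' w' : sproj (vbr (val (nproj v')) w') =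
    sproj (vbr (val (nproj v')) (svec (sproj w'))) :> saff.
  by rewrite [in LHS](sn_decomp w') vbrDr sprojD nn addr0.
rewrite (ns v w) (ns w v) [in LHS](sn_decomp v) [in LHS](sn_decomp w) vbrDr.
rewrite !(vbrDl _ (svec (sproj v)) (val (nproj v))) !sprojD nn addr0.
by rewrite (vbr_skew (svec _) (val _)) sprojN.
Qed.

(** The failure of the coaction to respect brackets is compensated by derivatives
    of its matrix coefficients. Transposed, this is the Maurer-Cartan equation of
    the forms coSdual, see dtot_coSdual. *)
Lemma coS_br X Y phi k : coS (sbr X Y) phi k =
  \sum_a \sum_b coS X phi a * coS Y phi b * strC R k a b
  + actF X (cs Y k) phi - actF Y (cs X k) phi.
Proof.
pose H (t : vfield * vfield) := fun phi => cs (sproj (vbr t.1 t.2)) k phi -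
  \sum_a \sum_b cs (sproj t.1) a phi * cs (sproj t.2) b phi * strC R k a b
  - wactF t.1 (cs (sproj t.2) k) phi + wactF t.2 (cs (sproj t.1) k) phi.
have r2 v w a b : regular (fun phi => cs (sproj v) a phi * cs (sproj w) b phi
     * strC R k a b).
  by apply: regular_mul; [apply: regular_mul; exact: regular_cs|exact: regular_cst].
have r2s v w a : regular (fun phi => \sum_b cs (sproj v) a phi * cs (sproj w) b phi
     * strC R k a b).
  by apply: regular_sum => b _.
have r2ss v w : regular (fun phi => \sum_a \sum_b cs (sproj v) a phi *
    cs (sproj w) b phi * strC R k a b).
  by apply: regular_sum => a _.
have rc v : regular (cs (sproj v) k) by exact: regular_cs.
have rw v w : regular (wactF v (cs (sproj w) k)) by exact: regular_wactF.
have rA v w := regular_sub (rc (vbr v w)) (r2ss v w).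
have rB v w := regular_sub (rA v w) (rw v w).
suff : H (svec X, svec Y) phi = 0.
  rewrite /H /= !svecK !wactF_svec; [|exact: regular_cs..].
  rewrite -[sproj (vbr _ _)]/(sbr X Y) => h; apply: subr0_eq; rewrite -[RHS]h /cs.
  ring.
apply: (@linv_family _ (fun=> True) H _ _ _ (_, _) I phi)
    => {X Y phi} [[v w] _|[v w] _|[v w] xi _].
- by apply: regular_add (rB v w) (rw w v).
- rewrite /H /=; under eq_bigr do under eq_bigr do rewrite /cs !coS_e.
  rewrite !(wactF_e _ (rc _)) /cs coS_e -!/(cs _ _) !pr_cs !(tri_gen mat) !act_s_sproj sbr_sproj -sbr_strC.
  by rewrite !saff_addE -[(- _) k]/(- (_ k)); ring.
- rewrite (_ : linv xi (H (v, w)) = fun phi => H (vbr (val xi) v, w) phi +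
      H (v, vbr (val xi) w) phi).
    apply: lspan_add.
      exact: (@lspan_family _ (fun=> True) H (vbr (val xi) v, w)).
    exact: (@lspan_family _ (fun=> True) H (v, vbr (val xi) w)).
  rewrite (linvD _ (rB v w) (rw w v)) (linvB _ (rA v w) (rw v w)).
  rewrite (linvB _ (rc (vbr v w)) (r2ss v w)) !linv_wactF // !linv_csW.
  rewrite linv_sum //; apply/funext => theta; rewrite /H /=.
  rewrite (_ : \sum_a _ =
    \sum_a \sum_b cs (sproj (vbr (val xi) v)) a theta * cs (sproj w) b theta * strC R k a b
  + \sum_a \sum_b cs (sproj v) a theta * cs (sproj (vbr (val xi) w)) b theta * strC R k a b).
    rewrite vbr_jacobi sprojD.
    have -> (A B : saff) : cs (A + B) k theta = cs A k theta + cs B k theta.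
      by rewrite /cs -(scale1r A) coS_lin !scale1r.
    ring.
  rewrite -big_split; apply: eq_bigr => a _ /=; rewrite linv_sum // -big_split.
  apply: eq_bigr => b _ /=; rewrite linvZr; last first.
    by apply: regular_mul; exact: regular_cs.
  by rewrite linvM; [|exact: regular_cs..]; rewrite !linv_csW mulrDl.
Qed.

(** * The coaction on forms *)

Variable coO : forms -> N -> forms.
Hypothesis coO_co : form_coaction pr coO.

Lemma regform_coO u : regform (coO u).
Proof. by move=> k K; have [] := coO_co u k K. Qed.

Lemma pr_coO w u k K : pr (word w) (fun phi => form_coef k K (coO u phi)) =
  form_coef k K (foldr (fun xi => lie (val xi)) u w).
Proof. by have [_] := coO_co u k K. Qed.

Lemma coO_lin c u u' phi : coO (c *: u + u') phi = c *: coO u phi + coO u' phi.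
Proof.
apply: form_ext => k K; rewrite form_coef_lin.
suff : (fun phi => form_coef k K (coO (c *: u + u') phi)) =
    fun phi => c * form_coef k K (coO u phi) + form_coef k K (coO u' phi).
  by move/(congr1 (fun h => h phi)).
have r1 := regform_coO u k K; have r2 := regform_coO u' k K.
apply: regular_eq => [||w]; first exact: regform_coO.
  by apply: regular_add => //; exact: regular_scale.
rewrite (flin_pr _) // !pr_coO -form_coef_lin; congr form_coef.
by elim: w => //= xi w ->; rewrite linearP.
Qed.

Lemma coO_e u : coO u e = u.
Proof.
apply: form_ext => k K; have r := regform_coO u k K.
by rewrite -[LHS](pr1 r) -uea_word0 pr_coO.
Qed.

Lemma linv_coO xi u k K : linv xi (fun phi => form_coef k K (coO u phi)) =
  fun phi => form_coef k K (coO (lie (val xi) u) phi).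
Proof.
have r := regform_coO u k K.
apply: regular_eq => [||w]; [exact: regular_linv|exact: regform_coO|].
by rewrite -pr_mul_gen // -uea_word_rcons !pr_coO foldr_rcons.
Qed.

Lemma lform_linv_coO xi u phi :
  lform (fun f => linv xi f phi) (coO u) = coO (lie (val xi) u) phi.
Proof.
apply: form_ext => k K; rewrite form_coef_mk.
exact: (congr1 (fun h => h phi) (linv_coO xi u k K)).
Qed.

(** Lie derivatives along n do not lower the order of a form. *)
Lemma coO_order d u phi : forms_order d u -> forms_order d (coO u phi).
Proof.
move=> ud; have coef0 k K : (mdeg K < d)%N -> form_coef k K (coO u phi) = 0.
  move=> Kd; suff : (fun phi => form_coef k K (coO u phi)) = fun=> 0.
    by move/(congr1 (fun h => h phi)).
  apply: regular_eq => [||w]; [exact: regform_coO|exact: regular_cst|].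
  rewrite pr_coO (flin0 (flin_pr _)).
  have : forms_order d (foldr (fun xi => lie (val xi)) u w).
    by elim: w => //= xi w IH; exact: lie_order.
  by case: k => [i|] [h1 h2]; [exact: h2|exact: h1].
by split=> [|i] K Kd; [exact: (coef0 None)|exact: (coef0 (Some i))].
Qed.

(** The basis of monomial forms. *)
Definition fmono (k : option 'I_n) (J : mindex n) : forms :=
  mkform (fun k' K => ((k' == k) && (K == J))%:R).

(** By coO_order, a coefficient of coO u phi of degree d only sees the finitely
    many coefficients of u of degree at most d. This is what makes the coaction
    a continuous operator. *)
Lemma coO_expand u phi k K : form_coef k K (coO u phi) =
  \sum_k' \sum_(J <- mbox n (mdeg K))
    form_coef k' J u * form_coef k K (coO (fmono k' J) phi).
Proof.
pose m := \sum_k' \sum_(J <- mbox n (mdeg K)) form_coef k' J u *: fmono k' J.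
have mE k1 K1 : (mdeg K1 < (mdeg K).+1)%N -> form_coef k1 K1 m = form_coef k1 K1 u.
  have coefD (v v' : forms) := finlin_addE v v' (finlin_coef k1 K1).
  have coef0 := finlin_0 (finlin_coef (R := R) k1 K1).
  move=> K1d; rewrite /m (big_morph _ coefD coef0) (bigD1 k1) //=.
  rewrite [X in _ + X]big1 => [|k' /negPf k'k]; rewrite (big_morph _ coefD coef0).
    rewrite addr0 (eq_bigr (fun J => if K1 == J then form_coef k1 J u else 0)).
      by rewrite big_seq_delta ?mbox_uniq // mdeg_mbox.
    move=> J _; rewrite finlin_scale; last exact: finlin_coef.
    by rewrite form_coef_mk eqxx /=; case: eqP; rewrite ?mulr1 ?mulr0.
  rewrite big1 // => J _; rewrite finlin_scale; last exact: finlin_coef.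
  by rewrite form_coef_mk eq_sym k'k mulr0.
have um : forms_order (mdeg K).+1 (u - m).
  have um0 k1 K1 : (mdeg K1 < (mdeg K).+1)%N -> form_coef k1 K1 (u - m) = 0.
    by move=> K1d; rewrite (finlinB _ _ (finlin_coef _ _)) mE // subrr.
  by split=> [|i] K1 K1d; [exact: (um0 None)|exact: (um0 (Some i))].
have cm : form_coef k K (coO (u - m) phi) = 0.
  have [h1 h2] := coO_order phi um.
  by case: k => [i|]; [exact: h2|exact: h1].
have coOD v v' : coO (v + v') phi = coO v phi + coO v' phi.
  by rewrite -(scale1r v) coO_lin !scale1r.
have coO0 : coO 0 phi = 0.
  by have := coO_lin (-1) 0 0 phi; rewrite scaler0 addr0 scaleN1r addNr.
rewrite -{1}(subrK m u) coOD (finlin_addE _ _ (finlin_coef _ _)) cm add0r.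
rewrite /m (big_morph (coO^~ phi) coOD coO0).
rewrite (big_morph (form_coef k K) (fun v v' => finlin_addE v v' (finlin_coef _ _))
  (finlin_0 (finlin_coef _ _))).
apply: eq_bigr => k' _; rewrite (big_morph (coO^~ phi) coOD coO0).
rewrite (big_morph (form_coef k K) (fun v v' => finlin_addE v v' (finlin_coef _ _))
  (finlin_0 (finlin_coef _ _))).
apply: eq_bigr => J _; rewrite -[_ *: _]addr0 coO_lin coO0 addr0.
exact: (finlin_scale _ _ (finlin_coef _ _)).
Qed.

Lemma finlin_coO phi k K : finlin (fun u => form_coef k K (coO u phi)).
Proof.
under eq_fun do rewrite coO_expand.
apply: finlin_sum => k'; apply: finlin_sum => J; apply: finlinZr.
exact: finlin_coef.
Qed.

(** N acts on forms by pullback, and Lie derivatives are derivations. *)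
Lemma coO_mul u u' phi :
  coO (form_mul u u') phi = form_mul (coO u phi) (coO u' phi).
Proof.
apply: form_ext => k K; apply: subr0_eq.
pose H (t : forms * forms) := fun phi => form_coef k K (coO (form_mul t.1 t.2) phi) -
  form_coef k K (form_mul (coO t.1 phi) (coO t.2 phi)).
have r1 v := regform_coO v k K.
have r2 v v' : regular (fun phi => form_coef k K (form_mul (coO v phi) (coO v' phi))).
  by apply: regform_mul; exact: regform_coO.
apply: (@linv_family _ (fun=> True) H _ _ _ (u, u') I phi)
    => {u u' phi} [[u u'] _|[u u'] _|[u u'] xi _].
- exact: regular_sub.
- by rewrite /H /= !coO_e subrr.
- rewrite (_ : linv xi (H (u, u')) = fun phi => H (lie (val xi) u, u') phi +
      H (u, lie (val xi) u') phi).
    apply: lspan_add.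
      exact: (@lspan_family _ (fun=> True) H (lie (val xi) u, u')).
    exact: (@lspan_family _ (fun=> True) H (u, lie (val xi) u')).
  rewrite (linvB _ (r1 _) (r2 _ _)) linv_coO; apply/funext => phi.
  rewrite (form_mul_pder k K (pder_linv xi phi)); [|exact: regform_coO..].
  rewrite !lform_linv_coO lieM /H /= -{1}(scale1r (form_mul _ _)) coO_lin scale1r.
  by rewrite (finlin_addE _ _ (finlin_coef _ _)); ring.
Qed.

Lemma coO_mulN u psi phi : coO u (mulN psi phi) = coO (coO u phi) psi.
Proof.
apply: form_ext => k K; apply: subr0_eq.
pose H u := fun phi => form_coef k K (coO u (mulN psi phi)) -
  form_coef k K (coO (coO u phi) psi).
have r1 v : regular (fun phi => form_coef k K (coO v (mulN psi phi))).
  exact: (@regular_transl (fun phi => form_coef k K (coO v phi)) psi (regform_coO v k K)).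
have r2 v : regular (fun phi => form_coef k K (coO (coO v phi) psi)).
  by apply: (finlin_regular (finlin_coO psi k K)); exact: regform_coO.
apply: (@linv_family _ (fun=> True) H _ _ _ u I phi) => {u phi} [u _|u _|u xi _].
- exact: regular_sub.
- by rewrite /H mulN1 coO_e subrr.
- rewrite (_ : linv xi (H u) = H (lie (val xi) u)); first exact: lspan_family.
  rewrite (linvB _ (r1 _) (r2 _)) (linv_transl xi (fun phi => form_coef k K (coO u phi))).
  rewrite linv_coO; apply/funext => phi; congr (_ - _).
  rewrite (finlin_flin (flin_linv xi phi) (finlin_coO psi k K)); last exact: regform_coO.
  by rewrite lform_linv_coO.
Qed.

(** The coaction through the antipode, as it enters the coboundary and the product. *)
Definition coOV u : N -> forms := fun phi => coO u (invN phi).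

Lemma regform_coOV u : regform (coOV u).
Proof. by move=> k K; exact: (regular_invN (regform_coO u k K)). Qed.

Lemma coOV_e u : coOV u e = u.
Proof. by rewrite /coOV inv1N coO_e. Qed.

Lemma coOV_mulN u psi phi : coOV u (mulN psi phi) = coOV (coOV u psi) phi.
Proof. by rewrite /coOV invMN coO_mulN. Qed.

Lemma linv_coOV xi u L phi : finlin L ->
  linv xi (fun phi => L (coOV u phi)) phi = - L (lie (val xi) (coOV u phi)).
Proof.
move=> Ll.
have r1 v : regular (fun phi => L (coO v phi)).
  by apply: finlin_regular => //; exact: regform_coO.
have -> : linv xi (fun phi => L (coOV u phi)) phi =
   pr (gen xi) (fun q => L (coO (coOV u phi) (invN q))).
  by congr (pr _ _); apply/funext => q; rewrite -[coO _ (invN q)]coOV_mulN.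
rewrite -uea_word1 -(pairing_S pr_hopf [:: xi] (r1 _)) /= scaleN1r prN //.
rewrite uea_word1 -linv_e; congr (- _).
rewrite (finlin_flin (flin_linv xi e) Ll); last exact: regform_coO.
by rewrite lform_linv_coO coO_e.
Qed.

(** Think of coOV u phi as the form u transported by a varying diffeomorphism.
    For w in n, moving the diffeomorphism along w cancels the Lie derivative. For w
    in s there remains the Lie derivative of u along the transported field
    w_<0> w_<1>(phi). The family is indexed by w and by the functional L, as left
    invariant derivations change both. *)
Lemma coOV_wactF (w : vfield) u L phi : finlin L ->
  L (lie w (coOV u phi)) + wactF w (fun phi => L (coOV u phi)) phi =
  \sum_b coS (sproj w) phi b * L (coOV (lie (sbasis R b) u) phi).
Proof.
move=> Ll; apply: subr0_eq.
pose P (t : vfield * (forms -> C)) := finlin t.2.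
pose H (t : vfield * (forms -> C)) := fun phi => t.2 (lie t.1 (coOV u phi)) +
  wactF t.1 (fun phi => t.2 (coOV u phi)) phi -
  \sum_b cs (sproj t.1) b phi * t.2 (coOV (lie (sbasis R b) u) phi).
have fl (v : vfield) L' : finlin L' -> finlin (fun u => L' (lie v u)).
  by move=> Ll'; apply: (finlin_comp (Th := lie v)) => // k K; exact: finlin_lie.
have r0 L' v : finlin L' -> regular (fun phi => L' (coOV v phi)).
  by move=> Ll'; apply: finlin_regular => //; exact: regform_coOV.
have r1 L' v : finlin L' -> regular (fun phi => L' (lie v (coOV u phi))).
  by move=> Ll'; apply: (r0 (fun u => L' (lie v u))); exact: fl.
have r2 L' v : finlin L' -> regular (wactF v (fun phi => L' (coOV u phi))).
  by move=> Ll'; apply: regular_wactF; exact: r0.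
have r3 L' X b : finlin L' -> regular (fun phi => cs X b phi * L' (coOV (lie (sbasis R b) u) phi)).
  by move=> Ll'; apply: regular_mul; [exact: regular_cs|exact: r0].
have r3s L' X : finlin L' -> regular (fun phi =>
    \sum_b cs X b phi * L' (coOV (lie (sbasis R b) u) phi)).
  by move=> Ll'; apply: regular_sum => b _; exact: r3.
apply: (@linv_family _ P H _ _ _ (w, L) Ll phi)
    => {w L Ll phi} [[w L] /= Ll|[w L] Ll|[w L] xi Ll]; rewrite /P /= in Ll.
- exact: regular_sub (regular_add (r1 _ _ Ll) (r2 _ _ Ll)) (r3s _ _ Ll).
- rewrite /H /= wactF_e; last exact: r0.
  rewrite -linv_e linv_coOV // !coOV_e.
  under eq_bigr do rewrite /cs coS_e coOV_e.
  have -> : \sum_b sproj w b * L (lie (sbasis R b) u) = L (lie (svec (sproj w)) u).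
    rewrite -finlin_sumE //; congr (L _); rewrite /svec.
    have lieD v v' : lie (v + v') u = lie v u + lie v' u.
      by rewrite -(scale1r v) lie_linl !scale1r.
    have lie0' : lie 0 u = 0.
      by have := lie_linl (-1) 0 0 u; rewrite scaler0 addr0 scaleN1r addNr.
    rewrite (big_morph (fun v => lie v u) lieD lie0'); apply: eq_bigr => b _.
    by rewrite -[_ *: sbasis R b]addr0 lie_linl lie0' addr0.
  rewrite {1}(sn_decomp w) -(scale1r (svec _)) lie_linl scale1r finlin_addE //.
  by rewrite scale1r; ring.
- rewrite (_ : linv xi (H (w, L)) = fun phi => -1 * H (w, fun u => L (lie (val xi) u)) phi +
      H (vbr (val xi) w, L) phi).
    apply: lspan_add.
      apply: lspan_scale.
      by apply: (@lspan_family _ P H (w, fun u => L (lie (val xi) u))); exact: fl.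
    exact: (@lspan_family _ P H (vbr (val xi) w, L)).
  rewrite (linvB _ (regular_add (r1 _ _ Ll) (r2 _ _ Ll)) (r3s _ _ Ll)).
  rewrite (linvD _ (r1 _ _ Ll) (r2 _ _ Ll)) (linv_wactF _ _ (r0 _ _ Ll)).
  rewrite linv_sum; last by move=> b; exact: r3.
  apply/funext => phi; rewrite /H /=.
  rewrite (linv_coOV xi u phi (fl w L Ll)).
  have -> : linv xi (fun phi => L (coOV u phi)) =
      fun phi => -1 * L (lie (val xi) (coOV u phi)).
    by apply/funext => q; rewrite linv_coOV // mulN1r.
  rewrite (flinZ (flin_wactF w phi)); last exact: r1.
  rewrite (_ : \sum_b _ =
     \sum_b cs (sproj (vbr (val xi) w)) b phi * L (coOV (lie (sbasis R b) u) phi) -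
     \sum_b cs (sproj w) b phi * L (lie (val xi) (coOV (lie (sbasis R b) u) phi))).
    rewrite lie_br finlinB //; ring.
  rewrite -sumrB; apply: eq_bigr => b _ /=.
  rewrite linvM; [|exact: regular_cs|exact: r0].
  by rewrite linv_csW linv_coOV // mulrN.
Qed.

Lemma coOV_actF X u L phi : finlin L ->
  L (lie (svec X) (coOV u phi)) + actF X (fun phi => L (coOV u phi)) phi =
  \sum_b coS X phi b * L (coOV (lie (sbasis R b) u) phi).
Proof.
move=> Ll; rewrite -wactF_svec; last first.
  by apply: finlin_regular => //; exact: regform_coOV.
by rewrite coOV_wactF // svecK.
Qed.

End Duality.

(** * The exterior algebra *)

Section ExteriorAlgebra.
Variables (R : realType) (n : nat).
Local Notation C := R[i].
Local Notation I := (sidx n).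
Local Notation extC := (extC R n).
Local Notation upsilon := (@upsilon R n).

Lemma ext_addE (M : lmodType C) (x y : ext n M) A : (x + y) A = x A + y A.
Proof. by []. Qed.

Lemma ext_scaleE (M : lmodType C) c (x : ext n M) A : (c *: x) A = c *: x A.
Proof. by []. Qed.
Lemma ext_sumE (M : lmodType C) (T : Type) (r : seq T) (P : pred T) (F : T -> ext n M) A :
  (\sum_(i <- r | P i) F i) A = \sum_(i <- r | P i) F i A.
Proof.
elim: r => [|i r IH]; first by rewrite !big_nil.
by rewrite !big_cons; case: (P i); rewrite // ext_addE IH.
Qed.

Definition rank_lt (a b : I) : bool := (enum_rank a < enum_rank b)%N.

Lemma inversionsE (A B : {set I}) :
  inversions A B = (\sum_(a in A) \sum_(b in B) rank_lt b a)%N.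
Proof.
rewrite /inversions -sum1_card pair_big_dep /= [RHS]big_mkcond /= [LHS]big_mkcond /=.
apply: eq_bigr => -[a b] _; rewrite !inE /rank_lt /=.
by case: (a \in A); case: (b \in B) => //=; case: (_ < _)%N.
Qed.

Lemma inversionsUl (A A' B : {set I}) : [disjoint A & A'] ->
  inversions (A :|: A') B = (inversions A B + inversions A' B)%N.
Proof.
by move=> dAA; rewrite !inversionsE -bigU //=; apply: eq_bigl => a; rewrite !inE.
Qed.

Lemma inversionsUr (A B B' : {set I}) : [disjoint B & B'] ->
  inversions A (B :|: B') = (inversions A B + inversions A B')%N.
Proof.
move=> dBB; rewrite !inversionsE -big_split; apply: eq_bigr => a _ /=.
by rewrite -bigU //=; apply: eq_bigl => b; rewrite !inE.
Qed.

Lemma rank_lt_total a b : a != b -> (rank_lt b a + rank_lt a b = 1)%N.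
Proof.
rewrite /rank_lt => ab; have : enum_rank a != enum_rank b :> nat.
  by apply: contra ab => /eqP/val_inj/enum_rank_inj ->.
by rewrite neq_ltn; case: ltngtP.
Qed.

(** Each pair of elements of A x B is an inversion in exactly one of both orders. *)
Lemma inversionsC (A B : {set I}) : [disjoint A & B] ->
  (inversions A B + inversions B A = #|A| * #|B|)%N.
Proof.
move=> dAB; rewrite !inversionsE [X in (_ + X)%N]exchange_big -big_split /=.
rewrite -sum_nat_const; apply: eq_bigr => a aA; rewrite -big_split /=.
rewrite -sum1_card; apply: eq_bigr => b bB; apply: rank_lt_total.
by apply: contraTneq bB => <-; have /disjointFr -> := dAB.
Qed.

(** Summing over all pairs of disjoint sets makes the associativity and the
    commutativity of the wedge product a reordering of sums. *)
Lemma wedgeE (M1 M2 M3 : lmodType C) (mu : M1 -> M2 -> M3) (x : ext n M1) (y : ext n M2) A :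
  wedge mu x y A = \sum_(B : {set I}) \sum_(D : {set I})
    (if [disjoint B & D] && (B :|: D == A)
     then (-1) ^+ inversions B D *: mu (x B) (y D) else 0).
Proof.
rewrite /wedge big_mkcond /=; apply: eq_bigr => B _; case: ifPn => [BA|BA].
  rewrite (bigD1 (A :\: B)) //= big1 ?addr0 => [|D /negPf DAB]; last first.
    case: ifP => // /andP[dBD /eqP BDA]; move: DAB; rewrite -BDA.
    rewrite finset.setDUl finset.setDv finset.set0U.
    by move: dBD; rewrite disjoint_sym => /finset.setDidPl ->; rewrite eqxx.
  have -> : [disjoint B & A :\: B].
    by apply/pred0P => a; rewrite !inE; case: (a \in B).
  have -> : B :|: (A :\: B) = A by rewrite -{1}(finset.setIidPr BA) finset.setID.
  by rewrite eqxx.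
rewrite big1 // => D _; case: ifP => // /andP[_ /eqP BDA].
by case/negP: BA; rewrite -BDA finset.subsetUl.
Qed.

Definition bilin (M1 M2 M3 : lmodType C) (mu : M1 -> M2 -> M3) :=
  (forall k u u' v, mu (k *: u + u') v = k *: mu u v + mu u' v) /\
  (forall k u v v', mu u (k *: v + v') = k *: mu u v + mu u v').

Lemma bilin0l (M1 M2 M3 : lmodType C) (mu : M1 -> M2 -> M3) v : bilin mu -> mu 0 v = 0.
Proof. by case=> h _; have := h (-1) 0 0 v; rewrite scaler0 addr0 scaleN1r addNr. Qed.
Lemma bilin0r (M1 M2 M3 : lmodType C) (mu : M1 -> M2 -> M3) u : bilin mu -> mu u 0 = 0.
Proof. by case=> _ h; have := h (-1) u 0 0; rewrite scaler0 addr0 scaleN1r addNr. Qed.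
Lemma bilinZl (M1 M2 M3 : lmodType C) (mu : M1 -> M2 -> M3) k u v :
  bilin mu -> mu (k *: u) v = k *: mu u v.
Proof. by move=> h; rewrite -[k *: u]addr0 h.1 bilin0l // addr0. Qed.
Lemma bilinZr (M1 M2 M3 : lmodType C) (mu : M1 -> M2 -> M3) k u v :
  bilin mu -> mu u (k *: v) = k *: mu u v.
Proof. by move=> h; rewrite -[k *: v]addr0 h.2 bilin0r // addr0. Qed.
Lemma bilinDl (M1 M2 M3 : lmodType C) (mu : M1 -> M2 -> M3) u u' v :
  bilin mu -> mu (u + u') v = mu u v + mu u' v.
Proof. by move=> h; rewrite -(scale1r u) h.1 !scale1r. Qed.
Lemma bilinDr (M1 M2 M3 : lmodType C) (mu : M1 -> M2 -> M3) u v v' :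
  bilin mu -> mu u (v + v') = mu u v + mu u v'.
Proof. by move=> h; rewrite -(scale1r v) h.2 !scale1r. Qed.
Lemma bilinBl (M1 M2 M3 : lmodType C) (mu : M1 -> M2 -> M3) u u' v :
  bilin mu -> mu (u - u') v = mu u v - mu u' v.
Proof. by move=> h; rewrite -scaleN1r addrC h.1 scaleN1r addrC. Qed.
Lemma bilinBr (M1 M2 M3 : lmodType C) (mu : M1 -> M2 -> M3) u v v' :
  bilin mu -> mu u (v - v') = mu u v - mu u v'.
Proof. by move=> h; rewrite -scaleN1r addrC h.2 scaleN1r addrC. Qed.
Lemma bilin_suml (M1 M2 M3 : lmodType C) (mu : M1 -> M2 -> M3) (T : Type) (r : seq T)
    (P : pred T) (F : T -> M1) v : bilin mu ->
  mu (\sum_(i <- r | P i) F i) v = \sum_(i <- r | P i) mu (F i) v.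
Proof.
move=> h; apply: (big_morph (mu^~ v)) => [u u'|]; first exact: bilinDl.
exact: bilin0l.
Qed.
Lemma bilin_sumr (M1 M2 M3 : lmodType C) (mu : M1 -> M2 -> M3) (T : Type) (r : seq T)
    (P : pred T) (F : T -> M2) u : bilin mu ->
  mu u (\sum_(i <- r | P i) F i) = \sum_(i <- r | P i) mu u (F i).
Proof.
move=> h; apply: (big_morph (mu u)) => [v v'|]; first exact: bilinDr.
exact: bilin0r.
Qed.

Lemma bilin_wedge (M1 M2 M3 : lmodType C) (mu : M1 -> M2 -> M3) :
  bilin mu -> bilin (wedge (n := n) mu).
Proof.
move=> h; split=> k u v w; apply/funext => A; rewrite ext_addE ext_scaleE /wedge
  scaler_sumr -big_split; apply: eq_bigr => B _ /=.
  by rewrite ext_addE ext_scaleE h.1 scalerDr !scalerA mulrC.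
by rewrite ext_addE ext_scaleE h.2 scalerDr !scalerA mulrC.
Qed.

Lemma bilin_scale (M : lmodType C) : bilin (fun (c : C^o) (m : M) => c *: m).
Proof.
split=> [k u u' v|k u v v']; first by rewrite scalerDl -scalerA.
by rewrite scalerDr !scalerA mulrC.
Qed.

Lemma bilin_wedgeC (M : lmodType C) : bilin (@wedgeC R n M).
Proof. by apply: bilin_wedge; exact: bilin_scale. Qed.

Lemma if_scale (M : lmodType C) (b : bool) (k : C) (m : M) :
  k *: (if b then m else 0) = if b then k *: m else 0.
Proof. by case: b; rewrite ?scaler0. Qed.

(** The inversions of B, D, E arranged in this order do not depend on the
    bracketing. *)
Lemma wedgeA (M1 M2 M3 M12 M23 M : lmodType C)
    (mu12 : M1 -> M2 -> M12) (mu12_3 : M12 -> M3 -> M)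
    (mu23 : M2 -> M3 -> M23) (mu1_23 : M1 -> M23 -> M)
    (x : ext n M1) (y : ext n M2) (z : ext n M3) :
  bilin mu12_3 -> bilin mu1_23 ->
  (forall a b c, mu12_3 (mu12 a b) c = mu1_23 a (mu23 b c)) ->
  wedge mu12_3 (wedge mu12 x y) z = wedge mu1_23 x (wedge mu23 y z).
Proof.
move=> h1 h2 mA; apply/funext => A; rewrite !wedgeE.
transitivity (\sum_(B : {set I}) \sum_(D : {set I}) \sum_(E : {set I})
  (if [&& [disjoint B & D], [disjoint B :|: D & E] & B :|: D :|: E == A] then
    ((-1) ^+ inversions B D * (-1) ^+ inversions (B :|: D) E) *:
      mu1_23 (x B) (mu23 (y D) (z E)) else 0)).
  rewrite exchange_big /= [RHS](eq_bigr _ (fun B _ => exchange_big _ _ _ _ _ _)).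
  rewrite [RHS]exchange_big /=; apply: eq_bigr => E _.
  under eq_bigr do rewrite wedgeE.
  transitivity (\sum_(P : {set I}) \sum_(B : {set I}) \sum_(D : {set I})
    (if [disjoint B & D] && (B :|: D == P) then
      (if [disjoint P & E] && (P :|: E == A) then
      ((-1) ^+ inversions B D * (-1) ^+ inversions P E) *:
      mu1_23 (x B) (mu23 (y D) (z E)) else 0) else 0)).
    apply: eq_bigr => P _; case: ifP => _; last first.
      by rewrite big1 // => B _; rewrite big1 // => D _; rewrite if_same.
    rewrite (bilin_suml _ _ _ _ h1) scaler_sumr; apply: eq_bigr => B _.
    rewrite (bilin_suml _ _ _ _ h1) scaler_sumr; apply: eq_bigr => D _.
    case: ifP => _; last by rewrite bilin0l // scaler0.
    by rewrite (bilinZl _ _ _ h1) scalerA mA mulrC.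
  rewrite exchange_big /=; apply: eq_bigr => B _; rewrite exchange_big /=.
  apply: eq_bigr => D _; rewrite (bigD1 (B :|: D)) //= eqxx andbT.
  rewrite big1 ?addr0 => [|P /negPf]; last by rewrite eq_sym => ->; rewrite andbF.
  by case: ifP.
apply: eq_bigr => B _; transitivity (\sum_(D : {set I}) \sum_(E : {set I})
  \sum_(P : {set I}) (if [disjoint D & E] && (D :|: E == P) then
      (if [disjoint B & P] && (B :|: P == A) then
      ((-1) ^+ inversions B P * (-1) ^+ inversions D E) *:
      mu1_23 (x B) (mu23 (y D) (z E)) else 0) else 0)).
  apply: eq_bigr => D _; apply: eq_bigr => E _.
  rewrite (bigD1 (D :|: E)) //= eqxx andbT.
  rewrite big1 ?addr0 => [|P /negPf]; last by rewrite eq_sym => ->; rewrite andbF.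
  rewrite -finset.setUA; have dU1 : [disjoint B :|: D & E] = [disjoint B & E] && [disjoint D & E].
    by rewrite -!finset.setI_eq0 finset.setIUl finset.setU_eq0.
  have dU2 : [disjoint B & D :|: E] = [disjoint B & D] && [disjoint B & E].
    by rewrite -!finset.setI_eq0 finset.setIUr finset.setU_eq0.
  rewrite dU1 dU2; case: (boolP [disjoint D & E]) => dDE; last by rewrite !andbF.
  case: (boolP [disjoint B & D]) => dBD //=.
  case: (boolP [disjoint B & E]) => dBE //=.
  case: ifP => // _; rewrite inversionsUl // inversionsUr // !exprD.
  by congr (_ *: _); rewrite mulrA.
rewrite exchange_big /= [in LHS](eq_bigr _ (fun B _ => exchange_big _ _ _ _ _ _)).
rewrite exchange_big /=; apply: eq_bigr => P _.
rewrite wedgeE; case: ifP => _; last first.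
  by rewrite big1 // => E _; rewrite big1 // => D _; rewrite if_same.
rewrite exchange_big /= (bilin_sumr _ _ _ _ h2) scaler_sumr; apply: eq_bigr => D _.
rewrite (bilin_sumr _ _ _ _ h2) scaler_sumr; apply: eq_bigr => E _.
case: ifP => _; last by rewrite bilin0r // scaler0.
by rewrite (bilinZr _ _ _ h2) scalerA.
Qed.

Lemma wedge_comm (M1 M2 M3 : lmodType C) (mu : M1 -> M2 -> M3) p q
    (x : ext n M1) (y : ext n M2) : bilin mu -> extdeg p x -> extdeg q y ->
  wedge mu x y = (-1) ^+ (p * q) *: wedge (fun b a => mu a b) y x.
Proof.
move=> h xp yq; apply/funext => A; rewrite ext_scaleE !wedgeE exchange_big scaler_sumr.
apply: eq_bigr => D _; rewrite scaler_sumr; apply: eq_bigr => B _.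
rewrite disjoint_sym finset.setUC if_scale; case: ifP => // /andP[dDB _].
have [Bp|/xp ->] := eqVneq #|B| p; last by rewrite bilin0l // !scaler0.
have [Dq|/yq ->] := eqVneq #|D| q; last by rewrite bilin0r // !scaler0.
rewrite scalerA; congr (_ *: _); rewrite -Bp -Dq -inversionsC 1?disjoint_sym //.
by rewrite exprD -mulrA -expr2 sqrr_sign mulr1.
Qed.

Lemma extdeg_wedge (M1 M2 M3 : lmodType C) (mu : M1 -> M2 -> M3) p q
    (x : ext n M1) (y : ext n M2) : bilin mu -> extdeg p x -> extdeg q y ->
  extdeg (p + q) (wedge mu x y).
Proof.
move=> h xp yq A Apq; rewrite wedgeE big1 // => B _; rewrite big1 // => D _.
case: ifP => // /andP[dBD /eqP BDA].
have [Bp|/xp ->] := eqVneq #|B| p; last by rewrite bilin0l // scaler0.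
have [Dq|/yq ->] := eqVneq #|D| q; last by rewrite bilin0r // scaler0.
by move: Apq; rewrite -BDA cardsU (disjoint_setI0 dBD) cards0 subn0 Bp Dq eqxx.
Qed.

End ExteriorAlgebra.

Section ExteriorMaps.
Variables (R : realType) (n : nat).
Local Notation C := R[i].
Local Notation I := (sidx n).
Local Notation extC := (extC R n).
Local Notation upsilon := (@upsilon R n).
Local Notation rank_lt := (@rank_lt n).

Lemma extC_addE (x y : extC) A : (x + y) A = x A + y A. Proof. by []. Qed.
Lemma extC_oppE (x : extC) A : (- x) A = - x A. Proof. by []. Qed.
Lemma extC_scaleE c (x : extC) A : (c *: x) A = c * x A. Proof. by []. Qed.
Lemma extC_sumE (T : Type) (r : seq T) (P : pred T) (F : T -> extC) A :
  (\sum_(i <- r | P i) F i) A = \sum_(i <- r | P i) F i A.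
Proof. exact: ext_sumE. Qed.

(** The element m (x) x, the shape to which all identities are reduced by
    linearity. *)
Definition tens (M : lmodType C) (x : extC) (m : M) : ext n M := fun A => x A *: m.

(** The monomials upsilon^A. *)
Definition umono (A : {set I}) : extC := fun B => (B == A)%:R.

Lemma bilin_tens (M : lmodType C) : bilin (fun (x : extC) (m : M) => tens x m).
Proof.
split=> [k x x' m|k x m m']; apply/funext => A.
  transitivity (k *: (x A *: m) + x' A *: m) => //.
  by rewrite scalerA -scalerDl.
transitivity (k *: (x A *: m) + x A *: m') => //.
by rewrite scalerA (mulrC k) -scalerA -scalerDr.
Qed.

Lemma ext_decomp (M : lmodType C) (x : ext n M) : x = \sum_B tens (umono B) (x B).
Proof.
apply/funext => A; rewrite ext_sumE (bigD1 A) //= /tens /umono eqxx scale1r.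
by rewrite big1 ?addr0 // => B /negPf BA; rewrite eq_sym BA scale0r.
Qed.

Lemma extC_decomp (x : extC) : x = \sum_B x B *: umono B.
Proof.
apply/funext => A; rewrite extC_sumE (bigD1 A) //= extC_scaleE /umono eqxx mulr1.
by rewrite big1 ?addr0 // => B /negPf BA; rewrite extC_scaleE eq_sym BA mulr0.
Qed.

Lemma wedge_tens (M1 M2 M3 : lmodType C) (mu : M1 -> M2 -> M3) x y m m' : bilin mu ->
  wedge mu (tens x m) (tens y m') = tens (wedgeC x y) (mu m m').
Proof.
move=> h; apply/funext => A; rewrite /tens /wedgeC /wedge scaler_suml.
apply: eq_bigr => B _; rewrite (bilinZl _ _ _ h) (bilinZr _ _ _ h) !scalerA.
by rewrite /GRing.scale /= mulrA.
Qed.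

Lemma wedgeC_tens (M : lmodType C) x y (m : M) :
  wedgeC x (tens y m) = tens (wedgeC x y) m.
Proof.
apply/funext => A; rewrite /tens /wedgeC /wedge scaler_suml.
by apply: eq_bigr => B _; rewrite !scalerA.
Qed.

Lemma wedge_decomp (M1 M2 M3 : lmodType C) (mu : M1 -> M2 -> M3) x y : bilin mu ->
  wedge mu x y = \sum_B \sum_D tens (wedgeC (umono B) (umono D)) (mu (x B) (y D)).
Proof.
move=> h; have hw := bilin_wedge n h.
rewrite {1}(ext_decomp x) {1}(ext_decomp y) (bilin_suml _ _ _ _ hw).
apply: eq_bigr => B _; rewrite (bilin_sumr _ _ _ _ hw); apply: eq_bigr => D _.
exact: wedge_tens.
Qed.

Lemma umono_deg (A : {set I}) : extdeg #|A| (umono A).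
Proof. by move=> B BA; rewrite /umono; case: eqP => // AB; rewrite AB eqxx in BA. Qed.

Lemma upsilon_umono b : upsilon b = umono [set b]%SET. Proof. by []. Qed.

Lemma upsilon_deg b : extdeg 1 (upsilon b).
Proof. by rewrite -(cards1 b); exact: umono_deg. Qed.

Lemma wedge_umono (B D : {set I}) : wedgeC (umono B) (umono D) =
  if [disjoint B & D] then (-1) ^+ inversions B D *: umono (B :|: D) else 0.
Proof.
apply/funext => A; rewrite [LHS]wedgeE (bigD1 B) //= [X in _ + X]big1 => [|B' /negPf B'B].
  rewrite addr0 (bigD1 D) //= [X in _ + X]big1 => [|D' /negPf D'D].
    rewrite addr0 /umono !eqxx; case: (boolP [disjoint B & D]) => dBD //=.
    rewrite extC_scaleE eq_sym; case: eqP => _; rewrite ?mulr0 // mulr1.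
    by rewrite /GRing.scale /= !mulr1.
  by case: ifP => // _; rewrite /umono D'D /GRing.scale /= mulr0 mulr0.
by rewrite big1 // => D' _; case: ifP => // _; rewrite {1}/umono B'B scale0r scaler0.
Qed.

Lemma wedgeCA (M : lmodType C) (x y : extC) (z : ext n M) :
  wedgeC (wedgeC x y) z = wedgeC x (wedgeC y z).
Proof.
apply: wedgeA; [exact: bilin_scale|exact: bilin_scale|move=> a b c].
by rewrite scalerA.
Qed.

Lemma wedgeC_comm p q (x y : extC) : extdeg p x -> extdeg q y ->
  wedgeC x y = (-1) ^+ (p * q) *: wedgeC y x.
Proof.
move=> xp yq; rewrite /wedgeC (wedge_comm (bilin_scale _) xp yq); congr (_ *: _).
by congr (wedge _ _ _); apply/funext => a; apply/funext => b; rewrite /GRing.scale /= mulrC.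
Qed.

Lemma wedgeC1x (M : lmodType C) (z : ext n M) : wedgeC (@ext1 R n) z = z.
Proof.
apply/funext => A; rewrite /wedgeC /wedge (bigD1 finset.set0) ?finset.sub0set //=.
rewrite big1 => [|B /andP[_ /negPf B0]]; last by rewrite /ext1 B0 scale0r scaler0.
rewrite /ext1 eqxx scale1r finset.setD0 addr0 inversionsE big1 ?scale1r // => a.
by rewrite inE.
Qed.

Lemma wedgeCx1 (x : extC) : wedgeC x (@ext1 R n) = x.
Proof.
apply/funext => A; rewrite /wedgeC /wedge (bigD1 A) ?fintype.subxx //=.
rewrite big1 => [|B /andP[BA BA']]; last first.
  rewrite /ext1; case: eqP => [AB|_]; last by rewrite /GRing.scale /= !mulr0.
  case/negP: BA'; rewrite finset.eqEsubset BA /=.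
  by apply/fintype.subsetP => b bA; apply: contraT => bB; move/setP/(_ b): AB; rewrite !inE bA bB.
rewrite addr0 finset.setDv /ext1 eqxx inversionsE big1 => [|a _].
  by rewrite /GRing.scale /= mulr1 mul1r.
by rewrite big1 // => b; rewrite inE.
Qed.

End ExteriorMaps.

(** * Algebra maps and derivations of the exterior algebra *)

Lemma mul_anti (S : comPzRingType) (a b c d z : S) :
  a * b = -1 -> a * c * (b * d * z) = - (d * (c * z)).
Proof.
by move=> ab; transitivity (a * b * (d * (c * z))); [ring|rewrite ab mulN1r].
Qed.

Section AlgebraMaps.
Variables (R : realType) (n : nat).
Local Notation C := R[i].
Local Notation I := (sidx n).
Local Notation extC := (extC R n).
Local Notation upsilon := (@upsilon R n).
Local Notation rlt := (@rank_lt n).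
Local Notation eb := (@umono R n).

Lemma rlt_trans : transitive rlt.
Proof. by move=> b a c; exact: ltn_trans. Qed.

Lemma rlt_irr : irreflexive rlt.
Proof. by move=> a; exact: ltnn. Qed.

Lemma enum_rlt_sorted (A : {set I}) : sorted rlt (enum A).
Proof.
rewrite {1}/enum_mem; apply: sorted_filter; first exact: rlt_trans.
rewrite -enumT; case E: (enum I) => [//|x0 s]; rewrite -E; apply/(sortedP x0) => i isz.
have r j (jl : (j < #|I|)%N) : enum_rank (nth x0 (enum I) j) = Ordinal jl.
  by rewrite -[RHS]enum_valK (enum_val_nth x0).
rewrite /rank_lt -cardE in isz *.
by rewrite (r _ isz) (r _ (ltnW isz)) /=.
Qed.

(** A new index b is moved to its place in the increasing enumeration past as many
    factors as there are inversions; this is the sign in the wedge product with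
    upsilon b. *)
Lemma enum_insert b (A : {set I}) : b \notin A -> exists s1 s2,
  [/\ enum A = s1 ++ s2, enum (b |: A) = s1 ++ b :: s2 &
      size s1 = inversions [set b]%SET A].
Proof.
move=> bA; pose s1 := [seq a <- enum A | rlt a b]; pose s2 := [seq a <- enum A | rlt b a].
have tot a : a \in A -> ~~ rlt a b -> rlt b a.
  move=> aA /negPf ab; have := @rank_lt_total n a b; rewrite ab addn0.
  have -> : a != b by apply: contraNneq bA => <-.
  by case: (rlt b a) => // /(_ isT).
have so : sorted rlt (s1 ++ b :: s2).
  rewrite (sorted_pairwise rlt_trans) pairwise_cat /= -!(sorted_pairwise rlt_trans).
  have s2b : all (rlt b) s2 by exact: filter_all.
  have st p : sorted rlt [seq a <- enum A | p a].
    by apply: (sorted_filter rlt_trans); exact: enum_rlt_sorted.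
  rewrite s2b !st.
  rewrite !andbT; apply/allP => a; rewrite mem_filter => /andP[ab _] /=; rewrite ab /=.
  by apply/allP => c; rewrite mem_filter => /andP[bc _]; exact: rlt_trans bc.
have eqs s t : sorted rlt s -> sorted rlt t -> s =i t -> s = t.
  exact: (irr_sorted_eq rlt_trans rlt_irr).
have so' : sorted rlt (s1 ++ s2).
  apply: subseq_sorted so; first exact: rlt_trans.
  by apply: cat_subseq => //; exact: subseq_cons.
have m1 a : (a \in s1) = rlt a b && (a \in A) by rewrite mem_filter mem_enum.
have m2 a : (a \in s2) = rlt b a && (a \in A) by rewrite mem_filter mem_enum.
exists s1, s2; split.
- apply: eqs => //; first exact: enum_rlt_sorted.
  move=> a; rewrite mem_enum mem_cat m1 m2 -andb_orl.
  case: (boolP (a \in A)) => aA; rewrite ?andbF // andbT.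
  by case: (boolP (rlt a b)) => //= /(tot _ aA).
- apply: eqs => //; first exact: enum_rlt_sorted.
  move=> a; rewrite mem_enum !inE mem_cat inE m1 m2.
  case: (eqVneq a b) => [->|ab]; first by rewrite orbT.
  rewrite /= -andb_orl; case: (boolP (a \in A)) => aA; rewrite ?andbF // andbT.
  by case: (boolP (rlt a b)) => //= /(tot _ aA).
- rewrite size_filter inversionsE big_set1 -sum1_count big_enum_cond /=.
  by rewrite big_mkcondr.
Qed.

Section Extmul.
Variable phi : I -> extC.
Hypothesis phi1 : forall b, extdeg 1 (phi b).

Lemma wedgeC_swap (M : lmodType C) a b (z : ext n M) :
  wedgeC (phi a) (wedgeC (phi b) z) = - wedgeC (phi b) (wedgeC (phi a) z).
Proof.
rewrite -!wedgeCA (wedgeC_comm (phi1 a) (phi1 b)) (bilinZl _ _ _ (bilin_wedgeC _ _)).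
by rewrite muln1 expr1 scaleN1r.
Qed.

Lemma wedgeC_sqr0 (M : lmodType C) a (z : ext n M) : wedgeC (phi a) (wedgeC (phi a) z) = 0.
Proof.
have /eqP := wedgeC_swap a a z; rewrite -addr_eq0 -mulr2n -scaler_nat scaler_eq0.
by rewrite pnatr_eq0 => /eqP.
Qed.

(** Factors of degree 1 anticommute. *)
Lemma extmul_move s1 b s2 : wedgeC (phi b) (extmul phi (s1 ++ s2)) =
  (-1) ^+ size s1 *: extmul phi (s1 ++ b :: s2).
Proof.
elim: s1 => [|a s1 IH] /=; first by rewrite expr0 scale1r.
rewrite wedgeC_swap IH (bilinZr _ _ _ (bilin_wedgeC _ _)).
by rewrite exprS mulN1r scaleNr.
Qed.

Lemma extmul_dup b s : b \in s -> wedgeC (phi b) (extmul phi s) = 0.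
Proof.
elim: s => [//|a s IH] /=; rewrite inE; case: eqVneq => [-> _|_ /= /IH bs].
  exact: wedgeC_sqr0.
by rewrite wedgeC_swap bs (bilin0r _ (bilin_wedgeC _ _)) oppr0.
Qed.

Lemma extdeg_extmul s : extdeg (size s) (extmul phi s).
Proof.
elim: s => [|a s IH] /=; last by rewrite -add1n; apply: extdeg_wedge => //; exact: bilin_scale.
by move=> A; rewrite cards_eq0 /ext1 => /negPf ->.
Qed.

End Extmul.

Lemma inversions_single b (A : {set I}) :
  (forall a, a \in A -> rlt b a) -> inversions [set b]%SET A = 0%N.
Proof.
move=> bA; rewrite inversionsE big_set1 big1 // => a /bA ba.
by case: (boolP (rlt a b)) => // /(rlt_trans ba); rewrite rlt_irr.
Qed.

Lemma extmul_upsilon_sorted s : sorted rlt s -> extmul upsilon s = eb [set x in s]%SET.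
Proof.
elim: s => [_|b s IH] /=.
  apply/funext => A; rewrite /ext1 /umono; congr (nat_of_bool (A == _))%:R.
rewrite (path_sortedE rlt_trans) => /andP[/allP bs ss]; rewrite IH // upsilon_umono wedge_umono.
have bs' : b \notin s by apply/negP => /bs; rewrite rlt_irr.
rewrite disjoints1 inE bs' inversions_single ?expr0 ?scale1r.
  by congr eb; apply/finset.setP => x; rewrite !inE.
by move=> a; rewrite inE => /bs.
Qed.

(** The enumeration of a finite set is increasing for the order that counts the
    inversions, so no sign appears. *)
Lemma umono_extmul (A : {set I}) : eb A = extmul upsilon (enum A).
Proof.
rewrite extmul_upsilon_sorted; last exact: enum_rlt_sorted.
by congr eb; apply/finset.setP => x; rewrite inE mem_enum.
Qed.

Section Extlin.
Variable F : seq I -> extC.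

Lemma extlin_tensE (M : lmodType C) (z : ext n M) :
  extlin F z = \sum_(B : {set I}) tens (F (enum B)) (z B).
Proof. by apply/funext => A; rewrite ext_sumE. Qed.

Lemma extlin_lin (M : lmodType C) k (x y : ext n M) :
  extlin F (k *: x + y) = k *: extlin F x + extlin F y.
Proof.
rewrite !extlin_tensE scaler_sumr -big_split; apply: eq_bigr => B _ /=.
by rewrite ext_addE ext_scaleE (bilin_tens n M).2.
Qed.

Lemma extlin0 (M : lmodType C) : extlin F (0 : ext n M) = 0.
Proof. by have := extlin_lin (-1) (0 : ext n M) 0; rewrite scaler0 addr0 scaleN1r addNr. Qed.

Lemma extlinD (M : lmodType C) (x y : ext n M) : extlin F (x + y) = extlin F x + extlin F y.
Proof. by rewrite -(scale1r x) extlin_lin !scale1r. Qed.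

Lemma extlinZ (M : lmodType C) k (x : ext n M) : extlin F (k *: x) = k *: extlin F x.
Proof. by rewrite -[k *: x]addr0 extlin_lin extlin0 addr0. Qed.

Lemma extlin_sum (M : lmodType C) (T : Type) (r : seq T) (P : pred T) (x : T -> ext n M) :
  extlin F (\sum_(i <- r | P i) x i) = \sum_(i <- r | P i) extlin F (x i).
Proof. by apply: (big_morph (extlin F)) => [x' y'|]; [exact: extlinD|exact: extlin0]. Qed.

Lemma extlin_tens (M : lmodType C) (x : extC) (m : M) :
  extlin F (tens x m) = tens (extlin F x) m.
Proof.
apply/funext => A; rewrite /extlin /tens scaler_suml; apply: eq_bigr => B _.
by rewrite scalerA.
Qed.

Lemma extlin_umono (A : {set I}) : extlin F (eb A) = F (enum A).
Proof.
apply/funext => B; rewrite /extlin (bigD1 A) //= /umono eqxx [X in X + _]mulr1.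
by rewrite big1 ?addr0 // => D /negPf DA; rewrite DA [LHS]mulr0.
Qed.

End Extlin.

Section Morphism.
Variable phi : I -> extC.
Hypothesis phi1 : forall b, extdeg 1 (phi b).
Local Notation h := (extlin (extmul phi)).

(** Either b occurs already, and both sides vanish, or b is inserted at its place,
    with the same sign on both sides. *)
Lemma extmap_upsilon b (z : extC) :
  h (wedgeC (upsilon b) z) = wedgeC (phi b) (h z) :> extC.
Proof.
have bw := bilin_wedgeC (R := R) n C^o.
rewrite (extC_decomp z) (bilin_sumr _ _ _ _ bw) !extlin_sum (bilin_sumr _ _ _ _ bw).
apply: eq_bigr => A _; rewrite (bilinZr _ _ _ bw) !extlinZ (bilinZr _ _ _ bw).
congr (_ *: _); rewrite upsilon_umono wedge_umono disjoints1 extlin_umono.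
case: (boolP (b \in A)) => bA /=; first by rewrite extlin0 extmul_dup // mem_enum.
rewrite extlinZ extlin_umono.
have [s1 [s2 [e1 e2 <-]]] := enum_insert bA.
by rewrite e1 e2 (extmul_move phi1).
Qed.

Lemma extmap_extmul s (z : extC) :
  h (wedgeC (extmul upsilon s) z) = wedgeC (extmul phi s) (h z) :> extC.
Proof.
elim: s => [|b s IH] /=; first by rewrite !wedgeC1x.
by rewrite wedgeCA extmap_upsilon IH wedgeCA.
Qed.

Lemma extmap_extmul1 s : h (extmul upsilon s) = extmul phi s :> extC.
Proof.
rewrite -[in LHS](wedgeCx1 (extmul upsilon s)) extmap_extmul.
rewrite -[RHS]wedgeCx1; congr wedgeC.
have -> : @ext1 R n = eb finset.set0 by [].
by rewrite extlin_umono enum_set0.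
Qed.

Lemma extmapC_wedge (x y : extC) : h (wedgeC x y) = wedgeC (h x) (h y) :> extC.
Proof.
have bw := bilin_wedgeC (R := R) n C^o.
rewrite (extC_decomp x) (bilin_suml _ _ _ _ bw) !extlin_sum (bilin_suml _ _ _ _ bw).
apply: eq_bigr => A _; rewrite (bilinZl _ _ _ bw) !extlinZ (bilinZl _ _ _ bw).
by congr (_ *: _); rewrite umono_extmul extmap_extmul extmap_extmul1.
Qed.

(** A linear map given on monomials by products of degree 1 elements is
    multiplicative. *)
Lemma extmap_wedge (M1 M2 M3 : lmodType C) (mu : M1 -> M2 -> M3) x y : bilin mu ->
  h (wedge mu x y) = wedge mu (h x) (h y).
Proof.
move=> bmu; have bw := bilin_wedge n bmu.
rewrite (wedge_decomp _ _ bmu) extlin_sum (extlin_tensE _ x) (bilin_suml _ _ _ _ bw).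
apply: eq_bigr => B _; rewrite extlin_sum (extlin_tensE _ y) (bilin_sumr _ _ _ _ bw).
apply: eq_bigr => D _; rewrite extlin_tens extmapC_wedge !extlin_umono.
by rewrite wedge_tens.
Qed.

Lemma extdeg_extmap (M : lmodType C) p (z : ext n M) : extdeg p z -> extdeg p (h z).
Proof.
move=> zp A Ap; rewrite /extlin big1 // => B _.
have [Bp|/zp ->] := eqVneq #|B| p; last by rewrite scaler0.
by rewrite (extdeg_extmul phi1) ?scale0r // -cardE Bp.
Qed.

End Morphism.

(** The contraction with the basis vector k. *)
Definition iota (k : I) (z : extC) : extC := fun A =>
  if k \in A then 0 else (-1) ^+ inversions [set k]%SET A * z (k |: A)%SET.

Lemma wedge_upsilonE b (z : extC) A : wedgeC (upsilon b) z A =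
  if b \in A then (-1) ^+ inversions [set b]%SET (A :\ b)%SET * z (A :\ b)%SET else 0.
Proof.
rewrite /wedgeC /wedge; case: ifPn => bA.
  rewrite (bigD1 [set b]%SET) ?finset.sub1set //= big1 ?addr0 => [|B /andP[_ /negPf Bb]].
    by rewrite /Defs.upsilon eqxx scale1r.
  by rewrite /Defs.upsilon Bb scale0r scaler0.
rewrite big1 // => B BA; rewrite /Defs.upsilon; case: eqP => [Bb|_].
  by move: BA; rewrite Bb finset.sub1set (negPf bA).
by rewrite scale0r scaler0.
Qed.

Lemma iota_upsilon k b (z : extC) : iota k (wedgeC (upsilon b) z) =
  (k == b)%:R *: z - wedgeC (upsilon b) (iota k z).
Proof.
apply/funext => A; rewrite extC_addE extC_oppE extC_scaleE wedge_upsilonE /iota wedge_upsilonE.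
have s2 m : (-1) ^+ m * (-1) ^+ m = 1 :> C by rewrite -expr2 sqrr_sign.
case: (eqVneq k b) => [<-|kb].
  rewrite mul1r !inE eqxx /=; case: (boolP (k \in A)) => kA.
    by rewrite finset.setD1K // mulrA s2 mul1r subrr.
  by rewrite finset.setU1K // mulrA s2 mul1r subr0.
rewrite mul0r sub0r !inE (negPf kb) /= eq_sym (negPf kb) /=.
case: (boolP (b \in A)) => bA; last by rewrite mulr0 if_same oppr0.
case: (boolP (k \in A)) => kA; first by rewrite mulr0 oppr0.
have kbA : (k |: A) :\ b = k |: (A :\ b).
  by apply/finset.setP => x; rewrite !inE; case: (eqVneq x b) => // ->; rewrite eq_sym (negPf kb).
have E1 : inversions [set k]%SET A =
    (inversions [set k]%SET [set b]%SET + inversions [set k]%SET (A :\ b))%N.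
  by rewrite -inversionsUr ?finset.setD1K // disjoints1 !inE eqxx.
have E2 : inversions [set b]%SET (k |: (A :\ b)) =
    (inversions [set b]%SET [set k]%SET + inversions [set b]%SET (A :\ b))%N.
  by rewrite inversionsUr // disjoints1 !inE (negPf kA) andbF.
have i1 : (inversions [set k]%SET [set b]%SET + inversions [set b]%SET [set k]%SET = 1)%N.
  by rewrite inversionsC ?cards1 // disjoints1 inE.
have s1 : (-1) ^+ inversions [set k]%SET [set b]%SET *
    (-1) ^+ inversions [set b]%SET [set k]%SET = -1 :> C by rewrite -exprD i1 expr1.
rewrite kbA E1 E2 !exprD; exact: mul_anti.
Qed.

(** The derivation of /\ s^* that extends dDR_gen, written through contractions so
    that linearity and the Leibniz rule can be read off; dDR_dext identifies it
    with dDR, which is defined on increasing monomials. *)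
Definition dext (z : extC) : extC := \sum_k wedgeC (dDR_gen R k) (iota k z).

Lemma dDR_gen_deg (k : I) : extdeg 2 (dDR_gen R k).
Proof.
move=> A A2; rewrite /dDR_gen extC_scaleE !extC_sumE big1 ?mulr0 // => i _.
rewrite extC_sumE big1 // => j _; rewrite extC_scaleE.
rewrite /wedgeC (extdeg_wedge (bilin_scale _) (upsilon_deg R i) (upsilon_deg R j)) //.
by rewrite mulr0.
Qed.

Lemma iota_lin k c (z z' : extC) : iota k (c *: z + z') = c *: iota k z + iota k z'.
Proof.
apply/funext => A; rewrite extC_addE extC_scaleE /iota; case: ifP => _.
  by rewrite mulr0 addr0.
by rewrite extC_addE extC_scaleE mulrDr mulrCA.
Qed.

Lemma dext_lin c (z z' : extC) : dext (c *: z + z') = c *: dext z + dext z'.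
Proof.
rewrite /dext scaler_sumr -big_split; apply: eq_bigr => k _ /=.
by rewrite iota_lin (bilin_wedgeC n C^o).2.
Qed.

Lemma dextZ c (z : extC) : dext (c *: z) = c *: dext z.
Proof.
have d0 : dext 0 = 0.
  by have := dext_lin (-1) 0 0; rewrite scaler0 addr0 scaleN1r addNr.
by rewrite -[c *: z]addr0 dext_lin d0 addr0.
Qed.

Lemma dext_sum (T : Type) (r : seq T) (P : pred T) (z : T -> extC) :
  dext (\sum_(i <- r | P i) z i) = \sum_(i <- r | P i) dext (z i).
Proof.
apply: (big_morph dext) => [x y|].
  by rewrite -(scale1r x) dext_lin !scale1r.
by have := dext_lin (-1) 0 0; rewrite scaler0 addr0 scaleN1r addNr.
Qed.

Lemma dext_upsilon b (z : extC) : dext (wedgeC (upsilon b) z) =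
  wedgeC (dDR_gen R b) z - wedgeC (upsilon b) (dext z).
Proof.
have bw := bilin_wedgeC (R := R) n C^o.
have swap k (x : extC) : wedgeC (dDR_gen R k) (wedgeC (upsilon b) x) =
    wedgeC (upsilon b) (wedgeC (dDR_gen R k) x).
  rewrite -!wedgeCA (wedgeC_comm (dDR_gen_deg k) (upsilon_deg R b)).
  by rewrite muln1 sqrrN expr1n scale1r.
rewrite /dext (bilin_sumr _ _ _ _ bw) (bigD1 b) //= iota_upsilon eqxx scale1r.
rewrite [in RHS](bigD1 b) //= opprD addrA -sumrN; congr (_ + _).
  by rewrite (bilinBr _ _ _ bw) swap.
apply: eq_bigr => k /negPf kb; rewrite iota_upsilon kb scale0r sub0r -scaleN1r.
by rewrite (bilinZr _ _ _ bw) scaleN1r swap.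
Qed.

Lemma dext1 : dext (@ext1 R n) = 0.
Proof.
rewrite /dext big1 // => k _.
have -> : iota k (@ext1 R n) = 0.
  apply/funext => A; rewrite /iota; case: ifPn => // kA; rewrite /ext1.
  case: eqP => [kA0|_]; last by rewrite mulr0.
  by have := setU11 k A; rewrite kA0 inE.
by rewrite (bilin0r _ (bilin_wedgeC n C^o)).
Qed.

Lemma dext_extmul s : dext (extmul upsilon s) = dDR_mono R s.
Proof.
elim: s => [|b s IH] /=; first exact: dext1.
by rewrite dext_upsilon IH.
Qed.

Lemma dDR_dext (z : extC) : dDR (M := C^o) z = dext z.
Proof.
rewrite /dDR [in LHS](extC_decomp z) [in RHS](extC_decomp z) extlin_sum dext_sum.
apply: eq_bigr => A _; rewrite extlinZ dextZ extlin_umono.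
by rewrite umono_extmul dext_extmul.
Qed.

Lemma dDR_tens (M : lmodType C) (x : extC) (m : M) : dDR (tens x m) = tens (dext x) m.
Proof. by rewrite /dDR extlin_tens -dDR_dext. Qed.

Lemma dext_extmul_wedge s (z : extC) : dext (wedgeC (extmul upsilon s) z) =
  wedgeC (dDR_mono R s) z + (-1) ^+ size s *: wedgeC (extmul upsilon s) (dext z).
Proof.
have bw := bilin_wedgeC (R := R) n C^o.
elim: s => [|b s IH] /=.
  by rewrite !wedgeC1x expr0 scale1r (bilin0l _ bw) add0r.
rewrite wedgeCA dext_upsilon IH (bilinDr _ _ _ bw) (bilinZr _ _ _ bw).
have -> : wedgeC (wedgeC (dDR_gen R b) (extmul upsilon s)
      - wedgeC (upsilon b) (dDR_mono R s)) z =
    wedgeC (dDR_gen R b) (wedgeC (extmul upsilon s) z)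
      - wedgeC (upsilon b) (wedgeC (dDR_mono R s) z).
  by rewrite (bilinBl _ _ _ bw) !wedgeCA.
by rewrite opprD addrA exprS mulN1r scaleNr wedgeCA.
Qed.

(** By linearity the left factor may be taken to be a product of basis elements,
    and then dext_extmul_wedge applies. *)
Lemma dDR_wedge (M1 M2 M3 : lmodType C) (mu : M1 -> M2 -> M3) p (x : ext n M1) (y : ext n M2) :
  bilin mu ->
  extdeg p x ->
  dDR (wedge mu x y) = wedge mu (dDR x) y + (-1) ^+ p *: wedge mu x (dDR y).
Proof.
move=> bmu xp; have bw := bilin_wedge n bmu.
rewrite (wedge_decomp _ _ bmu) /dDR extlin_sum [in RHS](extlin_tensE _ x).
rewrite [X in _ = _ + _ *: wedge _ X _](ext_decomp x) !(bilin_suml _ _ _ _ bw).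
rewrite scaler_sumr -big_split; apply: eq_bigr => B _ /=.
have [Bp|/xp x0] := eqVneq #|B| p; last first.
  have t0 (X : extC) : tens X (0 : M1) = 0 by exact: (bilin0r _ (bilin_tens n M1)).
  rewrite x0 !t0 !(bilin0l _ bw) scaler0 addr0 extlin_sum big1 // => D _.
  by rewrite (bilin0l _ bmu) (bilin0r _ (bilin_tens n M3)) extlin0.
rewrite extlin_sum (extlin_tensE _ y) [X in _ = wedge mu _ X + _](ext_decomp y).
rewrite !(bilin_sumr _ _ _ _ bw).
rewrite scaler_sumr -big_split; apply: eq_bigr => D _ /=.
rewrite !(wedge_tens _ _ _ _ bmu) -/(dDR _) dDR_tens (umono_extmul B) dext_extmul_wedge.
rewrite -dDR_dext /dDR extlin_umono -cardE Bp.
by rewrite (bilinDl _ _ _ (bilin_tens n M3)) (bilinZl _ _ _ (bilin_tens n M3)).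
Qed.

End AlgebraMaps.

(** * The identities on N used by the bicomplex *)

Section TwistedData.
Variables (R : realType) (n : nat).
Local Notation N := (diffeo0 R n).
Local Notation C := R[i].
Local Notation saff := (saff R n).
Local Notation forms := (forms R n).

(** What the bicomplex uses of the Hopf algebra F, its action and its coactions,
    as identities between functions on N. *)
Record twisted_data (actF : saff -> (N -> C) -> N -> C) (coS : saff -> N -> saff)
    (coO : forms -> N -> forms) : Prop := TwistedData {
  td_actF_regular X f : regular f -> regular (actF X f);
  td_actF_pder X psi : pder psi (fun f => actF X f psi);
  td_actF_e X f : regular f -> actF X f (oneN R n) = 0;
  td_actF_mulN X f psi phi : regular f -> actF X f (mulN psi phi) =
    \sum_b coS X phi b * actF (sdelta R b) (fun p => f (mulN p phi)) psi
    + actF X (fun q => f (mulN psi q)) phi;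
  td_coS_regular X b : regular (fun psi => coS X psi b);
  td_coS_mulN X psi phi : coS X (mulN psi phi) = coS (coS X phi) psi;
  td_coS_delta X psi b : coS X psi b = \sum_c X c * coS (sdelta R c) psi b;
  td_coS_br X Y phi k : coS (sbr X Y) phi k =
    \sum_a \sum_b coS X phi a * coS Y phi b * strC R k a b
    + actF X (fun psi => coS Y psi k) phi - actF Y (fun psi => coS X psi k) phi;
  td_coO_regular u : regform (coO u);
  td_coO_lin c u u' phi : coO (c *: u + u') phi = c *: coO u phi + coO u' phi;
  td_coO_expand u phi k K : form_coef k K (coO u phi) =
    \sum_k' \sum_(J <- mbox n (mdeg K))
      form_coef k' J u * form_coef k K (coO (fmono R k' J) phi);
  td_coO_mul u u' phi : coO (form_mul u u') phi = form_mul (coO u phi) (coO u' phi);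
  td_coO_mulN u psi phi : coO u (mulN psi phi) = coO (coO u phi) psi;
  td_coO_inv_actF X u L phi : finlin L ->
    L (lie (svec X) (coO u (invN phi))) + actF X (fun phi => L (coO u (invN phi))) phi =
    \sum_b coS X phi b * L (coO (lie (sbasis R b) u) (invN phi)) }.

Lemma hopf_twisted_data pr tri tel actF coS coO : hopf_pairing pr ->
  nondegenerate_pairing pr -> matched_actions tri tel -> dual_action pr tel actF ->
  s_coaction pr tri coS -> form_coaction pr coO -> twisted_data actF coS coO.
Proof.
move=> ph nd mat da sc oc; split.
- exact: regular_actF da.
- exact: (pder_actF ph nd mat da).
- exact: (actF_e ph mat da).
- exact: (actF_mulN ph nd mat da).
- by move=> X b; have [] := sc X b.
- exact: (coS_mulN ph nd mat sc).
- exact: (coS_delta ph nd mat sc).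
- exact: (coS_br ph nd mat da sc).
- exact: regform_coO oc.
- exact: (coO_lin ph nd oc).
- exact: (coO_expand ph nd oc).
- exact: (coO_mul ph nd oc).
- exact: (coO_mulN ph nd oc).
- exact: (coOV_actF ph nd mat da sc oc).
Qed.

End TwistedData.

(** * Regular functions on powers of N *)

Section RegularTensors.
Variables (R : realType) (n : nat).
Local Notation N := (diffeo0 R n).
Local Notation C := R[i].
Implicit Types (f g : seq N -> C) (h : N -> C).

Lemma regular_tens_supp q f l : regular_tens q f -> size l != q -> f l = 0.
Proof.
elim=> [f' _|//|c f' g' _ IHf _ IHg] lq; first by rewrite /ftens (negPf lq).
by rewrite IHf // IHg // mulr0 addr0.
Qed.

Lemma regular_tensD q f g : regular_tens q f -> regular_tens q g ->
  regular_tens q (fun l => f l + g l).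
Proof.
move=> rf rg; under eq_fun do rewrite -[f _]mul1r.
exact: regular_tens_lin.
Qed.

Lemma regular_tensZ q c f : regular_tens q f -> regular_tens q (fun l => c * f l).
Proof.
move=> rf; under eq_fun do rewrite -[_ * _]addr0.
by apply: regular_tens_lin => //; exact: regular_tens0.
Qed.

Lemma regular_tens_sum q (T : Type) (r : seq T) (P : pred T) (f : T -> seq N -> C) :
  (forall j, P j -> regular_tens q (f j)) ->
  regular_tens q (fun l => \sum_(j <- r | P j) f j l).
Proof.
move=> rf; elim: r => [|j r IH].
  by under eq_fun do rewrite big_nil; exact: regular_tens0.
under eq_fun do rewrite big_cons.
by case: (boolP (P j)) => // Pj; apply: regular_tensD => //; exact: rf.
Qed.

(** The function h (x) f. *)
Definition tcons h f : seq N -> C := fun l => if l is psi :: l' then h psi * f l' else 0.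

Lemma regular_tens_nil : regular_tens 0 (fun l : seq N => (size l == 0%N)%:R : C).
Proof.
rewrite (_ : (fun _ => _) = ftens (fun (_ : 'I_0) (_ : N) => 1 : C)).
  by apply: regular_tens_pure => -[].
by apply/funext => l; rewrite /ftens; case: eqP => //; rewrite big_ord0.
Qed.

Lemma ftens_cons q (f : 'I_q.+1 -> N -> C) :
  ftens f = tcons (f ord0) (ftens (fun i => f (lift ord0 i))).
Proof.
apply/funext => -[|psi l]; rewrite /ftens //= eqSS; case: eqP => _; last by rewrite mulr0.
by rewrite big_ord_recl.
Qed.

Lemma regular_tens_cons q h f : regular h -> regular_tens q f -> regular_tens q.+1 (tcons h f).
Proof.
move=> rh; elim=> [f' rf'||c f' g' _ IHf _ IHg].
- pose F (i : 'I_q.+1) := if unlift ord0 i is Some j then f' j else h.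
  have -> : tcons h (ftens f') = ftens F.
    rewrite ftens_cons /F unlift_none; congr (tcons h (ftens _)).
    by apply/funext => j; rewrite liftK.
  by apply: regular_tens_pure => i; rewrite /F; case: unliftP.
- rewrite (_ : tcons _ _ = fun=> 0); first exact: regular_tens0.
  by apply/funext => -[|psi l] //=; rewrite mulr0.
- rewrite (_ : tcons _ _ = fun l => c * tcons h f' l + tcons h g' l).
    exact: regular_tens_lin.
  apply/funext => -[|psi l] /=; first by rewrite mulr0 addr0.
  by rewrite mulrDr mulrCA.
Qed.

(** Induction on the number of variables, splitting off the first. *)
Lemma regular_tens_cons_ind (P : nat -> (seq N -> C) -> Prop) :
  P 0%N (fun l => (size l == 0%N)%:R) ->
  (forall q h f, regular h -> regular_tens q f -> P q f -> P q.+1 (tcons h f)) ->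
  (forall q, P q (fun=> 0)) ->
  (forall q c f g, regular_tens q f -> regular_tens q g -> P q f -> P q g ->
     P q (fun l => c * f l + g l)) ->
  forall q f, regular_tens q f -> P q f.
Proof.
move=> P0 Pcons Pz Plin q f; elim=> [f' rf'||c f' g' rf IHf rg IHg].
- elim: q f' rf' => [|q IH] f' rf'.
    rewrite (_ : ftens f' = fun l => (size l == 0%N)%:R) //.
    by apply/funext => l; rewrite /ftens; case: eqP => //; rewrite big_ord0.
  rewrite ftens_cons; apply: Pcons => //; last exact: IH.
  exact: regular_tens_pure.
- exact: Pz.
- exact: Plin.
Qed.

Lemma regular_tens_mul q f g : regular_tens q f -> regular_tens q g ->
  regular_tens q (fun l => f l * g l).
Proof.
move=> rf; elim: rf g => [f' rf'||c f1 f2 _ IH1 _ IH2] g rg.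
- elim: rg => [g' rg'||c g1 g2 _ IH1 _ IH2].
  + rewrite (_ : (fun _ => _) = ftens (fun i psi => f' i psi * g' i psi)).
      by apply: regular_tens_pure => i; exact: regular_mul.
    apply/funext => l; rewrite /ftens; case: eqP => _; last by rewrite mulr0.
    by rewrite -big_split.
  + by under eq_fun do rewrite mulr0; exact: regular_tens0.
  + under eq_fun do rewrite mulrDr mulrCA; exact: regular_tens_lin.
- by under eq_fun do rewrite mul0r; exact: regular_tens0.
- under eq_fun do rewrite mulrDl -mulrA; apply: regular_tens_lin; [exact: IH1|exact: IH2].
Qed.

Lemma regular_tens_cat q q' f g : regular_tens q f -> regular_tens q' g ->
  regular_tens (q + q') (fun l => f (take q l) * g (drop q l)).
Proof.
move=> rf rg; move: q f rf.
apply: regular_tens_cons_ind => [|q h f rh rf IH|q|q c f1 f2 _ _ IH1 IH2].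
- rewrite add0n; under eq_fun do rewrite take0 mul1r drop0; exact: rg.
- have := regular_tens_cons rh IH; congr regular_tens; apply/funext => -[|psi l] /=.
    by rewrite mul0r.
  by rewrite mulrA.
- by under eq_fun do rewrite mul0r; exact: regular_tens0.
- under eq_fun do rewrite mulrDl -mulrA; exact: regular_tens_lin.
Qed.

Lemma regular_tens_single h : regular h -> regular_tens 1 (fun l => if l is [:: psi] then h psi else 0).
Proof.
move=> rh; have := regular_tens_cons rh regular_tens_nil; congr regular_tens.
by apply/funext => -[|psi [|psi' l]] //=; rewrite ?mulr1 ?mulr0.
Qed.

(** If f is linear in h then h_(1) (x) f h_(2) is regular, as the coproduct is a
    sum of pure tensors. *)
Lemma regular_tens_cons2 q (G : N -> N -> C) (f : (N -> C) -> seq N -> C) : regular2 G -> (forall h, regular h -> regular_tens q (f h)) ->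
  (forall h h' l, f (fun phi => h phi + h' phi) l = f h l + f h' l) ->
  (forall c h l, f (fun phi => c * h phi) l = c * f h l) ->
  regular_tens q.+1 (fun l => if l is psi :: l' then f (G psi) l' else 0).
Proof.
move=> rG rf fD fZ; elim: rG => [g1 g2 r1 r2|G1 G2 _ IH1 _ IH2].
  have := regular_tens_cons r1 (rf _ r2); congr regular_tens.
  by apply/funext => -[|psi l] //=; rewrite fZ.
have := regular_tensD IH1 IH2; congr regular_tens.
by apply/funext => -[|psi l] /=; rewrite ?addr0 // fD.
Qed.

(** The iterated coproduct of h. *)
Lemma regular_tens_prod q h : regular h ->
  regular_tens q (fun l => if size l == q then h (prodN l) else 0).
Proof.
elim: q h => [|q IH] h rh.
  have := regular_tensZ (h (oneN R n)) regular_tens_nil; congr regular_tens.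
  by apply/funext => -[|psi l]; rewrite ?mulr1 ?mulr0.
pose F (h1 : N -> C) l := if size l == q then h1 (prodN l) else 0.
have FD h1 h2 l : F (fun phi => h1 phi + h2 phi) l = F h1 l + F h2 l.
  by rewrite /F; case: ifP; rewrite ?addr0.
have FZ c h1 l : F (fun phi => c * h1 phi) l = c * F h1 l.
  by rewrite /F; case: ifP; rewrite ?mulr0.
have := regular_tens_cons2 (regular_mulN rh) IH FD FZ; congr regular_tens.
by apply/funext => -[|psi l].
Qed.

Lemma regular_tens_contract q i f : regular_tens q f -> (0 < i <= q)%N ->
  regular_tens q.+1 (fun l => if size l == q.+1 then f (Defs.contract i l) else 0).
Proof.
move=> rf; move: q f rf i.
apply: regular_tens_cons_ind => [[|i]//|q h f rh rf IH [//|[_|i]]|q i _|q c f1 f2 r1 r2 IH1 IH2 i iq].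
- have FD h1 h2 l : tcons (fun phi => h1 phi + h2 phi) f l = tcons h1 f l + tcons h2 f l.
    by case: l => [|psi l] /=; rewrite ?addr0 ?mulrDl.
  have FZ c h1 l : tcons (fun phi => c * h1 phi) f l = c * tcons h1 f l.
    by case: l => [|psi l] /=; rewrite ?mulr0 ?mulrA.
  have := regular_tens_cons2 (regular_mulN rh) (fun h' r' => regular_tens_cons r' rf) FD FZ.
  congr regular_tens; apply/funext => -[|psi [|phi l]] //.
  rewrite /Defs.contract /= !eqSS drop0; case: eqP => // /eqP lq.
  by rewrite (regular_tens_supp rf lq) mulr0.
- rewrite !ltnS => /= iq; have := regular_tens_cons rh (IH i.+1 iq); congr regular_tens.
  apply/funext => -[|psi l] //=; rewrite eqSS; case: eqP => _; last by rewrite mulr0.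
  by rewrite /Defs.contract /=.
- by under eq_fun do rewrite if_same; exact: regular_tens0.
- have := regular_tens_lin c (IH1 i iq) (IH2 i iq); congr regular_tens.
  by apply/funext => l; case: ifP; rewrite ?mulr0 ?addr0.
Qed.

Lemma regular_tens_slot q f l i : regular_tens q f -> (i < size l)%N ->
  regular (fun phi => f (set_nth (oneN R n) l i phi)).
Proof.
move=> rf; move: q f rf l i.
apply: regular_tens_cons_ind => [[|psi l] [|i] //= _|q h f rh rf IH [|psi l] [|i] //= il|q l i _
  |q c f1 f2 _ _ IH1 IH2 l i il].
- exact: regular_cst.
- exact: regular_cst.
- by apply: regular_mul => //; exact: regular_cst.
- by apply: regular_scale; exact: IH.
- exact: regular_cst.
- by apply: regular_add; [apply: regular_scale; exact: IH1|exact: IH2].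
Qed.

End RegularTensors.

(** * The two differentials on the bicomplex *)

Section Bicomplex.
Variables (R : realType) (n : nat).
Local Notation N := (diffeo0 R n).
Local Notation C := R[i].
Local Notation I := (sidx n).
Local Notation saff := (saff R n).
Local Notation forms := (forms R n).
Local Notation e := (oneN R n).
Local Notation upsilon := (@upsilon R n).

Variables (actF : saff -> (N -> C) -> N -> C) (coS : saff -> N -> saff)
  (coO : forms -> N -> forms).
Hypothesis td : twisted_data actF coS coO.

Local Notation dCE := (dCE actF coS).
Local Notation bN := (bN coS coO).
Local Notation twist := (twist coS coO).
Local Notation phiS psi := (coSdual coS psi).

Lemma actF_flin X psi : flin (fun f => actF X f psi).
Proof. by have [] := td_actF_pder td X psi. Qed.

Lemma coSdual_deg psi b : extdeg 1 (phiS psi b).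
Proof.
move=> A A1; rewrite /coSdual extC_sumE big1 // => c _.
by rewrite extC_scaleE (upsilon_deg R c A1) mulr0.
Qed.

Lemma regular_coSdual b A : regular (fun psi => phiS psi b A).
Proof.
under eq_fun do rewrite /coSdual extC_sumE; apply: regular_sum => c _.
by apply: regular_mul; [exact: td_coS_regular td _ _|exact: regular_cst].
Qed.

(** The definition of the action on tensors, read from the first factor: X_<1> acts
    on the remaining ones through their composite. *)
Lemma bullet_cons X h f psi l : regular h ->
  (forall i, (i < size l)%N -> regular (fun phi => f (set_nth e l i phi))) ->
  bullet actF coS X (tcons h f) (psi :: l) =
  (\sum_b coS X (prodN l) b * actF (sdelta R b) h psi) * f l
  + h psi * bullet actF coS X f l.
Proof.
move=> rh rf; rewrite /bullet big_ord_recl /=; congr (_ + _).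
  rewrite drop0 mulr_suml; apply: eq_bigr => b _; rewrite -mulrA; congr (_ * _).
  by rewrite (flinZr (actF_flin _ _)).
rewrite mulr_sumr; apply: eq_bigr => i _; rewrite mulr_sumr; apply: eq_bigr => b _.
rewrite /= add0n mulrCA; congr (_ * _).
by rewrite (flinZ (actF_flin _ _)) //; exact: rf.
Qed.

Lemma bullet_lin q X c f g l : regular_tens q f -> regular_tens q g ->
  bullet actF coS X (fun l => c * f l + g l) l =
  c * bullet actF coS X f l + bullet actF coS X g l.
Proof.
move=> rf rg; rewrite /bullet mulr_sumr -big_split; apply: eq_bigr => i _ /=.
rewrite mulr_sumr -big_split; apply: eq_bigr => b _ /=.
rewrite (actF_flin _ _ c); [|exact: regular_tens_slot rf _|exact: regular_tens_slot rg _].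
ring.
Qed.

Lemma bullet0 X l : bullet actF coS X (fun=> 0) l = 0.
Proof.
rewrite /bullet big1 // => i _; rewrite big1 // => b _.
by rewrite (flin0 (actF_flin _ _)) mulr0.
Qed.

Lemma regular_tens_bullet q X f : regular_tens q f -> regular_tens q (bullet actF coS X f).
Proof.
move=> rf; move: q f rf; apply: regular_tens_cons_ind => [|q h f rh rf IH|q|q c f g rf rg IH1 IH2].
- rewrite (_ : bullet _ _ _ _ = fun=> 0); first exact: regular_tens0.
  apply/funext => -[|psi l]; first by rewrite /bullet big_ord0.
  rewrite /bullet big1 // => i _; rewrite big1 // => b _.
  rewrite (_ : (fun phi => _) = fun=> 0).
    by rewrite (flin0 (actF_flin _ _)) mulr0.
  by apply/funext => phi; rewrite size_set_nth /= maxnE.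
- have r1 b := regular_tens_cons (td_actF_regular td (sdelta R b) rh)
       (regular_tens_mul (regular_tens_prod q (td_coS_regular td X b)) rf).
  have r2 := regular_tens_sum (index_enum I) (P := xpredT) (fun b _ => r1 b).
  have := regular_tensD r2 (regular_tens_cons rh IH); congr regular_tens.
  apply/funext => -[|psi l]; first by rewrite /= big1 // addr0 /bullet big_ord0.
  rewrite bullet_cons //; last by move=> i; exact: regular_tens_slot rf.
  rewrite /=; congr (_ + _); rewrite mulr_suml; apply: eq_bigr => b _.
  case: eqP => [_|/eqP lq]; first by rewrite mulrA [_ * coS _ _ _]mulrC.
  by rewrite (regular_tens_supp rf lq) !mulr0.
- by rewrite (_ : bullet _ _ _ _ = fun=> 0); [exact: regular_tens0|apply/funext => l; exact: bullet0].
- rewrite (_ : bullet _ _ _ _ = fun l => c * bullet actF coS X f l + bullet actF coS X g l).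
    exact: regular_tens_lin.
  by apply/funext => l; exact: bullet_lin rf rg.
Qed.

Lemma regular_tens_finlin q (L : forms -> C) (c : seq N -> forms) : finlin L ->
  (forall k K, regular_tens q (fun l => form_coef k K (c l))) ->
  regular_tens q (fun l => L (c l)).
Proof.
move=> [s sE] rc; under eq_fun do rewrite sE.
by apply: regular_tens_sum => x _; apply: regular_tensZ; exact: rc.
Qed.

Definition rext q (z : seq N -> ext n forms) :=
  forall A k K, regular_tens q (fun l => form_coef k K (z l A)).

Lemma rextD q z z' : rext q z -> rext q z' -> rext q (fun l => z l + z' l).
Proof.
move=> rz rz' A k K; under eq_fun do rewrite ext_addE (finlin_addE _ _ (finlin_coef _ _)).
exact: regular_tensD.
Qed.

Lemma rextZ q c z : rext q z -> rext q (fun l => c *: z l).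
Proof.
move=> rz A k K; under eq_fun do rewrite ext_scaleE (finlin_scale _ _ (finlin_coef _ _)).
exact: regular_tensZ.
Qed.

Lemma rextN q z : rext q z -> rext q (fun l => - z l).
Proof. by move=> rz; under eq_fun do rewrite -scaleN1r; exact: rextZ. Qed.

Lemma rext0 q : rext q (fun=> 0).
Proof.
move=> A k K; rewrite (_ : (fun _ => _) = fun=> 0); first exact: regular_tens0.
by apply/funext => l; case: k.
Qed.

Lemma rext_sum q (T : Type) (r : seq T) (z : T -> seq N -> ext n forms) :
  (forall j, rext q (z j)) -> rext q (fun l => \sum_(j <- r) z j l).
Proof.
move=> rz; elim: r => [|j r IH].
  by under eq_fun do rewrite big_nil; exact: rext0.
by under eq_fun do rewrite big_cons; exact: rextD.
Qed.

Lemma rext_extlin q F z : rext q z -> rext q (fun l => extlin F (z l)).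
Proof.
move=> rz; under eq_fun do rewrite extlin_tensE.
apply: rext_sum => B A k K.
under eq_fun do rewrite (finlin_scale _ _ (finlin_coef _ _)).
exact: regular_tensZ.
Qed.

Lemma rext_wedgeC q x z : rext q z -> rext q (fun l => wedgeC x (z l)).
Proof.
move=> rz A k K; rewrite (_ : (fun _ => _) = fun l => \sum_(B : {set I} | B \subset A)
    (-1) ^+ inversions B (A :\: B) * (x B * form_coef k K (z l (A :\: B)))).
  by apply: regular_tens_sum => B _; apply: regular_tensZ; apply: regular_tensZ; exact: rz.
apply/funext => l; rewrite /wedgeC /wedge.
rewrite (big_morph _ (fun v v' => finlin_addE v v' (finlin_coef k K)) (finlin_0 (finlin_coef k K))).
by apply: eq_bigr => B _; rewrite !(finlin_scale _ _ (finlin_coef k K)).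
Qed.

Lemma rext_dCE q c : rext q c -> rext q (dCE c).
Proof.
move=> rc; apply: rextD; first apply: rextD.
- exact: rext_extlin.
- apply: rextN; apply: rext_sum => b; apply: (@rext_wedgeC _ _
     (fun l A => lie (sbasis R b) (c l A))) => A k K.
  exact: (regular_tens_finlin (finlin_lie (sbasis R b) k K)).
- apply: rextN; apply: rext_sum => b; apply: (@rext_wedgeC _ _
     (bullet_coef actF coS (sdelta R b) c)) => A k K.
  under eq_fun do rewrite form_coef_mk.
  exact: regular_tens_bullet.
Qed.

Lemma extdegD (M : lmodType C) p (z z' : ext n M) :
  extdeg p z -> extdeg p z' -> extdeg p (z + z').
Proof. by move=> zp zp' A Ap; rewrite ext_addE zp // zp' // addr0. Qed.

Lemma extdegZ (M : lmodType C) p k (z : ext n M) : extdeg p z -> extdeg p (k *: z).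
Proof. by move=> zp A Ap; rewrite ext_scaleE zp // scaler0. Qed.

Lemma extdegN (M : lmodType C) p (z : ext n M) : extdeg p z -> extdeg p (- z).
Proof. by move=> zp; rewrite -scaleN1r; exact: extdegZ. Qed.

Lemma extdeg_sum (M : lmodType C) p (T : Type) (r : seq T) (z : T -> ext n M) :
  (forall j, extdeg p (z j)) -> extdeg p (\sum_(j <- r) z j).
Proof. by move=> zp A Ap; rewrite ext_sumE big1 // => j _; exact: zp. Qed.

Lemma extdeg_dDR_mono s : extdeg (size s).+1 (@dDR_mono R n s).
Proof.
elim: s => [|b s IH] /=; first by move=> A _.
apply: extdegD.
  rewrite -add2n; apply: extdeg_wedge; [exact: bilin_scale|exact: dDR_gen_deg|].
  by apply: extdeg_extmul => b'; exact: upsilon_deg.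
apply: extdegN; rewrite -add1n; apply: extdeg_wedge => //; first exact: bilin_scale.
exact: upsilon_deg.
Qed.

Lemma extdeg_dDR (M : lmodType C) p (z : ext n M) : extdeg p z -> extdeg p.+1 (dDR z).
Proof.
move=> zp A Ap; rewrite /dDR /extlin big1 // => B _.
have [Bp|/zp ->] := eqVneq #|B| p; last by rewrite scaler0.
by rewrite extdeg_dDR_mono ?scale0r // -cardE Bp.
Qed.

Lemma extdeg_dCE p c l : (forall l, extdeg p (c l)) -> extdeg p.+1 (dCE c l).
Proof.
move=> cp; have up b (z : ext n forms) : extdeg p z -> extdeg p.+1 (wedgeC (upsilon b) z).
  move=> zp; rewrite -add1n; apply: extdeg_wedge => //; first exact: bilin_scale.
  exact: upsilon_deg.
apply: extdegD; first apply: extdegD; first exact: extdeg_dDR.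
  apply: extdegN; apply: extdeg_sum => b; apply: up => A Ap.
  by rewrite cp // linear0.
apply: extdegN; apply: extdeg_sum => b; apply: up => A Ap.
apply: form_ext => k K; rewrite form_coef_mk (finlin_0 (finlin_coef k K)).
rewrite (_ : (fun _ => _) = fun=> 0) ?bullet0 //.
by apply/funext => l'; rewrite cp // (finlin_0 (finlin_coef k K)).
Qed.

Lemma dCE_supp q c l : (forall l, size l != q -> c l = 0) -> size l != q -> dCE c l = 0.
Proof.
move=> cq lq; rewrite /Defs.dCE cq // /dDR extlin0.
have bw := bilin_wedgeC (R := R) n forms.
have z b (z : ext n forms) : z = 0 -> wedgeC (upsilon b) z = 0.
  by move=> ->; exact: (bilin0r _ bw).
rewrite big1 => [|b _]; last by apply: z; apply/funext => A; exact: linear0.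
rewrite big1 ?subr0 // => b _; apply: z; apply/funext => A; apply: form_ext => k K.
rewrite form_coef_mk (finlin_0 (finlin_coef k K)) /bullet.
rewrite big1 // => i _; rewrite big1 // => b' _.
rewrite (_ : (fun _ => _) = fun=> 0) ?(flin0 (actF_flin _ _)) ?mulr0 //.
apply/funext => psi; rewrite cq; first by rewrite (finlin_0 (finlin_coef k K)).
by rewrite size_set_nth (maxn_idPr _).
Qed.

Lemma bicomplex_dCE p q c : bicomplex p q c -> bicomplex p.+1 q (dCE c).
Proof.
move=> [cq cp rc]; split=> [l|l|]; [exact: dCE_supp|exact: extdeg_dCE|exact: rext_dCE].
Qed.

Lemma regular_extmul s A : regular (fun psi => extmul (phiS psi) s A).
Proof.
elim: s A => [|b s IH] A /=; first exact: regular_cst.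
apply: regular_sum => B _; apply: regular_scale.
apply: regular_mul; [exact: regular_coSdual|exact: IH].
Qed.

Lemma coO0 psi : coO 0 psi = 0.
Proof. by have := td_coO_lin td (-1) 0 0 psi; rewrite scaler0 addr0 scaleN1r addNr. Qed.

Lemma coOZ k u psi : coO (k *: u) psi = k *: coO u psi.
Proof. by rewrite -[k *: u]addr0 (td_coO_lin td) coO0 addr0. Qed.

Lemma twist_lin psi k z z' : twist psi (k *: z + z') = k *: twist psi z + twist psi z'.
Proof.
rewrite /Defs.twist -extlin_lin; congr extlin; apply/funext => A.
exact: (td_coO_lin td).
Qed.

Lemma twist0 psi : twist psi 0 = 0.
Proof. by have := twist_lin psi (-1) 0 0; rewrite scaler0 addr0 scaleN1r addNr. Qed.

Lemma twistZ psi k z : twist psi (k *: z) = k *: twist psi z.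
Proof. by rewrite -[k *: z]addr0 twist_lin twist0 addr0. Qed.

Lemma twistD psi z z' : twist psi (z + z') = twist psi z + twist psi z'.
Proof. by rewrite -(scale1r z) twist_lin !scale1r. Qed.

(** An expansion into finitely many regular functions, with the coefficients of z
    as scalars; it shows that the twist stays in the completed tensor product. *)
Lemma twist_coef psi z A k K : form_coef k K (twist psi z A) =
  \sum_(B : {set I}) \sum_k' \sum_(J <- mbox n (mdeg K)) form_coef k' J (z B) *
    (extmul (phiS psi) (enum B) A * form_coef k K (coO (fmono R k' J) (invN psi))).
Proof.
have coefD (u v : forms) := finlin_addE u v (finlin_coef k K).
have coef0 := finlin_0 (finlin_coef (R := R) k K).
rewrite /Defs.twist /extlin (big_morph _ coefD coef0); apply: eq_bigr => B _.
rewrite (finlin_scale _ _ (finlin_coef k K)) (td_coO_expand td) mulr_sumr.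
apply: eq_bigr => k' _; rewrite mulr_sumr; apply: eq_bigr => J _.
by rewrite mulrCA.
Qed.

Lemma regular_twist z A k K : regular (fun psi => form_coef k K (twist psi z A)).
Proof.
under eq_fun do rewrite twist_coef.
apply: regular_sum => B _; apply: regular_sum => k' _; apply: regular_sum => J _.
apply: regular_scale; apply: regular_mul; first exact: regular_extmul.
exact: (regular_invN (td_coO_regular td (fmono R k' J) k K)).
Qed.

Lemma extdeg_twist p psi z : extdeg p z -> extdeg p (twist psi z).
Proof.
move=> zp; apply: extdeg_extmap => [b|A Ap]; first exact: coSdual_deg.
by rewrite zp // coO0.
Qed.

Lemma size_contract i (l : seq N) : (0 < i < size l)%N ->
  size (Defs.contract i l) = (size l).-1.
Proof.
case: i => [//|i] /= il; rewrite /Defs.contract size_cat /= size_drop size_take.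
rewrite (ltnW il); case: (size l) il => // m im.
by rewrite subSS subnSK //= subnKC // ltnW.
Qed.

Lemma bN_supp q c l : (forall l, size l != q -> c l = 0) -> size l != q.+1 -> bN c l = 0.
Proof.
case: l => [//|psi l] cq /=; rewrite eqSS => lq.
rewrite cq // add0r big_nat big1 => [|i /andP[i0 il]]; last first.
  by rewrite cq ?scaler0 // size_contract ?i0.
by rewrite cq ?size_belast // twist0 scaler0 addr0.
Qed.

Lemma extdeg_bN p c l : (forall l, extdeg p (c l)) -> extdeg p (bN c l).
Proof.
move=> cp; case: l => [|psi l] /=; first by move=> A _.
apply: extdegD; last by apply: extdegZ; exact: extdeg_twist.
apply: extdegD => //; apply: extdeg_sum => i; exact: extdegZ.
Qed.

(** The faces of b_N are, in this order, a tensor product with 1, the contractions,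
    and the twist, which is handled by its expansion twist_coef. *)
Lemma rext_bN q c : (forall l, size l != q -> c l = 0) -> rext q c -> rext q.+1 (bN c).
Proof.
move=> cq rc; have cs := bN_supp cq.
have b1 (l : seq N) : size l = q.+1 -> bN c l = c (behead l) +
    \sum_(1 <= i < q.+1) (-1) ^+ i *: c (Defs.contract i l)
    + (-1) ^+ q.+1 *: twist (last e (drop q l)) (c (take q l)).
  case: l => [//|psi l] [lq]; rewrite /Defs.bN lq; congr (_ + _ *: twist _ _).
    by rewrite lastI -cats1 -lq -(size_belast psi l) drop_size_cat.
  by congr c; rewrite lastI -cats1 -lq -(size_belast psi l) take_size_cat.
move=> A k K.
have coefD (u v : forms) := finlin_addE u v (finlin_coef k K).
have coef0 := finlin_0 (finlin_coef (R := R) k K).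
have coefZ x (u : forms) := finlin_scale x u (finlin_coef k K).
pose T (l : seq N) := \sum_(B : {set I}) \sum_k' \sum_(J <- mbox n (mdeg K))
  form_coef k' J (c (take q l) B) * (fun l' => if l' is [:: psi] then
    (extmul (phiS psi) (enum B) A * form_coef k K (coO (fmono R k' J) (invN psi)))
    else 0) (drop q l).
have rT : regular_tens q.+1 T.
  apply: regular_tens_sum => B _; apply: regular_tens_sum => k' _; apply: regular_tens_sum => J _.
  have rJ : regular (fun psi => extmul (phiS psi) (enum B) A *
      form_coef k K (coO (fmono R k' J) (invN psi))).
    apply: regular_mul; first exact: regular_extmul.
    exact: (regular_invN (td_coO_regular td (fmono R k' J) k K)).
  by rewrite -addn1; exact: (regular_tens_cat (rc B k' J) (regular_tens_single rJ)).
have rM : regular_tens q.+1 (fun l => \sum_(1 <= i < q.+1) (-1) ^+ i *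
    (if size l == q.+1 then form_coef k K (c (Defs.contract i l) A) else 0)).
  rewrite (_ : (fun _ => _) = fun l => \sum_(i < q) (-1) ^+ i.+1 *
    (if size l == q.+1 then form_coef k K (c (Defs.contract i.+1 l) A) else 0)).
    by apply: regular_tens_sum => i _; apply: regular_tensZ; apply: (regular_tens_contract (rc A k K)) => /=.
  by apply/funext => l; rewrite big_add1 big_mkord.
have := regular_tensD (regular_tensD (regular_tens_cons (regular_cst n (1 : C)) (rc A k K)) rM) (regular_tensZ ((-1) ^+ q.+1) rT).
congr regular_tens; apply/funext => l.
case: (eqVneq (size l) q.+1) => [lq|lq]; last first.
  rewrite cs // coef0 big1 ?addr0 => [|i _]; last by rewrite mulr0.
  have -> : tcons (fun=> 1) (fun l => form_coef k K (c l A)) l = 0.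
    by case: l lq => [//|psi l] /=; rewrite eqSS => lq; rewrite cq // coef0 mulr0.
  rewrite add0r /T big1 ?mulr0 // => B _; rewrite big1 // => k' _; rewrite big1 // => J _.
  case E : (drop q l) => [|psi [|psi' l']]; rewrite ?mulr0 //.
  case/negP: lq; rewrite -(cat_take_drop q l) E size_cat /= size_take.
  have : (q < size l)%N by rewrite ltnNge; apply/negP => /drop_oversize; rewrite E.
  by move=> ->; rewrite addn1.
rewrite b1 // !ext_addE ext_scaleE !coefD coefZ ext_sumE (big_morph _ coefD coef0).
congr (_ + _ + _ * _).
- by case: l lq => [//|psi l] _ /=; rewrite mul1r.
- by apply: eq_bigr => i _; rewrite ext_scaleE coefZ.
- rewrite twist_coef /T; apply: eq_bigr => B _; apply: eq_bigr => k' _.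
  apply: eq_bigr => J _.
  have : size (drop q l) = 1%N by rewrite size_drop lq subSnn.
  by case: (drop q l) => [//|psi [|//]].
Qed.

Lemma bicomplex_bN p q c : bicomplex p q c -> bicomplex p q.+1 (bN c).
Proof.
move=> [cq cp rc]; split=> [l|l|]; [exact: bN_supp|exact: extdeg_bN|exact: rext_bN].
Qed.

(** Supports of bidegree (p, q), the part of the condition bicomplex on which the
    sums in totalD and star depend. *)
Definition bihom p q (c : cochain R n) :=
  (forall l, size l != q -> c l = 0) /\ (forall l, extdeg p (c l)).

Lemma bihom_component p q c : bihom p q c -> component p q c = c.
Proof.
move=> [cq cp]; apply/funext => l; apply/funext => A; rewrite /component.
case: eqP => [_|/eqP lq] /=; last by rewrite cq.
by case: eqP => // /eqP Ap; rewrite cp.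
Qed.

Lemma bihom_component0 p q p' q' c : bihom p q c -> (p', q') != (p, q) ->
  component p' q' c = 0.
Proof.
move=> [cq cp] pq; apply/funext => l; apply/funext => A; rewrite /component.
case: eqP => //= lq; case: eqP => //= Ap; case: (eqVneq q' q) => [qq|qq]; last first.
  by rewrite cq // lq.
rewrite cp // Ap; apply: contraNneq pq => ->; by rewrite qq.
Qed.

Lemma dCE0 l : dCE 0 l = 0.
Proof. by apply: (@dCE_supp (size l).+1) => //; rewrite neq_ltn ltnSn. Qed.

Lemma bN0 l : bN 0 l = 0.
Proof. by apply: (@bN_supp (size l)) => //; rewrite neq_ltn ltnSn. Qed.

Lemma bihom_gt_dim p q c : bihom p q c -> (#|I| < p)%N -> c = 0.
Proof.
move=> [_ cp] Ip; apply/funext => l; apply/funext => A; apply: cp.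
by rewrite neq_ltn (leq_ltn_trans (max_card _) Ip).
Qed.

Lemma totalD_bihom p q c : bihom p q c ->
  totalD actF coS coO c = dCE c + (-1) ^+ p *: bN c.
Proof.
move=> cpq; apply/funext => l; rewrite -[RHS]/(dCE c l + (-1) ^+ p *: bN c l).
have zero p' q' : (p', q') != (p, q) ->
    dCE (component p' q' c) l + (-1) ^+ p' *: bN (component p' q' c) l = 0.
  by move=> /(bihom_component0 cpq) ->; rewrite dCE0 bN0 scaler0 addr0.
have [pI|pI] := leqP p #|I|; last first.
  rewrite (bihom_gt_dim cpq pI) dCE0 bN0 scaler0 addr0 /totalD big1 // => p' _.
  rewrite big1 // => q' _; rewrite -(bihom_gt_dim cpq pI); apply: zero.
  rewrite xpair_eqE; apply/negP => /andP[/eqP pp _].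
  by have := ltn_ord p'; rewrite pp ltnS leqNgt pI.
rewrite /totalD (bigD1 (Ordinal (n := #|I|.+1) (m := p) pI)) //=.
rewrite [X in _ + X]big1 ?addr0 => [|p' pp]; last first.
  rewrite big1 // => q' _; apply: zero; rewrite xpair_eqE negb_and.
  by apply/orP; left; apply: contraNneq pp => pp; apply/eqP; exact: val_inj.
have [qs|qs] := leqP q (size l); last first.
  rewrite big1 => [|q' _]; last first.
    apply: zero; rewrite xpair_eqE eqxx /=; apply/negP => /eqP qq.
    by have := ltn_ord q'; rewrite qq ltnS leqNgt qs.
  rewrite (dCE_supp cpq.1) 1?(bN_supp cpq.1) ?scaler0 ?addr0 //.
    by rewrite neq_ltn ltnS ltnW.
  by rewrite neq_ltn qs.
rewrite (bigD1 (Ordinal (n := (size l).+1) (m := q) qs)) //=.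
rewrite [X in _ + X]big1 ?addr0 => [|q' qq]; last first.
  apply: zero; rewrite xpair_eqE negb_and; apply/orP; right.
  by apply: contraNneq qq => qq; apply/eqP; exact: val_inj.
by rewrite bihom_component.
Qed.

End Bicomplex.

(** * The cup product *)

Section Products.
Variables (R : realType) (n : nat).
Local Notation N := (diffeo0 R n).
Local Notation C := R[i].
Local Notation I := (sidx n).
Local Notation saff := (saff R n).
Local Notation forms := (forms R n).
Local Notation extC := (extC R n).
Local Notation cochain := (cochain R n).
Local Notation upsilon := (@upsilon R n).
Local Notation fmul := (@form_mul R n).

Variables (actF : saff -> (N -> C) -> N -> C) (coS : saff -> N -> saff)
  (coO : forms -> N -> forms).
Hypothesis td : twisted_data actF coS coO.

Local Notation dCE := (dCE actF coS).
Local Notation bN := (bN coS coO).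
Local Notation twist := (twist coS coO).
Local Notation phiS psi := (coSdual coS psi).
Local Notation cup := (cup coS coO).
Local Notation star := (star coS coO).
Local Notation bullet := (bullet actF coS).
Local Notation bihom := (@bihom R n).

Lemma bilin_fmul : bilin fmul.
Proof. by split=> *; [exact: form_mul_linl|exact: form_mul_linr]. Qed.

Let bfw : bilin (wedge (n := n) fmul). Proof. exact: (bilin_wedge n bilin_fmul). Qed.

(** The operators coO are multiplicative on forms and extlin on monomials. *)
Lemma twist_wedge psi z z' :
  twist psi (wedge fmul z z') = wedge fmul (twist psi z) (twist psi z').
Proof.
rewrite /Defs.twist -(extmap_wedge (coSdual_deg coS psi) _ _ bilin_fmul).
congr extlin; apply/funext => A; rewrite /wedge.
have coOD u v : coO (u + v) (invN psi) = coO u (invN psi) + coO v (invN psi).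
  by rewrite -(scale1r u) (td_coO_lin td) !scale1r.
rewrite (big_morph _ coOD (coO0 td _)); apply: eq_bigr => B _.
by rewrite (coOZ td) (td_coO_mul td).
Qed.

Lemma coSdual_mulN psi phi b : phiS (mulN psi phi) b =
  extlin (extmul (phiS phi)) (phiS psi b) :> extC.
Proof.
rewrite {2}/coSdual extlin_sum [LHS]/coSdual.
under [RHS]eq_bigr do rewrite extlinZ upsilon_umono extlin_umono enum_set1 /= wedgeCx1 /coSdual scaler_sumr.
rewrite exchange_big /=; apply: eq_bigr => c _.
rewrite (td_coS_mulN td) (td_coS_delta td) scaler_suml; apply: eq_bigr => c' _.
by rewrite scalerA mulrC.
Qed.

(** The antipode reverses the order, and so does the passage to the dual
    of s: both factors of the twist are right actions of N. *)
Lemma twist_mulN psi phi z : twist phi (twist psi z) = twist (mulN psi phi) z.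
Proof.
rewrite /Defs.twist.
have coOD u v : coO (u + v) (invN phi) = coO u (invN phi) + coO v (invN phi).
  by rewrite -(scale1r u) (td_coO_lin td) !scale1r.
transitivity (extlin (extmul (phiS phi)) (extlin (extmul (phiS psi))
    (fun A => coO (z A) (invN (mulN psi phi))))).
  congr extlin; apply/funext => A; rewrite /extlin (big_morph _ coOD (coO0 td _)).
  by apply: eq_bigr => B _; rewrite (coOZ td) invMN (td_coO_mulN td).
rewrite (extlin_tensE (extmul (phiS psi))) extlin_sum [RHS]extlin_tensE.
apply: eq_bigr => B _; rewrite extlin_tens.
suff -> : extlin (extmul (phiS phi)) (extmul (phiS psi) (enum B)) =
    extmul (phiS (mulN psi phi)) (enum B) :> extC by [].
elim: (enum B) => [|b s IH] /=.
  have -> : @ext1 R n = umono R finset.set0 by [].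
  by rewrite extlin_umono enum_set0.
rewrite (extmapC_wedge (coSdual_deg coS phi)) IH.
by rewrite coSdual_mulN.
Qed.

Lemma cup_supp q x y l : (forall l, size l != q -> x l = 0) ->
  cup x y l = wedge fmul (twist (prodN (drop q l)) (x (take q l))) (y (drop q l)).
Proof.
move=> xq; have [ql|ql] := leqP q (size l); last first.
  rewrite (xq (take q l)); last by rewrite size_take ltnNge ltnW //= neq_ltn ql.
  rewrite (twist0 td) (bilin0l _ bfw) /Defs.cup big1 // => q0 _.
  rewrite xq ?(twist0 td) ?(bilin0l _ bfw) // size_takel ?leq_ord //.
  by rewrite neq_ltn (leq_ltn_trans (leq_ord q0) ql).
rewrite /Defs.cup (bigD1 (Ordinal (n := (size l).+1) (m := q) ql)) //=.
rewrite big1 ?addr0 // => q0 qq; rewrite xq ?(twist0 td) ?(bilin0l _ bfw) //.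
rewrite size_takel ?leq_ord //; exact: contraNneq qq.
Qed.

Lemma cup_cat q x y l1 l2 : (forall l, size l != q -> x l = 0) -> size l1 = q ->
  cup x y (l1 ++ l2) = wedge fmul (twist (prodN l2) (x l1)) (y l2).
Proof.
by move=> xq l1q; rewrite (cup_supp _ _ xq) -l1q take_size_cat // drop_size_cat.
Qed.

Lemma cupDl x x' y : cup (x + x') y = cup x y + cup x' y.
Proof.
apply/funext => l; rewrite -[RHS]/(cup x y l + cup x' y l) -big_split.
apply: eq_bigr => q _ /=; rewrite -(bilinDl _ _ _ bfw) -(twistD td) //.
Qed.

Lemma cupDr x y y' : cup x (y + y') = cup x y + cup x y'.
Proof.
apply/funext => l; rewrite -[RHS]/(cup x y l + cup x y' l) -big_split.
by apply: eq_bigr => q _ /=; rewrite -(bilinDr _ _ _ bfw).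
Qed.

Lemma cupZl k x y : cup (k *: x) y = k *: cup x y.
Proof.
apply/funext => l; rewrite -[RHS]/(k *: cup x y l) scaler_sumr.
by apply: eq_bigr => q _ /=; rewrite -(bilinZl _ _ _ bfw) -(twistZ td).
Qed.

Lemma cupZr k x y : cup x (k *: y) = k *: cup x y.
Proof.
apply/funext => l; rewrite -[RHS]/(k *: cup x y l) scaler_sumr.
by apply: eq_bigr => q _ /=; rewrite -(bilinZr _ _ _ bfw).
Qed.

Lemma cup0l y : cup 0 y = 0.
Proof. by have := cupZl 0 0 y; rewrite !scale0r. Qed.

Lemma cup0r x : cup x 0 = 0.
Proof. by have := cupZr 0 x 0; rewrite !scale0r. Qed.

Lemma bihom_cup p q p' q' x y : bihom p q x -> bihom p' q' y ->
  bihom (p + p')%N (q + q')%N (cup x y).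
Proof.
move=> [xq xp] [yq yp]; split=> l.
  move=> lq; rewrite (cup_supp _ _ xq).
  have [ql|ql] := leqP q (size l); last first.
    rewrite (xq (take q l)) ?(twist0 td) ?(bilin0l _ bfw) //.
    by rewrite size_take ltnNge ltnW //= neq_ltn ql.
  rewrite yq ?(bilin0r _ bfw) // size_drop.
  by apply: contraNneq lq => E; rewrite -E subnKC.
rewrite (cup_supp _ _ xq); apply: extdeg_wedge => //; first exact: bilin_fmul.
exact: (extdeg_twist td).
Qed.

Lemma bihomZ p q k x : bihom p q x -> bihom p q (k *: x).
Proof.
move=> [xq xp]; split=> l; last exact: extdegZ.
by move=> lq; rewrite -[LHS]/(k *: x l) xq // scaler0.
Qed.

Lemma componentD p q (c c' : cochain) :
  component p q (c + c') = component p q c + component p q c'.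
Proof.
apply/funext => l; apply/funext => A.
rewrite -[RHS]/(component p q c l A + component p q c' l A) /component.
by case: ifP; rewrite ?addr0.
Qed.

Lemma componentZ p q k (c : cochain) : component p q (k *: c) = k *: component p q c.
Proof.
apply/funext => l; apply/funext => A.
rewrite -[RHS]/(k *: component p q c l A) /component.
by case: ifP; rewrite ?scaler0.
Qed.

Lemma starDl x x' y : star (x + x') y = star x y + star x' y.
Proof.
apply/funext => l; rewrite -[RHS]/(star x y l + star x' y l) -big_split.
apply: eq_bigr => p _; rewrite -big_split; apply: eq_bigr => q _ /=.
rewrite -big_split; apply: eq_bigr => p' _; rewrite -big_split; apply: eq_bigr => q' _ /=.
by rewrite componentD cupDl -scalerDr.
Qed.

Lemma starDr x y y' : star x (y + y') = star x y + star x y'.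
Proof.
apply/funext => l; rewrite -[RHS]/(star x y l + star x y' l) -big_split.
apply: eq_bigr => p _; rewrite -big_split; apply: eq_bigr => q _ /=.
rewrite -big_split; apply: eq_bigr => p' _; rewrite -big_split; apply: eq_bigr => q' _ /=.
by rewrite componentD cupDr -scalerDr.
Qed.

Lemma starZl k x y : star (k *: x) y = k *: star x y.
Proof.
apply/funext => l; rewrite -[RHS]/(k *: star x y l) scaler_sumr.
apply: eq_bigr => p _; rewrite scaler_sumr; apply: eq_bigr => q _ /=.
rewrite scaler_sumr; apply: eq_bigr => p' _; rewrite scaler_sumr; apply: eq_bigr => q' _ /=.
by rewrite componentZ cupZl -[(k *: _) l]/(k *: _ l) !scalerA mulrC.
Qed.

Lemma starZr k x y : star x (k *: y) = k *: star x y.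
Proof.
apply/funext => l; rewrite -[RHS]/(k *: star x y l) scaler_sumr.
apply: eq_bigr => p _; rewrite scaler_sumr; apply: eq_bigr => q _ /=.
rewrite scaler_sumr; apply: eq_bigr => p' _; rewrite scaler_sumr; apply: eq_bigr => q' _ /=.
by rewrite componentZ cupZr -[(k *: _) l]/(k *: _ l) !scalerA mulrC.
Qed.

(** Only one summand of the product survives on elements of pure bidegree. *)
Lemma star_bihom p q p' q' x y : bihom p q x -> bihom p' q' y ->
  star x y = (-1) ^+ (q * p') *: cup x y.
Proof.
move=> hx hy; apply/funext => l; rewrite -[RHS]/(_ *: cup x y l).
have [xz|xnz] := leqP p #|I|; last first.
  rewrite (bihom_gt_dim hx xnz) cup0l scaler0 /Defs.star.
  have c0 p0 q0 : component p0 q0 (0 : cochain) = 0.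
    by apply/funext => l'; apply/funext => A; rewrite /component if_same.
  rewrite big1 // => p0 _; rewrite big1 // => q0 _.
  rewrite big1 // => p1 _; rewrite big1 // => q1 _.
  by rewrite c0 cup0l scaler0.
have [yz|ynz] := leqP p' #|I|; last first.
  rewrite (bihom_gt_dim hy ynz) cup0r scaler0 /Defs.star.
  have c0 p0 q0 : component p0 q0 (0 : cochain) = 0.
    by apply/funext => l'; apply/funext => A; rewrite /component if_same.
  rewrite big1 // => p0 _; rewrite big1 // => q0 _.
  rewrite big1 // => p1 _; rewrite big1 // => q1 _.
  by rewrite c0 cup0r scaler0.
have zero p0 q0 p1 q1 : (p0, q0) != (p, q) \/ (p1, q1) != (p', q') ->
    (-1) ^+ (q0 * p1) *: cup (component p0 q0 x) (component p1 q1 y) l = 0.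
  by case=> [/(bihom_component0 hx) ->|/(bihom_component0 hy) ->];
     rewrite ?cup0l ?cup0r scaler0.
have ordneq m (i j : 'I_m) : i != j -> (i : nat) != j by [].
rewrite /Defs.star (bigD1 (Ordinal (n := #|I|.+1) (m := p) xz)) //=.
rewrite [X in _ + X]big1 ?addr0 => [|p0 /ordneq pp]; last first.
  rewrite big1 // => q0 _; rewrite big1 // => p1 _; rewrite big1 // => q1 _.
  by apply: zero; left; rewrite xpair_eqE negb_and pp.
have [ql|ql] := leqP q (size l); last first.
  have -> : cup x y l = 0.
    rewrite (cup_supp _ _ hx.1) (hx.1 (take q l)) ?(twist0 td) ?(bilin0l _ bfw) //.
    by rewrite size_take ltnNge ltnW //= neq_ltn ql.
  rewrite scaler0 big1 // => q0 _; rewrite big1 // => p1 _; rewrite big1 // => q1 _.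
  apply: zero; left; rewrite xpair_eqE negb_and; apply/orP; right.
  by rewrite neq_ltn (leq_ltn_trans (leq_ord q0) ql).
rewrite (bigD1 (Ordinal (n := (size l).+1) (m := q) ql)) //=.
rewrite [X in _ + X]big1 ?addr0 => [|q0 /ordneq qq]; last first.
  rewrite big1 // => p1 _; rewrite big1 // => q1 _.
  by apply: zero; left; rewrite xpair_eqE negb_and qq orbT.
rewrite (bigD1 (Ordinal (n := #|I|.+1) (m := p') yz)) //=.
rewrite [X in _ + X]big1 ?addr0 => [|p1 /ordneq pp]; last first.
  by rewrite big1 // => q1 _; apply: zero; right; rewrite xpair_eqE negb_and pp.
have [ql'|ql'] := leqP q' (size l); last first.
  have -> : cup x y l = 0.
    rewrite (cup_supp _ _ hx.1) (hy.1 (drop q l)) ?(bilin0r _ bfw) //.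
    by rewrite size_drop neq_ltn (leq_ltn_trans (leq_subr _ _) ql').
  rewrite scaler0 big1 // => q1 _.
  apply: zero; right; rewrite xpair_eqE negb_and; apply/orP; right.
  by rewrite neq_ltn (leq_ltn_trans (leq_ord q1) ql').
rewrite (bigD1 (Ordinal (n := (size l).+1) (m := q') ql')) //=.
rewrite [X in _ + X]big1 ?addr0 => [|q1 /ordneq qq]; last first.
  by apply: zero; right; rewrite xpair_eqE negb_and qq orbT.
by rewrite (bihom_component hx) (bihom_component hy).
Qed.

End Products.

(** * The Leibniz rule for b_N *)

Section LeibnizBN.
Variables (R : realType) (n : nat).
Local Notation N := (diffeo0 R n).
Local Notation C := R[i].
Local Notation saff := (saff R n).
Local Notation forms := (forms R n).
Local Notation extC := (extC R n).
Local Notation cochain := (cochain R n).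
Local Notation e := (oneN R n).
Local Notation upsilon := (@upsilon R n).
Local Notation fmul := (@form_mul R n).

Variables (actF : saff -> (N -> C) -> N -> C) (coS : saff -> N -> saff)
  (coO : forms -> N -> forms).
Hypothesis td : twisted_data actF coS coO.

Local Notation dCE := (dCE actF coS).
Local Notation bN := (bN coS coO).
Local Notation twist := (twist coS coO).
Local Notation cup := (cup coS coO).
Local Notation star := (star coS coO).
Local Notation bullet := (bullet actF coS).
Local Notation bihom := (@bihom R n).

Let bfw : bilin (wedge (n := n) fmul). Proof. exact: (bilin_wedge n (@bilin_fmul R n)). Qed.

Lemma prodN_cat (l1 l2 : seq N) : prodN (l1 ++ l2) = mulN (prodN l1) (prodN l2).
Proof. by elim: l1 => [|psi l1 IH] /=; rewrite ?mul1N // IH mulNA. Qed.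

Lemma prodN_rcons (l : seq N) psi : prodN (rcons l psi) = mulN (prodN l) psi.
Proof. by rewrite -cats1 prodN_cat /= mulN1. Qed.

Lemma contract_catl i (l1 l2 : seq N) : (0 < i < size l1)%N ->
  Defs.contract i (l1 ++ l2) = Defs.contract i l1 ++ l2.
Proof.
case: i => [//|i] /= il; rewrite /Defs.contract /= -catA /=.
rewrite takel_cat 1?ltnW // ?(ltnW il) // !nth_cat il (ltnW il).
congr (_ ++ _ :: _); rewrite drop_cat; case: ltnP => // ge.
have E : size l1 = i.+2 by apply/eqP; rewrite eqn_leq ge il.
by rewrite E subnn drop0 drop_oversize ?E.
Qed.

Lemma contract_catr i (l1 l2 : seq N) : (0 < i)%N ->
  Defs.contract (size l1 + i) (l1 ++ l2) = l1 ++ Defs.contract i l2.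
Proof.
case: i => [//|i] _; rewrite /Defs.contract addnS /= take_cat !nth_cat.
rewrite ltnNge leq_addr /= ltnNge (leq_trans (leq_addr i _) (leqnSn _)) /=.
rewrite addKn -addnS addKn -catA; congr (_ ++ (_ ++ _ :: _)).
by rewrite drop_cat ltnNge -addnS leq_addr /= addKn.
Qed.

Lemma prodN_contract i (l : seq N) : (0 < i < size l)%N ->
  prodN (Defs.contract i l) = prodN l.
Proof.
elim: l i => [|psi l IH] [|[|i]] //=.
  case: l {IH} => [//|phi l] _; rewrite /Defs.contract /= drop0.
  by rewrite mulNA.
rewrite ltnS => il; rewrite -(IH i.+1 il) /Defs.contract /=.
by [].
Qed.

Lemma bNE m (c : cochain) (l : seq N) : size l = m.+1 -> bN c l = c (behead l) +
  \sum_(1 <= i < m.+1) (-1) ^+ i *: c (Defs.contract i l)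
  + (-1) ^+ m.+1 *: twist (last e l) (c (take m l)).
Proof.
case: l => [//|psi l] [lm]; rewrite /Defs.bN lm; congr (_ + _ *: twist _ (c _)).
by rewrite lastI -cats1 -lm -(size_belast psi l) take_size_cat.
Qed.

Lemma twist_sum psi (T : Type) (r : seq T) (P : pred T) (z : T -> ext n forms) :
  twist psi (\sum_(i <- r | P i) z i) = \sum_(i <- r | P i) twist psi (z i).
Proof. by apply: big_morph => [z1 z2|]; [exact: (twistD td)|exact: (twist0 td)]. Qed.

Lemma wedge_face_l phi z1 z2 k m (F : nat -> ext n forms) v :
  wedge fmul (twist phi (z1 + \sum_(1 <= i < m) (-1) ^+ i *: F i + k *: z2)) v =
  wedge fmul (twist phi z1) v
  + \sum_(1 <= i < m) (-1) ^+ i *: wedge fmul (twist phi (F i)) v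
  + k *: wedge fmul (twist phi z2) v.
Proof.
rewrite 2!(twistD td) 2!(bilinDl _ _ _ bfw) (twistZ td) (bilinZl _ _ _ bfw) twist_sum.
rewrite (bilin_suml _ _ _ _ bfw); congr (_ + _ + _); apply: eq_bigr => i _.
by rewrite (twistZ td) (bilinZl _ _ _ bfw).
Qed.

Lemma wedge_face_r z z1 z2 k m (F : nat -> ext n forms) :
  wedge fmul z (z1 + \sum_(1 <= i < m) (-1) ^+ i *: F i + k *: z2) =
  wedge fmul z z1 + \sum_(1 <= i < m) (-1) ^+ i *: wedge fmul z (F i)
  + k *: wedge fmul z z2.
Proof.
rewrite 2!(bilinDr _ _ _ bfw) (bilinZr _ _ _ bfw).
rewrite (bilin_sumr _ _ _ _ bfw); congr (_ + _ + _); apply: eq_bigr => i _.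
by rewrite (bilinZr _ _ _ bfw).
Qed.

Lemma bihom_bN p q x : bihom p q x -> bihom p q.+1 (bN x).
Proof.
move=> [xq xp]; split=> l; first exact: (bN_supp td).
exact: (extdeg_bN td).
Qed.

(** Write l = l1 ++ psi :: l2 with q entries in l1. The first face and the
    contractions before position q + 1 come from x on l1 with psi, the later ones
    and the last face from y on psi with l2. The two remaining terms, the last
    face of x and the first face of y, are the product of the twist of x l1
    by the composite of psi :: l2 with y l2, with opposite signs. *)
Lemma bN_cup p q p' q' x y : bihom p q x -> bihom p' q' y ->
  bN (cup x y) = cup (bN x) y + (-1) ^+ q *: cup x (bN y).
Proof.
move=> hx hy; have hc := bihom_cup td hx hy; have [xq xp] := hx; have [yq yp] := hy.
have hbx := bihom_bN hx; have hby := bihom_bN hy.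
apply/funext => l; rewrite -[RHS]/(cup (bN x) y l + (-1) ^+ q *: cup x (bN y) l).
case: (eqVneq (size l) (q + q').+1) => [lq|lq]; last first.
  rewrite (bN_supp td hc.1) // (bihom_cup td hbx hy).1 ?addSn //.
  by rewrite (bihom_cup td hx hby).1 ?addnS // scaler0 addr0.
pose l1 := take q l; pose psi := nth e l q; pose l2 := drop q.+1 l.
have ql : (q < size l)%N by rewrite lq ltnS leq_addr.
have l1q : size l1 = q by rewrite size_takel // ltnW.
have l2q : size l2 = q' by rewrite size_drop lq subSS addKn.
have lE : l = l1 ++ psi :: l2 by rewrite -(drop_nth e ql) cat_take_drop.
have lE' : l = rcons l1 psi ++ l2 by rewrite lE cat_rcons.
have r1q : size (rcons l1 psi) = q.+1 by rewrite size_rcons l1q.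
have twB : bilin (fun (z1 z2 : ext n forms) => wedge fmul (twist (prodN l2) z1) z2).
  split=> k z1 z2 z3; first by rewrite (twist_lin td) bfw.1.
  by rewrite bfw.2.
have tk : take q (rcons l1 psi) = l1 by rewrite -l1q -cats1 take_size_cat.
have s2 : size (psi :: l2) = q'.+1 by rewrite /= l2q.
have -> : cup (bN x) y l =
    wedge fmul (twist (prodN l2) (x (behead (rcons l1 psi)))) (y l2)
    + \sum_(1 <= i < q.+1) (-1) ^+ i *:
        wedge fmul (twist (prodN l2) (x (Defs.contract i (rcons l1 psi)))) (y l2)
    + (-1) ^+ q.+1 *: wedge fmul (twist (prodN (psi :: l2)) (x l1)) (y l2).
  rewrite [in LHS]lE' (cup_cat td _ _ hbx.1 r1q) (bNE _ r1q) [LHS]wedge_face_l.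
  by rewrite (twist_mulN td) last_rcons tk.
have -> : cup x (bN y) l =
    wedge fmul (twist (prodN (psi :: l2)) (x l1)) (y l2)
    + \sum_(1 <= i < q'.+1) (-1) ^+ i *:
        wedge fmul (twist (prodN (psi :: l2)) (x l1)) (y (Defs.contract i (psi :: l2)))
    + (-1) ^+ q'.+1 *: wedge fmul (twist (prodN (psi :: l2)) (x l1))
        (twist (last e (psi :: l2)) (y (take q' (psi :: l2)))).
  by rewrite [in LHS]lE (cup_cat td _ _ xq l1q) (bNE _ s2) [LHS]wedge_face_r.
rewrite (bNE _ lq).
have -> : cup x y (behead l) =
    wedge fmul (twist (prodN l2) (x (behead (rcons l1 psi)))) (y l2).
  rewrite [in LHS]lE' -(cup_cat td _ _ xq); last by rewrite size_behead r1q.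
  by case: (l1).
have -> : twist (last e l) (cup x y (take (q + q') l)) =
    wedge fmul (twist (prodN (psi :: l2)) (x l1)) (twist (last e (psi :: l2)) (y (take q' (psi :: l2)))).
  rewrite lE last_cat take_cat l1q ltnNge leq_addr /= addKn (cup_cat td _ _ xq l1q).
  rewrite (twist_wedge td) (twist_mulN td) -prodN_rcons.
  have -> : take q' (psi :: l2) = belast psi l2.
    by rewrite lastI -cats1 -l2q -(size_belast psi l2) take_size_cat.
  by rewrite -lastI.
rewrite (@big_cat_nat _ _ _ q.+1) //=; last by rewrite ltnS leq_addr.
have -> : \sum_(1 <= i < q.+1) (-1) ^+ i *: cup x y (Defs.contract i l) =
  \sum_(1 <= i < q.+1) (-1) ^+ i *:
        wedge fmul (twist (prodN l2) (x (Defs.contract i (rcons l1 psi)))) (y l2).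
  apply: eq_big_nat => i iq; rewrite [in LHS]lE' contract_catl ?r1q //.
  by rewrite (cup_cat td _ _ xq) // size_contract r1q.
have -> : \sum_(q.+1 <= i < (q + q').+1) (-1) ^+ i *: cup x y (Defs.contract i l) =
  (-1) ^+ q *: \sum_(1 <= i < q'.+1) (-1) ^+ i *:
        wedge fmul (twist (prodN (psi :: l2)) (x l1)) (y (Defs.contract i (psi :: l2))).
  rewrite (_ : (q + q').+1 = (q'.+1 + q)%N); last by rewrite addSn addnC.
  rewrite -{1}[q.+1]add1n big_addn addnK scaler_sumr.
  apply: eq_big_nat => i /andP[i0 iq].
  rewrite scalerA -exprD [(i + q)%N]addnC [in LHS]lE -{2}l1q contract_catr //.
  by rewrite (cup_cat td _ _ xq l1q) prodN_contract // i0 s2.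
rewrite !scalerDr !scalerA -exprD addnS [(_ ^+ q.+1)]exprS mulN1r scaleNr.
by rewrite !addrA subrK.
Qed.

(** * The action of s on products *)

Lemma set_nth_id (l : seq N) i : (i < size l)%N -> set_nth e l i (nth e l i) = l.
Proof.
move=> il; apply: (@eq_from_nth _ e); first by rewrite size_set_nth (maxn_idPr _).
by move=> j _; rewrite nth_set_nth /=; case: eqP => [->|].
Qed.

Lemma regular_prod_slot h (l : seq N) i : regular h -> (i < size l)%N ->
  regular (fun phi => h (prodN (set_nth e l i phi))).
Proof.
move=> rh il; have := regular_tens_slot (regular_tens_prod (size l) rh) il; congr regular.
by apply/funext => phi; rewrite size_set_nth (maxn_idPr _) // eqxx.
Qed.

(** The action on h_(1) (x) ... (x) h_(q) is that on h: iterate td_actF_mulN. *)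
Lemma bullet_prod X h (l : seq N) : regular h ->
  bullet X (fun l => h (prodN l)) l = actF X h (prodN l).
Proof.
elim: l h => [|psi l IH] h rh.
  by rewrite /Defs.bullet big_ord0 /= (td_actF_e td).
rewrite /Defs.bullet big_ord_recl /= drop0 (td_actF_mulN td) //; congr (_ + _).
rewrite -IH; last exact: regular_transl.
rewrite /Defs.bullet; apply: eq_bigr => i _; apply: eq_bigr => b _.
by rewrite /= add0n.
Qed.

Lemma bullet_mul_prod q X g h (l : seq N) : regular_tens q g -> regular h ->
  bullet X (fun l => g l * h (prodN l)) l =
  bullet X g l * h (prodN l) + g l * actF X h (prodN l).
Proof.
move=> rg rh; rewrite -bullet_prod // /Defs.bullet mulr_suml mulr_sumr -big_split.
apply: eq_bigr => i _ /=; rewrite mulr_suml mulr_sumr -big_split; apply: eq_bigr => b _ /=.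
have [_ d] := td_actF_pder td (sdelta R b) (nth e l i).
have r1 := regular_tens_slot rg (ltn_ord i); have r2 := regular_prod_slot rh (ltn_ord i).
by rewrite (d _ _ r1 r2) !set_nth_id // mulrDr mulrA mulrCA.
Qed.

(** By induction on the length of the first list with bullet_cons; X_<1> is
    evaluated at the composite of all later entries, which the cocycle identity
    td_coS_mulN splits at the border of the two lists. *)
Lemma bullet_cat q q' X f G (l1 l2 : seq N) : regular_tens q f -> regular_tens q' G ->
  size l1 = q ->
  bullet X (fun l => f (take q l) * G (drop q l)) (l1 ++ l2) =
  (\sum_c coS X (prodN l2) c * bullet (sdelta R c) f l1) * G l2 + f l1 * bullet X G l2.
Proof.
move=> rf rG; move: q f rf l1.
apply: regular_tens_cons_ind => [|q h f rh rf IH|q l1 lq|q c f1 f2 r1 r2 IH1 IH2 l1 lq].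
- case=> [|//] _ /=; rewrite big1 => [|c _]; last by rewrite /Defs.bullet big_ord0 mulr0.
  rewrite mul0r add0r mul1r; congr (bullet _ _ _); apply/funext => l.
  by rewrite take0 mul1r drop0.
- case=> [//|psi l1] /= [lq].
  have -> : (fun l => tcons h f (take q.+1 l) * G (drop q.+1 l)) =
      tcons h (fun l => f (take q l) * G (drop q l)).
    by apply/funext => -[|phi l] /=; rewrite ?mul0r // mulrA.
  rewrite (bullet_cons td _ _ rh); last first.
    by move=> i il; apply: (regular_tens_slot (regular_tens_cat rf rG)).
  rewrite IH // -lq take_size_cat // drop_size_cat //.
  rewrite mulrDr !mulrA addrA; congr (_ + _); rewrite -mulrDl; congr (_ * _).
  rewrite prodN_cat.
  under [in RHS]eq_bigr do rewrite (bullet_cons td _ _ rh (fun i => regular_tens_slot rf (i := i))) mulrDr.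
  rewrite big_split /=; congr (_ + _); last first.
    by rewrite mulr_sumr; apply: eq_bigr => c _; rewrite mulrCA.
  rewrite mulr_suml; under [RHS]eq_bigr do rewrite mulrA mulr_sumr mulr_suml.
  rewrite exchange_big /=; apply: eq_bigr => b _.
  rewrite (td_coS_mulN td) (td_coS_delta td) !mulr_suml; apply: eq_bigr => c _.
  by rewrite !mulrA.
- rewrite mul0r addr0 big1 => [|c _]; last by rewrite (bullet0 td) mulr0.
  rewrite mul0r -[RHS](bullet0 td X (l1 ++ l2)); congr (bullet _ _ _).
  by apply/funext => l; rewrite mul0r.
- have -> : (fun l => (c * f1 (take q l) + f2 (take q l)) * G (drop q l)) =
     fun l => c * (f1 (take q l) * G (drop q l)) + f2 (take q l) * G (drop q l).
    by apply/funext => l; rewrite mulrDl mulrA.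
  rewrite (bullet_lin td X c _ (regular_tens_cat r1 rG) (regular_tens_cat r2 rG)) IH1 // IH2 //.
  have -> : \sum_c0 coS X (prodN l2) c0 *
      bullet (sdelta R c0) (fun l => c * f1 l + f2 l) l1 =
    c * (\sum_c0 coS X (prodN l2) c0 * bullet (sdelta R c0) f1 l1) +
    \sum_c0 coS X (prodN l2) c0 * bullet (sdelta R c0) f2 l1.
    rewrite mulr_sumr -big_split; apply: eq_bigr => c0 _ /=.
    by rewrite (bullet_lin td _ _ _ r1 r2); ring.
  ring.
Qed.

End LeibnizBN.

(** * The twist intertwines the differentials *)

Section TwistDifferential.
Variables (R : realType) (n : nat).
Local Notation N := (diffeo0 R n).
Local Notation C := R[i].
Local Notation I := (sidx n).
Local Notation saff := (saff R n).
Local Notation forms := (forms R n).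
Local Notation extC := (extC R n).
Local Notation cochain := (cochain R n).
Local Notation upsilon := (@upsilon R n).

Variables (actF : saff -> (N -> C) -> N -> C) (coS : saff -> N -> saff)
  (coO : forms -> N -> forms).
Hypothesis td : twisted_data actF coS coO.

Local Notation dCE := (dCE actF coS).
Local Notation bN := (bN coS coO).
Local Notation twist := (twist coS coO).
Local Notation phiS psi := (coSdual coS psi).
Local Notation cup := (cup coS coO).
Local Notation star := (star coS coO).
Local Notation bullet := (bullet actF coS).
Local Notation bihom := (@bihom R n).

Definition dextC X (z : N -> extC) psi : extC := fun A => actF X (fun phi => z phi A) psi.

Lemma dextC_wedge X (z z' : N -> extC) psi :
  (forall A, regular (fun phi => z phi A)) -> (forall A, regular (fun phi => z' phi A)) ->
  dextC X (fun phi => wedgeC (z phi) (z' phi)) psi =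
  wedgeC (dextC X z psi) (z' psi) + wedgeC (z psi) (dextC X z' psi).
Proof.
move=> rz rz'; have [ll ld] := td_actF_pder td X psi.
apply/funext => A; rewrite extC_addE /dextC /wedgeC /wedge -big_split /=.
pose t (B : {set I}) := fun phi => (-1) ^+ inversions B (A :\: B) * (z phi B * z' phi (A :\: B)).
have rt B : regular (t B) by apply: regular_scale; exact: regular_mul.
transitivity (\sum_(B <- enum [pred B : {set I} | B \subset A]) actF X (t B) psi).
  rewrite -(flin_sum ll _ rt); congr (actF _ _ _); apply/funext => phi.
  by rewrite big_enum.
rewrite big_enum; apply: eq_bigr => B _.
by rewrite /t (flinZ ll) ?ld ?mulrDr //; exact: regular_mul.
Qed.

(** The Chevalley-Eilenberg differential with coefficients in F. *)
Definition dtot (z : N -> extC) psi : extC :=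
  dext (z psi) - \sum_b wedgeC (upsilon b) (dextC (sdelta R b) z psi).

Lemma dtot_wedge (z z' : N -> extC) psi : extdeg 1 (z psi) ->
  (forall A, regular (fun phi => z phi A)) -> (forall A, regular (fun phi => z' phi A)) ->
  dtot (fun phi => wedgeC (z phi) (z' phi)) psi =
  wedgeC (dtot z psi) (z' psi) - wedgeC (z psi) (dtot z' psi).
Proof.
move=> z1 rz rz'; have bC := bilin_wedgeC (R := R) n C^o.
rewrite /dtot -[dext (wedgeC _ _)]dDR_dext.
rewrite {1}/wedgeC (dDR_wedge (z' psi) (bilin_scale _) z1) expr1 scaleN1r !dDR_dext.
rewrite -/(wedgeC _ _) -/(wedgeC (z psi) _).
under eq_bigr do rewrite (dextC_wedge _ _ rz rz') (bilinDr _ _ _ bC) -!wedgeCA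
  (wedgeC_comm (upsilon_deg R _) z1) muln1 expr1 scaleN1r.
move: (dext (z psi)) (dext (z' psi)) => dz dz'.
rewrite big_split /= (bilinBl _ _ _ bC) (bilinBr _ _ _ bC).
rewrite (bilin_suml _ _ _ _ bC) (bilin_sumr _ _ _ _ bC).
have -> : \sum_i wedgeC (- wedgeC (z psi) (upsilon i)) (dextC (sdelta R i) z' psi) =
    - \sum_i wedgeC (z psi) (wedgeC (upsilon i) (dextC (sdelta R i) z' psi)).
  rewrite -sumrN; apply: eq_bigr => i _.
  by rewrite -scaleN1r (bilinZl _ _ _ bC) scaleN1r wedgeCA.
move: (wedgeC _ _) (wedgeC _ _) (\sum_i _) (\sum_i _) => A B D E.
by rewrite !opprD !opprK (AC (2*2) ((1*3)*(2*4))).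
Qed.

Lemma dext_upsilon1 b : dext (upsilon b) = dDR_gen R b.
Proof.
rewrite -[upsilon b](wedgeCx1 (upsilon b)) dext_upsilon dext1.
by rewrite (bilin0r _ (bilin_wedgeC n C^o)) subr0 wedgeCx1.
Qed.

(** The Maurer-Cartan equation of the coaction, from td_coS_br. *)
Lemma dtot_coSdual b psi :
  dtot (fun phi => phiS phi b) psi = extlin (extmul (phiS psi)) (dDR_gen R b).
Proof.
have bC := bilin_wedgeC (R := R) n C^o.
pose u i j : extC := wedgeC (upsilon i) (upsilon j).
pose X i j := actF (sdelta R i) (fun phi => coS (sdelta R j) phi b) psi.
have uC i j : u j i = - u i j.
  by rewrite /u (wedgeC_comm (upsilon_deg R j) (upsilon_deg R i)) muln1 expr1 scaleN1r.
have d1 : dext (phiS psi b) =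
    2^-1 *: \sum_i \sum_j coS (sbr (sdelta R i) (sdelta R j)) psi b *: u i j.
  rewrite /coSdual dext_sum; under eq_bigr do rewrite dextZ dext_upsilon1 /dDR_gen.
  under eq_bigr do rewrite scalerA mulrC -scalerA scaler_sumr.
  rewrite -scaler_sumr; congr (_ *: _); rewrite exchange_big /=; apply: eq_bigr => i _.
  under eq_bigr do rewrite scaler_sumr; rewrite exchange_big /=; apply: eq_bigr => j _.
  rewrite (td_coS_delta td) scaler_suml; apply: eq_bigr => c _.
  by rewrite scalerA mulrC.
have d2 i : dextC (sdelta R i) (fun phi => phiS phi b) psi = \sum_j X i j *: upsilon j.
  apply/funext => A; rewrite extC_sumE /dextC.
  rewrite -[LHS](_ : actF (sdelta R i) (fun phi => \sum_j coS (sdelta R j) phi b * upsilon j A) psi = _).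
    rewrite (flin_sum (actF_flin td _ _)); last first.
      by move=> j; apply: regular_mul; [exact: (td_coS_regular td)|exact: regular_cst].
    apply: eq_bigr => j _; rewrite extC_scaleE (flinZr (actF_flin td _ _)) //.
    exact: (td_coS_regular td).
  by congr (actF _ _ _); apply/funext => phi; rewrite /coSdual extC_sumE.
have d3 : extlin (extmul (phiS psi)) (dDR_gen R b) = 2^-1 *: \sum_i \sum_j
    (\sum_a \sum_c coS (sdelta R i) psi a * coS (sdelta R j) psi c * strC R b a c) *: u i j.
  rewrite /dDR_gen extlinZ; congr (_ *: _); rewrite extlin_sum.
  under eq_bigr do rewrite extlin_sum.
  have hw a c : extlin (extmul (phiS psi)) (wedgeC (upsilon a) (upsilon c)) =
      \sum_i \sum_j (coS (sdelta R i) psi a * coS (sdelta R j) psi c) *: u i j :> extC.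
    have he k : extlin (extmul (phiS psi)) (upsilon k) = phiS psi k :> extC.
      by rewrite upsilon_umono extlin_umono enum_set1 /= wedgeCx1.
    rewrite (extmapC_wedge (coSdual_deg coS psi)) !he {1}/coSdual (bilin_suml _ _ _ _ bC).
    apply: eq_bigr => i _; rewrite (bilinZl _ _ _ bC) /coSdual (bilin_sumr _ _ _ _ bC) scaler_sumr.
    by apply: eq_bigr => j _; rewrite (bilinZr _ _ _ bC) scalerA.
  under eq_bigr do under eq_bigr do rewrite extlinZ hw scaler_sumr.
  under eq_bigr do rewrite exchange_big /=.
  rewrite exchange_big /=; apply: eq_bigr => i _.
  under eq_bigr do under eq_bigr do rewrite scaler_sumr.
  under eq_bigr do rewrite exchange_big /=.
  rewrite exchange_big /=; apply: eq_bigr => j _.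
  rewrite scaler_suml; apply: eq_bigr => a _; rewrite scaler_suml; apply: eq_bigr => c _.
  by rewrite scalerA mulrC.
have d4 : \sum_i wedgeC (upsilon i) (dextC (sdelta R i) (fun phi => phiS phi b) psi) =
    \sum_i \sum_j X i j *: u i j.
  apply: eq_bigr => i _; rewrite d2 (bilin_sumr _ _ _ _ bC); apply: eq_bigr => j _.
  exact: (bilinZr _ _ _ bC).
have d5 : \sum_i \sum_j X j i *: u i j = - \sum_i \sum_j X i j *: u i j.
  rewrite exchange_big -sumrN; apply: eq_bigr => i _ /=; rewrite -sumrN.
  by apply: eq_bigr => j _; rewrite uC scalerN.
have d6 : \sum_i \sum_j coS (sbr (sdelta R i) (sdelta R j)) psi b *: u i j =
    \sum_i \sum_j (\sum_a \sum_c coS (sdelta R i) psi a * coS (sdelta R j) psi c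
         * strC R b a c) *: u i j
    + \sum_i \sum_j X i j *: u i j - \sum_i \sum_j X j i *: u i j.
  rewrite -big_split -sumrB; apply: eq_bigr => i _ /=.
  rewrite -big_split -sumrB; apply: eq_bigr => j _ /=.
  by rewrite (td_coS_br td) scalerBl scalerDl.
rewrite /dtot d1 d3 d4 d6 d5 opprK.
move: (\sum_i _) (\sum_i _) => S1 S2.
have half (x : C) : 2^-1 * (x + x) = x.
  by rewrite -mulr2n -[x *+ 2]mulr_natl mulrA mulVf ?pnatr_eq0 // mul1r.
apply/funext => A; transitivity (2^-1 * (S2 A + S1 A + S1 A) - S1 A) => //.
rewrite -addrA mulrDr half addrK //.
Qed.

Lemma dtot_extmul s psi :
  dtot (fun phi => extmul (phiS phi) s) psi =
  extlin (extmul (phiS psi)) (dDR_mono R s).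
Proof.
have bC := bilin_wedgeC (R := R) n C^o.
elim: s => [|b s IH] /=.
  rewrite /dtot dext1 extlin0 big1 ?subr0 // => b _.
  have -> : dextC (sdelta R b) (fun=> @ext1 R n) psi = 0.
    apply/funext => A; rewrite /dextC.
    have [ll ld] := td_actF_pder td (sdelta R b) psi.
    have r1 : regular (fun _ : N => 1 : C) by exact: regular_cst.
    have a1 : actF (sdelta R b) (fun=> 1) psi = 0.
      have := ld _ _ r1 r1; rewrite !mulr1 !mul1r => h.
      by apply: (@addrI _ (actF (sdelta R b) (fun=> 1) psi)); rewrite addr0 -h.
    rewrite -[RHS](mul0r (@ext1 R n A)) -a1 -(flinZr ll) //; congr (actF _ _ _).
    by apply/funext => phi; rewrite mul1r.
  exact: (bilin0r _ bC).
rewrite (dtot_wedge (coSdual_deg coS psi b)); last 2 first.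
- exact: (regular_coSdual td).
- exact: (regular_extmul td).
rewrite IH dtot_coSdual.
have xB (x y : extC) : extlin (extmul (phiS psi)) (x - y) =
    extlin (extmul (phiS psi)) x - extlin (extmul (phiS psi)) y :> extC.
  by rewrite extlinD -scaleN1r extlinZ scaleN1r.
have hx t : extlin (extmul (phiS psi)) (extmul upsilon t) = extmul (phiS psi) t :> extC.
  exact: (extmap_extmul1 (coSdual_deg coS psi)).
rewrite xB !(extmapC_wedge (coSdual_deg coS psi)) hx; congr (_ - wedgeC _ _).
by rewrite upsilon_umono extlin_umono enum_set1 /= wedgeCx1.
Qed.

(** The twist of /\ s^* commutes with the differentials: both sides are derivations
    over the twist, and dtot_coSdual treats the generators. *)
Lemma dtot_extlin (eta : extC) psi :
  dtot (fun phi => extlin (extmul (phiS phi)) eta) psi =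
  extlin (extmul (phiS psi)) (dext eta).
Proof.
have bC := bilin_wedgeC (R := R) n C^o.
have dX X : dextC X (fun phi => extlin (extmul (phiS phi)) eta) psi =
    \sum_(B : {set I}) eta B *: dextC X (fun phi => extmul (phiS phi) (enum B)) psi.
  apply/funext => A; rewrite extC_sumE /dextC.
  pose t (B : {set I}) := fun phi => extmul (phiS phi) (enum B) A * eta B.
  have rt B : regular (t B).
    by apply: regular_mul; [exact: (regular_extmul td)|exact: regular_cst].
  transitivity (actF X (fun phi => \sum_B t B phi) psi) => //.
  rewrite (flin_sum (actF_flin td _ _) _ rt); apply: eq_bigr => B _.
  rewrite /t (flinZr (actF_flin td _ _)) 1?mulrC //; exact: (regular_extmul td).
have eE phi : extlin (extmul (phiS phi)) eta = \sum_(B : {set I}) eta B *: extmul (phiS phi) (enum B) :> extC.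
  by rewrite {1}(extC_decomp eta) extlin_sum; apply: eq_bigr => B _; rewrite extlinZ extlin_umono.
have e1 : dext (extlin (extmul (phiS psi)) eta) =
    \sum_(B : {set I}) eta B *: dext (extmul (phiS psi) (enum B)).
  by rewrite eE dext_sum; apply: eq_bigr => B _; exact: dextZ.
have e2 : \sum_b wedgeC (upsilon b) (dextC (sdelta R b)
      (fun phi => extlin (extmul (phiS phi)) eta) psi) =
    \sum_(B : {set I}) eta B *: \sum_b wedgeC (upsilon b)
      (dextC (sdelta R b) (fun phi => extmul (phiS phi) (enum B)) psi).
  under [RHS]eq_bigr do rewrite scaler_sumr.
  rewrite exchange_big /=; apply: eq_bigr => b _; rewrite dX (bilin_sumr _ _ _ _ bC).
  by apply: eq_bigr => B _; exact: (bilinZr _ _ _ bC).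
rewrite /dtot e1 e2 -sumrB [in RHS](extC_decomp eta) dext_sum extlin_sum.
apply: eq_bigr => B _; rewrite dextZ extlinZ (umono_extmul _ B) dext_extmul -dtot_extmul.
by rewrite /dtot scalerBr.
Qed.

End TwistDifferential.

Section LieDifferential.
Variables (R : realType) (n : nat).
Local Notation N := (diffeo0 R n).
Local Notation C := R[i].
Local Notation I := (sidx n).
Local Notation saff := (saff R n).
Local Notation forms := (forms R n).
Local Notation extC := (extC R n).
Local Notation cochain := (cochain R n).
Local Notation upsilon := (@upsilon R n).
Local Notation fmul := (@form_mul R n).

Variables (actF : saff -> (N -> C) -> N -> C) (coS : saff -> N -> saff)
  (coO : forms -> N -> forms).
Hypothesis td : twisted_data actF coS coO.

Local Notation dCE := (dCE actF coS).
Local Notation bN := (bN coS coO).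
Local Notation twist := (twist coS coO).
Local Notation phiS psi := (coSdual coS psi).
Local Notation cup := (cup coS coO).
Local Notation star := (star coS coO).
Local Notation bullet := (bullet actF coS).
Local Notation bihom := (@bihom R n).

Let bfm : bilin fmul. Proof. exact: bilin_fmul. Qed.
Let bfw : bilin (wedge (n := n) fmul). Proof. exact: (bilin_wedge n bfm). Qed.
Let bw : bilin (@wedgeC R n forms). Proof. exact: bilin_wedgeC. Qed.
Let bt : bilin (fun (x : extC) (m : forms) => tens x m). Proof. exact: bilin_tens. Qed.
Local Notation act X psi := (fun h : N -> C => actF X h psi).

Lemma wedgeC_wedge (x : extC) z z' :
  wedgeC x (wedge fmul z z') = wedge fmul (wedgeC x z) z'.
Proof.
symmetry; apply: wedgeA; [exact: bfm|exact: bilin_scale|move=> a b c].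
exact: (bilinZl _ _ _ bfm).
Qed.

Lemma wedge_wedgeC p b z z' : extdeg p z ->
  wedge fmul z (wedgeC (upsilon b) z') =
  (-1) ^+ p *: wedgeC (upsilon b) (wedge fmul z z').
Proof.
move=> zp; rewrite wedgeC_wedge -(bilinZl _ _ _ bfw).
transitivity (wedge fmul (wedge (fun (m : forms) (c : C^o) => c *: m) z (upsilon b)) z').
  symmetry; apply: wedgeA; [exact: bfm|exact: bfm|move=> a c v].
  by rewrite (bilinZl _ _ _ bfm) (bilinZr _ _ _ bfm).
congr (wedge _ _ _).
have bsc : bilin (fun (m : forms) (c : C^o) => c *: m).
  by split=> [k m m' c|k m c c']; [exact: (bilin_scale forms).2|exact: (bilin_scale forms).1].
by rewrite (wedge_comm bsc zp (upsilon_deg R b)) muln1.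
Qed.

Definition lieE (b : I) (z : ext n forms) : ext n forms := fun A => lie (sbasis R b) (z A).

Lemma lieE_scale b k z : lieE b (k *: z) = k *: lieE b z.
Proof. by apply/funext => A; exact: linearZ. Qed.

Lemma lieE_tens b x m : lieE b (tens x m) = tens x (lie (sbasis R b) m).
Proof. by apply/funext => A; exact: linearZ. Qed.

Lemma lieE_wedge b z z' : lieE b (wedge fmul z z') =
  wedge fmul (lieE b z) z' + wedge fmul z (lieE b z').
Proof.
apply/funext => A; rewrite ext_addE /lieE /wedge raddf_sum -big_split.
by apply: eq_bigr => B _ /=; rewrite linearZ /= lieM scalerDr.
Qed.

(** The Chevalley-Eilenberg differential of s with coefficients in forms, that is
    d_CE without its term on F. *)
Definition dLie (z : ext n forms) : ext n forms :=
  dDR z - \sum_b wedgeC (upsilon b) (lieE b z).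

Definition dextF X (Z : N -> ext n forms) psi : ext n forms :=
  fun A => lform (act X psi) (fun phi => Z phi A).

Lemma dextF_tens X (z : N -> extC) (Fm : N -> forms) psi :
  (forall A, regular (fun phi => z phi A)) -> regform Fm ->
  dextF X (fun phi => tens (z phi) (Fm phi)) psi =
  tens (dextC actF X z psi) (Fm psi) + tens (z psi) (lform (act X psi) Fm).
Proof.
move=> rz rF; have [ll ld] := td_actF_pder td X psi.
apply/funext => A; rewrite ext_addE /tens; apply: form_ext => k K.
have cD := finlin_addE _ _ (finlin_coef k K); have cZ := finlin_scale _ _ (finlin_coef k K).
rewrite cD !cZ !form_coef_mk /dextC -(ld _ _ (rz A) (rF k K)).
by congr (actF _ _ _); apply/funext => phi; rewrite cZ.
Qed.

Lemma twist_tens psi eta u : twist psi (tens eta u) =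
  tens (extlin (extmul (phiS psi)) eta) (coO u (invN psi)).
Proof.
rewrite -extlin_tens; congr extlin; apply/funext => A; exact: (coOZ td).
Qed.

(** The exterior factor is dtot_extlin. On the form factor the sum over b of the
    Lie derivative and of the derivative along N is given by td_coO_inv_actF, and
    the coefficients of coS that appear there are those of phiS. *)
Lemma twist_dLie eta u psi :
  dLie (twist psi (tens eta u))
  - \sum_b wedgeC (upsilon b) (dextF (sdelta R b) (fun phi => twist phi (tens eta u)) psi) =
  twist psi (dLie (tens eta u)).
Proof.
set h := extlin (extmul (phiS psi)) eta; set m := coO u (invN psi).
have dF b : dextF (sdelta R b) (fun phi => twist phi (tens eta u)) psi =
    tens (dextC actF (sdelta R b) (fun phi => extlin (extmul (phiS phi)) eta) psi) m
    + tens h (lform (act (sdelta R b) psi) (fun phi => coO u (invN phi))).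
  rewrite -(dextF_tens (sdelta R b) (z := fun phi => extlin (extmul (phiS phi)) eta)
    (Fm := fun phi => coO u (invN phi))).
  - by congr dextF; apply/funext => phi; rewrite twist_tens.
  - move=> A; apply: regular_sum => B _; apply: regular_mul; last exact: regular_cst.
    exact: (regular_extmul td).
  - by move=> k K; exact: (regular_invN (td_coO_regular td u k K)).
have lF b : lie (sbasis R b) m
    + lform (act (sdelta R b) psi) (fun phi => coO u (invN phi)) =
    \sum_c coS (sdelta R b) psi c *: coO (lie (sbasis R c) u) (invN psi).
  apply: form_ext => k K; have fl := finlin_coef (R := R) k K.
  rewrite (finlin_addE _ _ fl) form_coef_mk (finlin_sumE _ _ _ fl).
  by rewrite -(td_coO_inv_actF td _ _ _ fl) svec_delta.
have bC := bilin_wedgeC (R := R) n C^o.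
have tL : twist psi (dLie (tens eta u)) = tens (extlin (extmul (phiS psi)) (dext eta)) m
   - \sum_c tens (wedgeC (phiS psi c) h) (coO (lie (sbasis R c) u) (invN psi)).
  rewrite /dLie dDR_tens -scaleN1r (twistD td) (twistZ td) scaleN1r twist_tens.
  congr (_ - _); rewrite (twist_sum td); apply: eq_bigr => c _.
  rewrite lieE_tens wedgeC_tens twist_tens.
  by rewrite (extmapC_wedge (coSdual_deg coS psi)) upsilon_umono extlin_umono enum_set1 /= wedgeCx1.
rewrite tL -(dtot_extlin td) /dtot twist_tens -/h -/m /dLie dDR_tens.
have -> : \sum_b wedgeC (upsilon b) (dextF (sdelta R b) (fun phi => twist phi (tens eta u)) psi) =
   tens (\sum_b wedgeC (upsilon b) (dextC actF (sdelta R b)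
          (fun phi => extlin (extmul (phiS phi)) eta) psi)) m
   + \sum_b tens (wedgeC (upsilon b) h)
       (lform (act (sdelta R b) psi) (fun phi => coO u (invN phi))).
  rewrite (bilin_suml _ _ _ _ bt) -big_split; apply: eq_bigr => b _ /=.
  by rewrite dF (bilinDr _ _ _ bw) !wedgeC_tens.
rewrite (bilinBl _ _ _ bt) -!addrA; congr (_ + _); rewrite opprD addrCA; congr (_ + _).
rewrite -opprD -big_split /=; congr (- _).
transitivity (\sum_b \sum_c coS (sdelta R b) psi c *:
    tens (wedgeC (upsilon b) h) (coO (lie (sbasis R c) u) (invN psi))).
  apply: eq_bigr => b _; rewrite lieE_tens wedgeC_tens -(bilinDr _ _ _ bt) lF.
  rewrite (bilin_sumr _ _ _ _ bt); apply: eq_bigr => c _.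
  exact: (bilinZr _ _ _ bt).
rewrite exchange_big; apply: eq_bigr => c _ /=.
rewrite /coSdual (bilin_suml _ _ _ _ bC) (bilin_suml _ _ _ _ bt).
by apply: eq_bigr => b _; rewrite (bilinZl _ _ _ bC) (bilinZl _ _ _ bt).
Qed.

End LieDifferential.

(** * The Leibniz rule for d_CE *)

Section PureTensors.
Variables (R : realType) (n : nat).
Local Notation N := (diffeo0 R n).
Local Notation C := R[i].
Local Notation I := (sidx n).
Local Notation saff := (saff R n).
Local Notation forms := (forms R n).
Local Notation extC := (extC R n).
Local Notation cochain := (cochain R n).
Local Notation upsilon := (@upsilon R n).
Local Notation fmul := (@form_mul R n).

Variables (actF : saff -> (N -> C) -> N -> C) (coS : saff -> N -> saff)
  (coO : forms -> N -> forms).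
Hypothesis td : twisted_data actF coS coO.

Local Notation dCE := (dCE actF coS).
Local Notation bN := (bN coS coO).
Local Notation twist := (twist coS coO).
Local Notation cup := (cup coS coO).
Local Notation star := (star coS coO).
Local Notation bullet := (bullet actF coS).
Local Notation bihom := (@bihom R n).

Let bfm : bilin fmul. Proof. exact: bilin_fmul. Qed.
Let bfw : bilin (wedge (n := n) fmul). Proof. exact: (bilin_wedge n bfm). Qed.
Let bw : bilin (@wedgeC R n forms). Proof. exact: bilin_wedgeC. Qed.

Lemma finlin_form_mul (v : forms) k K : finlin (fun u => form_coef k K (form_mul u v)).
Proof.
case: k => [i|]; last exact: finlin0.
have f1 : finlin_fps (@fst (fps R n) (form1 R n)) by move=> J; exact: (finlin_coef None J).
have := finlin_fps_mul (v.2 i) f1 K; congr finlin; apply/funext => u.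
by rewrite mulrC.
Qed.

Lemma form_coef_wedge (z z' : ext n forms) A k K : form_coef k K (wedge fmul z z' A) =
  \sum_(B : {set I} | B \subset A)
    (-1) ^+ inversions B (A :\: B) * form_coef k K (form_mul (z B) (z' (A :\: B))).
Proof.
have fl := finlin_coef (R := R) k K.
rewrite /wedge (big_morph _ (fun v v' => finlin_addE v v' fl) (finlin_0 fl)).
by apply: eq_bigr => B _; rewrite (finlin_scale _ _ fl).
Qed.

Lemma regular_wedge (Z : N -> ext n forms) V A k K :
  (forall A, regform (fun phi => Z phi A)) ->
  regular (fun phi => form_coef k K (wedge fmul (Z phi) V A)).
Proof.
move=> rZ; under eq_fun do rewrite form_coef_wedge.
apply: regular_sum => B _; apply: regular_scale.
exact: (finlin_regular (finlin_form_mul _ k K) (rZ B)).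
Qed.

(** The derivative along N passes through the product with a constant, as each
    coefficient of the product is a finite combination of coefficients of Z. *)
Lemma dextF_wedge X (Z : N -> ext n forms) V psi :
  (forall A, regform (fun phi => Z phi A)) ->
  dextF actF X (fun phi => wedge fmul (Z phi) V) psi = wedge fmul (dextF actF X Z psi) V.
Proof.
move=> rZ; apply/funext => A; apply: form_ext => k K.
have ll := actF_flin td X psi.
rewrite form_coef_mk form_coef_wedge.
under eq_fun do rewrite form_coef_wedge -big_filter.
have r B : regular (fun phi => form_coef k K (form_mul (Z phi B) (V (A :\: B)))).
  exact: (finlin_regular (finlin_form_mul _ k K) (rZ B)).
rewrite (flin_sum ll) => [|B]; last exact: regular_scale.
rewrite -[RHS]big_filter; apply: eq_bigr => B _.
by rewrite (flinZ ll) // (finlin_flin ll (finlin_form_mul _ k K) (rZ B)).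
Qed.

Lemma dLie_wedge p z z' : extdeg p z ->
  dLie (wedge fmul z z') = wedge fmul (dLie z) z' + (-1) ^+ p *: wedge fmul z (dLie z').
Proof.
move=> zp; rewrite /dLie (dDR_wedge z' bfm zp).
rewrite (bilinBl _ _ _ bfw) (bilinBr _ _ _ bfw) (bilin_suml _ _ _ _ bfw) (bilin_sumr _ _ _ _ bfw).
under eq_bigr do rewrite lieE_wedge (bilinDr _ _ _ bw) wedgeC_wedge.
rewrite big_split /= scalerBr scaler_sumr.
under [X in _ + (_ - X)]eq_bigr => b _ do
  rewrite (wedge_wedgeC b _ zp) scalerA -exprMn mulrNN mulr1 expr1n scale1r.
by rewrite opprD (AC (2*2) ((1*3)*(2*4))).
Qed.

Lemma pure_tensE (u : forms) (eta : extC) (f : seq N -> C) (l : seq N) : pure_tens u eta f l = f l *: tens eta u.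
Proof. by apply/funext => A; rewrite ext_scaleE /tens scalerA. Qed.

Lemma bulletZr q X f k (l : seq N) : regular_tens q f ->
  bullet X (fun l => f l * k) l = bullet X f l * k.
Proof.
move=> rf; have := bullet_lin td X k l rf (regular_tens0 R n q).
rewrite (bullet0 td) addr0 mulrC => <-; congr (bullet _ _ _).
by apply/funext => l'; rewrite addr0 mulrC.
Qed.

Lemma dCE_pure q (u : forms) (eta : extC) f (l : seq N) : regular_tens q f ->
  dCE (pure_tens u eta f) l = f l *: dLie (tens eta u)
    - \sum_b bullet (sdelta R b) f l *: wedgeC (upsilon b) (tens eta u).
Proof.
move=> rf; rewrite /Defs.dCE pure_tensE /dDR extlinZ -/(dDR _) scalerBr; congr (_ - _ - _).
  rewrite scaler_sumr; apply: eq_bigr => b _.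
  by rewrite -(bilinZr _ _ _ bw) -lieE_scale.
apply: eq_bigr => b _; rewrite -(bilinZr _ _ _ bw); congr wedgeC.
apply/funext => A; apply: form_ext => k K; have fl := finlin_coef (R := R) k K.
rewrite form_coef_mk ext_scaleE (finlin_scale _ _ fl) -(bulletZr _ _ _ rf).
congr (bullet _ _ _); apply/funext => l'.
by rewrite pure_tensE ext_scaleE (finlin_scale _ _ fl).
Qed.

Lemma bihom_pure p q (u : forms) (eta : extC) f : extdeg p eta -> regular_tens q f ->
  bihom p q (pure_tens u eta f).
Proof.
move=> ep rf; split=> l; first by move=> lq; rewrite pure_tensE (regular_tens_supp rf lq) scale0r.
by move=> A Ap; rewrite /pure_tens ep // mulr0 scale0r.
Qed.

Lemma dCE_scale_pure q k (u : forms) (eta : extC) f : regular_tens q f ->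
  dCE (k *: pure_tens u eta f) = k *: dCE (pure_tens u eta f).
Proof.
move=> rf; have -> : k *: pure_tens u eta f = pure_tens u eta (fun l => f l * k).
  by apply/funext => l; rewrite -[LHS]/(k *: pure_tens u eta f l) !pure_tensE scalerA mulrC.
apply/funext => l; rewrite -[RHS]/(k *: dCE (pure_tens u eta f) l).
have scale_rhs : k *: (f l *: dLie (tens eta u)
      - \sum_b bullet (sdelta R b) f l *: wedgeC (upsilon b) (tens eta u)) =
    (f l * k) *: dLie (tens eta u)
      - \sum_b bullet (sdelta R b) (fun l => f l * k) l *: wedgeC (upsilon b) (tens eta u).
  rewrite [LHS]scalerBr [in LHS]scalerA mulrC scaler_sumr; congr (_ - _).
  by apply: eq_bigr => b _; rewrite (bulletZr _ _ _ rf) scalerA mulrC.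
have rfk : regular_tens q (fun l => f l * k).
  by under eq_fun do rewrite mulrC; exact: regular_tensZ.
rewrite [LHS](dCE_pure _ _ _ rfk) -scale_rhs.
congr (_ *: _); symmetry; exact: (dCE_pure _ _ _ rf).
Qed.

End PureTensors.

Section LeibnizCE.
Variables (R : realType) (n : nat).
Local Notation N := (diffeo0 R n).
Local Notation C := R[i].
Local Notation I := (sidx n).
Local Notation saff := (saff R n).
Local Notation forms := (forms R n).
Local Notation extC := (extC R n).
Local Notation cochain := (cochain R n).
Local Notation upsilon := (@upsilon R n).
Local Notation fmul := (@form_mul R n).

Variables (actF : saff -> (N -> C) -> N -> C) (coS : saff -> N -> saff)
  (coO : forms -> N -> forms).
Hypothesis td : twisted_data actF coS coO.

Local Notation dCE := (dCE actF coS).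
Local Notation bN := (bN coS coO).
Local Notation twist := (twist coS coO).
Local Notation cup := (cup coS coO).
Local Notation star := (star coS coO).
Local Notation bullet := (bullet actF coS).
Local Notation bihom := (@bihom R n).

Let bfm : bilin fmul. Proof. exact: bilin_fmul. Qed.
Let bfw : bilin (wedge (n := n) fmul). Proof. exact: (bilin_wedge n bfm). Qed.
Let bw : bilin (@wedgeC R n forms). Proof. exact: bilin_wedgeC. Qed.

Lemma regform_twist U A : regform (fun phi => twist phi U A).
Proof. by move=> k K; exact: (regular_twist td). Qed.

(** The product at l is f (take q l) g (drop q l) W(psi), with W a function of the
    composite psi of the second list only. So bullet_cat and bullet_mul_prod apply
    to each coefficient. *)
Lemma bullet_coef_cup q q' b (u v : forms) (eta zeta : extC) f g (l1 l2 : seq N) :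
  regular_tens q f -> regular_tens q' g -> size l1 = q ->
  let W phi := wedge fmul (twist phi (tens eta u)) (tens zeta v) in
  let psi := prodN l2 in
  bullet_coef actF coS (sdelta R b) (cup (pure_tens u eta f) (pure_tens v zeta g)) (l1 ++ l2) =
  ((\sum_c coS (sdelta R b) psi c * bullet (sdelta R c) f l1) * g l2) *: W psi
  + (f l1 * bullet (sdelta R b) g l2) *: W psi
  + (f l1 * g l2) *: dextF actF (sdelta R b) W psi.
Proof.
move=> rf rg l1q W psi; apply/funext => A; apply: form_ext => k K.
have fl := finlin_coef (R := R) k K.
have cE a b' c (w w' : ext n forms) : form_coef k K ((a *: w + b' *: w + c *: w') A) =
    a * form_coef k K (w A) + b' * form_coef k K (w A) + c * form_coef k K (w' A).
  by case: (k).
rewrite cE !form_coef_mk {cE}.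
pose h phi := form_coef k K (W phi A).
have rh : regular h by apply: regular_wedge => B; exact: regform_twist.
pose G l := g l * h (prodN l).
have rG : regular_tens q' G.
  have := regular_tens_mul rg (regular_tens_prod q' rh); congr regular_tens; apply/funext => l; rewrite /G.
  by case: eqP => // /eqP lq; rewrite (regular_tens_supp rg lq) !mul0r.
have -> : (fun l => form_coef k K (cup (pure_tens u eta f) (pure_tens v zeta g) l A)) =
    fun l => f (take q l) * G (drop q l).
  apply/funext => l; rewrite (cup_supp td (q := q)); last first.
    by move=> l' lq; rewrite pure_tensE (regular_tens_supp rf lq) scale0r.
  rewrite !pure_tensE (twistZ td) (bilinZl _ _ _ bfw) (bilinZr _ _ _ bfw).
  by rewrite !ext_scaleE !(finlin_scale _ _ fl).
rewrite (bullet_cat td _ _ rf rG l1q) (bullet_mul_prod td _ _ rg rh).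
by rewrite /G mulrDr !mulrA addrA.
Qed.

(** The three groups of terms of bullet_coef_cup go to three places. The derivative
    of W corrects dLie of the product into the product of differentials, by
    twist_dLie. The action on f with the coefficients coS recombines
    upsilon b into the twist of upsilon c. The action on g only needs upsilon b to
    be moved past the twist of x, which gives the sign. *)
Lemma dCE_cup p q p' q' (u v : forms) (eta zeta : extC) f g :
  extdeg p eta -> regular_tens q f -> extdeg p' zeta -> regular_tens q' g ->
  dCE (cup (pure_tens u eta f) (pure_tens v zeta g)) =
  cup (dCE (pure_tens u eta f)) (pure_tens v zeta g)
  + (-1) ^+ p *: cup (pure_tens u eta f) (dCE (pure_tens v zeta g)).
Proof.
move=> ep rf zp rg; set x := pure_tens u eta f; set y := pure_tens v zeta g.
have hx : bihom p q x by exact: bihom_pure.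
have hy : bihom p' q' y by exact: bihom_pure.
have dxq l : size l != q -> dCE x l = 0 by exact: (dCE_supp td hx.1).
have dyq l : size l != q' -> dCE y l = 0 by exact: (dCE_supp td hy.1).
apply/funext => l.
rewrite -[RHS]/(cup (dCE x) y l + (-1) ^+ p *: cup x (dCE y) l).
have [lq|lq] := eqVneq (size l) (q + q')%N; last first.
  rewrite (dCE_supp td (bihom_cup td hx hy).1 lq) (cup_supp td _ _ dxq) (cup_supp td _ _ hx.1).
  have [ql|ql] := leqP q (size l); last first.
    have tq : size (take q l) != q by rewrite size_take ltnNge ltnW //= neq_ltn ql.
    by rewrite dxq // hx.1 // (twist0 td) !(bilin0l _ bfw) scaler0 addr0.
  have dq : size (drop q l) != q'.
    by rewrite size_drop; apply: contraNneq lq => E; rewrite -E subnKC.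
  have z0 (z z' : ext n forms) : z' = 0 -> wedge fmul z z' = 0 by move=> ->; exact: (bilin0r _ bfw).
  have sum0 (z z' : ext n forms) : z = 0 -> z' = 0 -> 0 = z + (-1) ^+ p *: z'.
    by move=> -> ->; rewrite scaler0 addr0.
  apply: sum0; apply: z0; [exact: (hy.1 _ dq)|exact: (dyq _ dq)].
have l1q : size (take q l) = q by rewrite size_takel // lq leq_addr.
rewrite -(cat_take_drop q l); move: (take q l) (drop q l) l1q => l1 l2 l1q {lq l}.
rewrite (cup_cat td _ _ dxq l1q) (cup_cat td _ _ hx.1 l1q).
set psi := prodN l2; set U : ext n forms := tens eta u; set V : ext n forms := tens zeta v.
set W := fun phi => wedge fmul (twist phi U) V.
have ec : cup x y (l1 ++ l2) = (f l1 * g l2) *: W psi.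
  rewrite (cup_cat td _ _ hx.1 l1q) /x /y !pure_tensE (twistZ td).
  by rewrite (bilinZl _ _ _ bfw) (bilinZr _ _ _ bfw) scalerA.
have Tp : extdeg p (twist psi U).
  by apply: (extdeg_twist td) => A Ap; rewrite /U /tens ep // scale0r.
pose B f0 b l0 := bullet (sdelta R b) f0 l0.
have dL : dCE (cup x y) (l1 ++ l2) = (f l1 * g l2) *: (dLie (W psi)
      - \sum_b wedgeC (upsilon b) (dextF actF (sdelta R b) W psi))
    - \sum_b ((\sum_c coS (sdelta R b) psi c * B f c l1) * g l2) *: wedgeC (upsilon b) (W psi)
    - \sum_b (f l1 * B g b l2) *: wedgeC (upsilon b) (W psi).
  have wb b : wedgeC (upsilon b) (bullet_coef actF coS (sdelta R b) (cup x y) (l1 ++ l2)) =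
      ((\sum_c coS (sdelta R b) psi c * B f c l1) * g l2) *: wedgeC (upsilon b) (W psi)
      + (f l1 * B g b l2) *: wedgeC (upsilon b) (W psi)
      + (f l1 * g l2) *: wedgeC (upsilon b) (dextF actF (sdelta R b) W psi).
    rewrite -3!(bilinZr _ _ _ bw) -2!(bilinDr _ _ _ bw); congr wedgeC.
    exact: (bullet_coef_cup b u v eta zeta l2 rf rg l1q).
  have ws : \sum_b wedgeC (upsilon b) (bullet_coef actF coS (sdelta R b) (cup x y) (l1 ++ l2)) =
      \sum_b ((\sum_c coS (sdelta R b) psi c * B f c l1) * g l2) *: wedgeC (upsilon b) (W psi)
      + \sum_b (f l1 * B g b l2) *: wedgeC (upsilon b) (W psi)
      + (f l1 * g l2) *: \sum_b wedgeC (upsilon b) (dextF actF (sdelta R b) W psi).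
    by rewrite scaler_sumr -2!big_split; apply: eq_bigr => b _; exact: wb.
  rewrite /Defs.dCE ws ec /dDR extlinZ -/(dDR _).
  have -> : \sum_b wedgeC (upsilon b)
      (fun A => lie (sbasis R b) (((f l1 * g l2) *: W psi) A)) =
      (f l1 * g l2) *: \sum_b wedgeC (upsilon b) (lieE b (W psi)).
    by rewrite scaler_sumr; apply: eq_bigr => b _; rewrite -(bilinZr _ _ _ bw) -lieE_scale.
  have gen k (z s1 s3 P Q : ext n forms) :
      k *: z - k *: s1 - (P + Q + k *: s3) = k *: (z - s1 - s3) - P - Q.
    by rewrite 2!scalerBr !opprD -!addrA; congr (_ + (_ + _)); rewrite addrA addrC.
  exact: gen.
have tw : dLie (W psi) - \sum_b wedgeC (upsilon b) (dextF actF (sdelta R b) W psi) =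
    wedge fmul (twist psi (dLie U)) V + (-1) ^+ p *: wedge fmul (twist psi U) (dLie V).
  pose S := \sum_b wedgeC (upsilon b) (dextF actF (sdelta R b) (fun phi => twist phi U) psi).
  have tU : wedge fmul (twist psi (dLie U)) V = wedge fmul (dLie (twist psi U)) V - wedge fmul S V.
    by rewrite -(twist_dLie td); exact: (bilinBl _ _ _ bfw).
  have sW : \sum_b wedgeC (upsilon b) (dextF actF (sdelta R b) W psi) = wedge fmul S V.
    rewrite /S (bilin_suml _ _ _ _ bfw); apply: eq_bigr => b _; rewrite -wedgeC_wedge.
    by congr wedgeC; apply: (dextF_wedge td) => A; exact: regform_twist.
  have dW : dLie (W psi) = wedge fmul (dLie (twist psi U)) V
      + (-1) ^+ p *: wedge fmul (twist psi U) (dLie V) by exact: dLie_wedge.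
  apply: (etrans (congr2 (fun z z' => z - z') dW sW)); apply: (etrans (addrAC _ _ _)).
  exact: (congr1 (fun z => z + _) (esym tU)).
rewrite dL tw !(dCE_pure td _ _ _ rf) !(dCE_pure td _ _ _ rg) -/U -/V /x /y !pure_tensE -/U -/V.
have e1 : wedge fmul (twist psi (f l1 *: dLie U
      - \sum_b bullet (sdelta R b) f l1 *: wedgeC (upsilon b) U)) (g l2 *: V) =
    (f l1 * g l2) *: wedge fmul (twist psi (dLie U)) V
    - \sum_b ((\sum_c coS (sdelta R b) psi c * B f c l1) * g l2) *: wedgeC (upsilon b) (W psi).
  have gen k k' (z v' : ext n forms) (a : I -> C) (zb : I -> ext n forms) :
      wedge fmul (twist psi (k *: z - \sum_b a b *: zb b)) (k' *: v') =
      (k * k') *: wedge fmul (twist psi z) v'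
      - \sum_b (a b * k') *: wedge fmul (twist psi (zb b)) v'.
    rewrite -scaleN1r (twistD td) 2!(twistZ td) scaleN1r (twist_sum td) (bilinZr _ _ _ bfw).
    rewrite (bilinBl _ _ _ bfw) scalerBr (bilinZl _ _ _ bfw) scalerA mulrC; congr (_ - _).
    rewrite (bilin_suml _ _ _ _ bfw) scaler_sumr; apply: eq_bigr => b _.
    rewrite (twistZ td) (bilinZl _ _ _ bfw) mulrC.
    exact: scalerA.
  have E := gen (f l1) (g l2) (dLie U) V (fun b => bullet (sdelta R b) f l1)
    (fun b => wedgeC (upsilon b) U).
  apply: (etrans E); apply: (congr1 (fun z => _ - z)); move=> {E gen}.
  have tu c : wedge fmul (twist psi (wedgeC (upsilon c) U)) V =
      \sum_b coS (sdelta R b) psi c *: wedgeC (upsilon b) (W psi).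
    rewrite /U wedgeC_tens (twist_tens td) (extmapC_wedge (coSdual_deg coS psi)).
    rewrite upsilon_umono extlin_umono enum_set1 /= wedgeCx1 -wedgeC_tens -(twist_tens td) -/U.
    rewrite -wedgeC_wedge -/(W psi) /coSdual (bilin_suml _ _ _ _ bw).
    by apply: eq_bigr => b _; exact: (bilinZl _ _ _ bw).
  transitivity (\sum_c \sum_b ((B f c l1 * g l2) * coS (sdelta R b) psi c) *:
      wedgeC (upsilon b) (W psi)).
    apply: eq_bigr => c _; rewrite tu scaler_sumr; apply: eq_bigr => b _.
    exact: scalerA.
  rewrite exchange_big; apply: eq_bigr => b _ /=; rewrite mulr_suml scaler_suml.
  by apply: eq_bigr => c _; congr (_ *: _); rewrite mulrC mulrA.
have e2 : wedge fmul (twist psi (f l1 *: U)) (g l2 *: dLie V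
      - \sum_b bullet (sdelta R b) g l2 *: wedgeC (upsilon b) V) =
    (f l1 * g l2) *: wedge fmul (twist psi U) (dLie V)
    - (-1) ^+ p *: \sum_b (f l1 * B g b l2) *: wedgeC (upsilon b) (W psi).
  have gen k k' (z v' : ext n forms) (a : I -> C) (zb : I -> ext n forms) :
      wedge fmul (twist psi (k *: z)) (k' *: v' - \sum_b a b *: zb b) =
      (k * k') *: wedge fmul (twist psi z) v'
      - \sum_b (k * a b) *: wedge fmul (twist psi z) (zb b).
    rewrite (twistZ td) (bilinZl _ _ _ bfw) (bilinBr _ _ _ bfw) scalerBr (bilinZr _ _ _ bfw) scalerA.
    congr (_ - _); rewrite (bilin_sumr _ _ _ _ bfw) scaler_sumr; apply: eq_bigr => b _.
    rewrite (bilinZr _ _ _ bfw); exact: scalerA.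
  have E := gen (f l1) (g l2) U (dLie V) (fun b => bullet (sdelta R b) g l2)
    (fun b => wedgeC (upsilon b) V).
  apply: (etrans E); apply: (congr1 (fun z => _ - z)); move=> {E gen}.
  rewrite scaler_sumr; apply: eq_bigr => b _.
  have gC k (z : ext n forms) : k *: ((-1) ^+ p *: z) = (-1) ^+ p *: (k *: z).
    by rewrite !scalerA mulrC.
  apply: etrans (gC _ _); apply: (congr1 (GRing.scale _)).
  exact: (wedge_wedgeC b _ Tp).
have fin k s (z z' s1 s2 : ext n forms) : s * s = 1 ->
    k *: (z + s *: z') - s1 - s2 = (k *: z - s1) + s *: (k *: z' - s *: s2).
  move=> ss; rewrite scalerDr scalerBr !scalerA ss scale1r [k * s]mulrC.
  by rewrite addrA; congr (_ - _); rewrite addrAC.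
have pp : (-1) ^+ p * (-1) ^+ p = 1 :> C by rewrite -exprMn mulrNN mulr1 expr1n.
apply: (etrans (fin _ _ _ _ _ _ pp)).
exact: (congr2 (fun z z' => z + (-1) ^+ p *: z') (esym e1) (esym e2)).
Qed.

End LeibnizCE.

(** * The total differential *)

Lemma face_sumZ (K : comNzRingType) (V : lmodType K) k (z z' : V) (F : nat -> V) m s :
  k *: z + \sum_(1 <= i < m) (-1) ^+ i *: (k *: F i) + s *: (k *: z') =
  k *: (z + \sum_(1 <= i < m) (-1) ^+ i *: F i + s *: z').
Proof.
rewrite 2!scalerDr scaler_sumr; congr (_ + _ + _); last by rewrite !scalerA mulrC.
by apply: eq_bigr => i _; rewrite !scalerA mulrC.
Qed.

(** The scalars a, b, c, k stand for the signs with exponents p, q, p' and q p'. *)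
Lemma leibniz_signs (K : comNzRingType) (V : lmodType K) (a b c k : K) (x1 x2 x3 x4 : V) :
  b * b = 1 ->
  k *: x1 + a *: (k *: x2) + (a * c) *: (k *: x3 + b *: (k *: x4)) =
  k *: x1 + a *: ((c * k) *: x3) + (a * b) *: ((b * k) *: x2 + c *: (k *: x4)).
Proof.
move=> bb; rewrite !scalerDr !scalerA -!addrA; congr (_ + _).
rewrite addrCA; congr (_ *: _ + (_ *: _ + _ *: _)); try ring.
by rewrite -(mulrA a) (mulrA b) bb mul1r.
Qed.

Section TotalDifferential.
Variables (R : realType) (n : nat).
Local Notation N := (diffeo0 R n).
Local Notation C := R[i].
Local Notation saff := (saff R n).
Local Notation forms := (forms R n).
Local Notation extC := (extC R n).
Local Notation cochain := (cochain R n).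
Local Notation upsilon := (@upsilon R n).

Variables (actF : saff -> (N -> C) -> N -> C) (coS : saff -> N -> saff)
  (coO : forms -> N -> forms).
Hypothesis td : twisted_data actF coS coO.

Local Notation dCE := (dCE actF coS).
Local Notation bN := (bN coS coO).
Local Notation twist := (twist coS coO).
Local Notation cup := (cup coS coO).
Local Notation star := (star coS coO).
Local Notation bullet := (bullet actF coS).
Local Notation bihom := (@bihom R n).

Lemma bNZ k (c : cochain) : bN (k *: c) = k *: bN c.
Proof.
apply/funext => -[|psi l]; rewrite -[RHS]/(k *: bN c _); first by rewrite scaler0.
rewrite [RHS](esym (face_sumZ _ _ _ (fun i => c (Defs.contract i (psi :: l))) _ _)).
by apply: (congr1 (fun z => _ + _ *: z)); exact: (twistZ td).
Qed.

Lemma totalD_star p q p' q' (u v : forms) (eta zeta : extC) f g :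
  extdeg p eta -> regular_tens q f -> extdeg p' zeta -> regular_tens q' g ->
  let x := pure_tens u eta f in let y := pure_tens v zeta g in
  totalD actF coS coO (star x y) =
  star (totalD actF coS coO x) y + (-1) ^+ (p + q) *: star x (totalD actF coS coO y).
Proof.
move=> ep rf zp rg x y; pose k : C := (-1) ^+ (q * p').
have hx : bihom p q x by exact: bihom_pure.
have hy : bihom p' q' y by exact: bihom_pure.
have hdx : bihom p.+1 q (dCE x).
  by split=> l; [exact: (dCE_supp td hx.1)|exact: (extdeg_dCE td _ hx.2)].
have hdy : bihom p'.+1 q' (dCE y).
  by split=> l; [exact: (dCE_supp td hy.1)|exact: (extdeg_dCE td _ hy.2)].
have hbx : bihom p q.+1 (bN x) by exact: (bihom_bN td hx).
have hby : bihom p' q'.+1 (bN y) by exact: (bihom_bN td hy).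
pose fk l := f l * k.
have rfk : regular_tens q fk by rewrite /fk; under eq_fun do rewrite mulrC; exact: regular_tensZ.
have kx : k *: x = pure_tens u eta fk.
  by apply/funext => l; rewrite -[LHS]/(k *: x l) /x !pure_tensE scalerA mulrC.
have hkx : bihom p q (k *: x) by exact: bihomZ.
have dkx : dCE (k *: x) = k *: dCE x by exact: (dCE_scale_pure td _ _ _ rf).
rewrite (star_bihom td hx hy) -/k -(cupZl td).
rewrite (totalD_bihom td (bihom_cup td hkx hy)) (bN_cup td hkx hy).
rewrite (_ : dCE (cup (k *: x) y) = cup (dCE (k *: x)) y + (-1) ^+ p *: cup (k *: x) (dCE y)).
  rewrite dkx bNZ !(cupZl td) (totalD_bihom td hx) (totalD_bihom td hy).
  rewrite (starDl td) (starDr coS coO) (starZl td) (starZr coS coO).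
  rewrite (star_bihom td hdx hy) (star_bihom td hbx hy) (star_bihom td hx hdy).
  rewrite (star_bihom td hx hby) mulSn mulnS !exprD -/k.
  by apply: leibniz_signs; rewrite -exprMn mulrNN mulr1 expr1n.
rewrite kx; exact: (dCE_cup td _ _ ep rfk zp rg).
Qed.

End TotalDifferential.

Theorem theorem4p7 (R : realType) (n : nat) (n_gt0 : (0 < n)%N)
    (pr : uea (@nbr R n) -> (diffeo0 R n -> R[i]) -> R[i])
    (pr_hopf : hopf_pairing pr) (pr_nondeg : nondegenerate_pairing pr)
    (tri : uea (@nbr R n) -> saff R n -> saff R n)
    (tel : uea (@nbr R n) -> saff R n -> uea (@nbr R n))
    (tri_tel_actions : matched_actions tri tel)
    (actF : saff R n -> (diffeo0 R n -> R[i]) -> diffeo0 R n -> R[i])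
    (actF_dual : dual_action pr tel actF)
    (coS : saff R n -> diffeo0 R n -> saff R n)
    (coS_coaction : s_coaction pr tri coS)
    (coO : forms R n -> diffeo0 R n -> forms R n)
    (coO_coaction : form_coaction pr coO) :
  (forall (p q : nat) (c : cochain R n), bicomplex p q c ->
    [/\ totalD actF coS coO c = dCE actF coS c + (-1) ^+ p *: bN coS coO c,
        bicomplex p.+1 q (dCE actF coS c)
      & bicomplex p q.+1 (bN coS coO c)]) /\
  (forall (p q p' q' : nat)
    (a : fps R n) (eta : extC R n) (f : seq (diffeo0 R n) -> R[i])
    (w : form1 R n) (zeta : extC R n) (g : seq (diffeo0 R n) -> R[i]),
    extdeg p eta -> regular_tens q f ->
    extdeg p' zeta -> regular_tens q' g ->
    let x := pure_tens (a, 0) eta f in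
    let y := pure_tens (0, w) zeta g in
    star coS coO x y = (-1) ^+ (q * p') *: cup coS coO x y /\
    totalD actF coS coO (star coS coO x y) =
      star coS coO (totalD actF coS coO x) y
      + (-1) ^+ (p + q) *: star coS coO x (totalD actF coS coO y)).
Proof.
have td := hopf_twisted_data pr_hopf pr_nondeg tri_tel_actions actF_dual coS_coaction coO_coaction.
split=> [p q c hc|p q p' q' a eta f w zeta g ep rf zp rg x y].
  have [cq cp _] := hc; split; [|exact: (bicomplex_dCE td hc)|exact: (bicomplex_bN td hc)].
  exact: (totalD_bihom td (conj cq cp)).
split; last exact: (totalD_star td _ _ ep rf zp rg).
exact: (star_bihom td (bihom_pure _ ep rf) (bihom_pure _ zp rg)).
Qed.
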